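(* Let $(X,[\ ])$ be a ternary group, let $D$ be an oriented knot diagram in the plane, and let $\gamma\colon \pi_1^T(D)\to X$ be a homomorphism of ternary groups from the ternary knot group of $D$ to $X$. Then the chain $c_\gamma(D)$ is a cycle, i.e. $\partial_1(c_\gamma(D))=0$, so it represents a class in $H_1^N(X)$. This homology class is invariant under all Reidemeister moves: if $D'$ is an oriented knot diagram obtained from $D$ by a single (oriented) Reidemeister move of type I, II or III performed inside a disc $B$, and $\gamma'\colon\pi_1^T(D')\to X$ is the homomorphism corresponding to $\gamma$, that is, the one whose associated coloring of the regions of $D'$ agrees with the coloring of the regions of $D$ associated to $\gamma$ at all points outside $B$ not lying on the diagrams, then $c_\gamma(D)$ and $c_{\gamma'}(D')$ represent the same element of $H_1^N(X)$.
   Context: **Ternary groups.** A ternary group $(X,[\ ])$ is a non-empty set $X$ with a ternary operation $[\ ]\colon X^3\to X$ such that (i) $[[abc]de]=[a[bcd]e]=[ab[cde]]$ for all $a,b,c,d,e\in X$, and (ii) for any quadruple $(a,b,c,d)$ of elements of $X$ satisfying $[abc]=d$, specification of any three elements of the quadruple determines the remaining one uniquely (i.e. $X$ is a ternary quasigroup: given any three of the entries there is exactly one choice of the fourth). The skew element $\bar a$ of $a\in X$ is the unique solution $x$ of $[aax]=a$. One has $[ba\bar a]=[b\bar a a]=[a\bar a b]=[\bar a a b]=b$, $\overline{[abc]}=[\bar c\bar b\bar a]$ and $\bar{\bar a}=a$. A homomorphism of ternary groups is a map preserving $[\ ]$. **Chain complex.** For $n\ge -1$ let $C_n(X)$ be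 the free abelian group on the set $X^{n+2}$ of $(n+2)$-tuples $(x_0,x_1,\ldots,x_n,x_{n+1})$ of elements of $X$, and let $C_{-2}(X)=\mathbb{Z}$. For $n\ge 1$ define $\partial_n\colon C_n(X)\to C_{n-1}(X)$ by $$\begin{aligned}\partial_n(x_0,\ldots,x_{n+1})={}&(x_1,\ldots,x_{n+1})\\&+\sum_{i=1}^n(-1)^i\Big\{([x_0\bar x_ix_{i+1}],[x_1\bar x_ix_{i+1}],\ldots,[x_{i-1}\bar x_ix_{i+1}],\hat x_i,x_{i+1},\ldots,x_{n+1})\\&\qquad+(x_0,\ldots,x_{i-1},\hat x_i,[x_{i-1}\bar x_ix_{i+1}],\ldots,[x_{i-1}\bar x_ix_{n}],[x_{i-1}\bar x_ix_{n+1}])\Big\}\\&+(-1)^{n+1}(x_0,\ldots,x_n),\end{aligned}$$ where $\hat x_i$ denotes a missing entry; also $\partial_0(x_0,x_1)=x_1-x_0$ and $\partial_{-1}(x_0)=0$. In particular $$\partial_1(a,b,c)=(b,c)-([a\bar bc],c)-(a,[a\bar bc])+(a,b),$$ $$\partial_2(a,b,c,d)=(b,c,d)-([a\bar bc],c,d)-(a,[a\bar bc],[a\bar bd])+([a\bar cd],[b\bar cd],d)+(a,b,[b\bar cd])-(a,b,c).$$ This is a chain complex. **Degenerate subcomplex and homology.** For $n\ge1$ let $C_n^D(X)\subset C_n(X)$ be the free abelian group generated by those $(n+2)$-tuples that contain, on three consecutive coordinates, a triple $a,\ b,\ [b\bar ab]$ or a triple $[b\bar ab],\ b,\ a$ for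 some $a,b\in X$; for $n<1$ let $C_n^D(X)=0$. It is known that $\partial_n(C_n^D(X))\subset C_{n-1}^D(X)$. The homology of the quotient complex $C_n^N(X)=C_n(X)/C_n^D(X)$ with the induced differential is denoted $H_*^N(X)$. **Ternary knot group.** For a knot diagram $D$ in the plane, $\pi_1^T(D)$ is the ternary group given by the presentation whose generators correspond to the regions of the complement of $D$ (i.e. the connected components of the plane minus the underlying curve of $D$), with one relation for each crossing: if the four regions around the crossing are, in cyclic order, $x,y,z,w$, with $w$ and $x$ separated by an edge of the under-strand (equivalently, $y$ and $z$ are separated by the other edge of the under-strand), then $w=[x\bar yz]$. A homomorphism $\gamma\colon\pi_1^T(D)\to X$ is the same thing as a coloring of the regions by elements of $X$ (the region with generator $x_i$ gets color $\gamma(x_i)$) that satisfies these relations at all crossings. Colorings of diagrams related by a Reidemeister move correspond bijectively: for each coloring of one diagram there is a unique coloring of the other that agrees with it outside the disc of the move. **The chain $c_\gamma(D)$.** At each crossing, draw the diagram locally so that both strands are oriented upward. The four regions around the crossing are then left, right, bottom (between the two incoming edges) and top (between the two outgoing edges). To a positive crossing (over-strand going from bottom left to top right) assign the chain $+(a,b,c)$, where $a,b,c$ are the colors of the left, bottom and right regions, respectively; the top region then has color $[a\bar bc]$. To a negative crossing (over-strand going from bottom right to top left) assign the chain $-(a,b,c)$, where $a,b,c$ are the colors of the left, top and right regions, respectively; the bottom region then has color $[a\bar bc]$. The chain $c_\gamma(D)\in C_1(X)$ is the sum of these signed triples over all crossings of $D$, and it is also regarded as an element of $C_1^N(X)$.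 *)

(* Defs.v *)
From HB Require Import structures.
From mathcomp Require Import all_boot all_order all_algebra.
From mathcomp Require Import generic_quotient ring_quotient.
From mathcomp Require Import all_classical all_reals all_analysis.
From mathcomp.multinomials Require Import freeg.
Import Order.TTheory GRing.Theory Num.Theory.
Import numFieldNormedType.Exports.

Set Implicit Arguments.
Unset Strict Implicit.
Unset Printing Implicit Defensive.

Local Open Scope classical_set_scope.
Local Open Scope ring_scope.
Local Open Scope quotient_scope.

HB.mixin Record isTernaryGroup X of Choice X := {
  tbr : X -> X -> X -> X;
  tbrA1 : forall a b c d e, tbr (tbr a b c) d e = tbr a (tbr b c d) e;
  tbrA2 : forall a b c d e, tbr a (tbr b c d) e = tbr a b (tbr c d e);
  tbr_solve1 : forall b c d, exists! x, tbr x b c = d;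
  tbr_solve2 : forall a c d, exists! x, tbr a x c = d;
  tbr_solve3 : forall a b d, exists! x, tbr a b x = d;
  tbr_inhabited : inhabited X
}.

#[short(type="ternaryGroupType")]
HB.structure Definition TernaryGroup := {X of isTernaryGroup X & Choice X}.

Lemma skew_subproof (X : ternaryGroupType) (a : X) :
  exists x, tbr a a x == a.
Proof. by have [x [xE _]] := tbr_solve3 a a a; exists x; apply/eqP. Qed.

Definition tskew (X : ternaryGroupType) (a : X) : X :=
  xchoose (skew_subproof a).

Record tgHom (A B : ternaryGroupType) := TgHom {
  tgHom_fun :> A -> B;
  tgHom_tbr : forall a b c,
    tgHom_fun (tbr a b c) = tbr (tgHom_fun a) (tgHom_fun b) (tgHom_fun c)
}.

(* Ternary groups form a variety in the signature ([ ], skew): a ternary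
   semigroup with a unary operation satisfying the four cancellation laws
   tweq_skew1-4 below is a ternary group whose skew operation is the given one.
   The ternary group presented by generators G and relations eqn is therefore
   the algebra of words modulo the congruence they generate. *)
Inductive tword (G : Type) : Type :=
| TGen of G
| TBr of tword G & tword G & tword G
| TSkew of tword G.

Inductive tweq (G : Type) (eqn : tword G -> tword G -> Prop) :
    tword G -> tword G -> Prop :=
| tweq_refl a : tweq eqn a a
| tweq_sym a b : tweq eqn a b -> tweq eqn b a
| tweq_trans a b c : tweq eqn a b -> tweq eqn b c -> tweq eqn a c
| tweq_br a a' b b' c c' : tweq eqn a a' -> tweq eqn b b' -> tweq eqn c c' ->
    tweq eqn (TBr a b c) (TBr a' b' c')
| tweq_skew a a' : tweq eqn a a' -> tweq eqn (TSkew a) (TSkew a')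
| tweq_A1 a b c d e :
    tweq eqn (TBr (TBr a b c) d e) (TBr a (TBr b c d) e)
| tweq_A2 a b c d e :
    tweq eqn (TBr a (TBr b c d) e) (TBr a b (TBr c d e))
| tweq_skew1 a b : tweq eqn (TBr b a (TSkew a)) b
| tweq_skew2 a b : tweq eqn (TBr b (TSkew a) a) b
| tweq_skew3 a b : tweq eqn (TBr a (TSkew a) b) b
| tweq_skew4 a b : tweq eqn (TBr (TSkew a) a b) b
| tweq_rel a b : eqn a b -> tweq eqn a b.

HB.instance Definition _ (G : Type) := gen_eqMixin (tword G).
HB.instance Definition _ (G : Type) := gen_choiceMixin (tword G).

Section Presentation.
Variables (G : Type) (eqn : tword G -> tword G -> Prop).

Definition tweqb : rel (tword G) := fun a b => `[< tweq eqn a b >].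

Lemma tweqb_equiv : equiv_class_of tweqb.
Proof.
split=> [a|a b|b a c].
- by apply/asboolP; apply: tweq_refl.
- by apply/asboolP/asboolP => ?; apply: tweq_sym.
- by move=> /asboolP ab /asboolP bc; apply/asboolP; apply: tweq_trans ab bc.
Qed.

Canonical tweqb_equivRel := EquivRelPack tweqb_equiv.
Canonical tweqb_encModRel := defaultEncModRel tweqb.

Definition presentedTG := {eq_quot tweqb}.
HB.instance Definition _ : EqQuotient _ tweqb presentedTG :=
  EqQuotient.on presentedTG.
HB.instance Definition _ := Choice.on presentedTG.

Definition pgen (g : G) : presentedTG := \pi_presentedTG (TGen g).
Definition pbr (a b c : presentedTG) : presentedTG :=
  \pi_presentedTG (TBr (repr a) (repr b) (repr c)).
Definition pskew (a : presentedTG) : presentedTG :=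
  \pi_presentedTG (TSkew (repr a)).

Lemma pi_tweq a b : tweq eqn a b <-> \pi_presentedTG a = \pi_presentedTG b.
Proof.
split=> [ab|/eqmodP/asboolP //]; by apply/eqmodP/asboolP.
Qed.

Lemma tweq_repr a : tweq eqn (repr (\pi_presentedTG a)) a.
Proof. by apply/pi_tweq; rewrite reprK. Qed.

Lemma pbrE a b c :
  pbr (\pi_presentedTG a) (\pi_presentedTG b) (\pi_presentedTG c) =
  \pi_presentedTG (TBr a b c).
Proof. by apply/pi_tweq; apply: tweq_br; apply: tweq_repr. Qed.

Lemma pskewE a : pskew (\pi_presentedTG a) = \pi_presentedTG (TSkew a).
Proof. by apply/pi_tweq; apply: tweq_skew; apply: tweq_repr. Qed.

Lemma pbrA1 a b c d e : pbr (pbr a b c) d e = pbr a (pbr b c d) e.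
Proof.
elim/quotW: a => a; elim/quotW: b => b; elim/quotW: c => c.
elim/quotW: d => d; elim/quotW: e => e; rewrite (pbrE a b c) (pbrE b c d) !pbrE.
by apply/pi_tweq; apply: tweq_A1.
Qed.

Lemma pbrA2 a b c d e : pbr a (pbr b c d) e = pbr a b (pbr c d e).
Proof.
elim/quotW: a => a; elim/quotW: b => b; elim/quotW: c => c.
elim/quotW: d => d; elim/quotW: e => e; rewrite (pbrE b c d) (pbrE c d e) !pbrE.
by apply/pi_tweq; apply: tweq_A2.
Qed.

Lemma pskew1 a b : pbr b a (pskew a) = b.
Proof.
elim/quotW: a => a; elim/quotW: b => b; rewrite pskewE pbrE.
by apply/pi_tweq; apply: tweq_skew1.
Qed.

Lemma pskew2 a b : pbr b (pskew a) a = b.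
Proof.
elim/quotW: a => a; elim/quotW: b => b; rewrite pskewE pbrE.
by apply/pi_tweq; apply: tweq_skew2.
Qed.

Lemma pskew3 a b : pbr a (pskew a) b = b.
Proof.
elim/quotW: a => a; elim/quotW: b => b; rewrite pskewE pbrE.
by apply/pi_tweq; apply: tweq_skew3.
Qed.

Lemma pskew4 a b : pbr (pskew a) a b = b.
Proof.
elim/quotW: a => a; elim/quotW: b => b; rewrite pskewE pbrE.
by apply/pi_tweq; apply: tweq_skew4.
Qed.

Lemma pbr_solve1 b c d : exists! x, pbr x b c = d.
Proof.
exists (pbr d (pskew c) (pskew b)); split=> [|x <-].
  by rewrite pbrA1 pbrA2 pskew4 pskew2.
by rewrite pbrA1 pbrA2 pskew3 pskew1.
Qed.

Lemma pbr_solve2 a c d : exists! x, pbr a x c = d.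
Proof.
exists (pbr (pskew a) d (pskew c)); split=> [|x <-].
  by rewrite -pbrA1 pskew3 pskew2.
by rewrite -pbrA1 pskew4 pskew1.
Qed.

Lemma pbr_solve3 a b d : exists! x, pbr a b x = d.
Proof.
exists (pbr (pskew b) (pskew a) d); split=> [|x <-].
  by rewrite -pbrA2 -pbrA1 pskew1 pskew3.
by rewrite -pbrA2 -pbrA1 pskew2 pskew4.
Qed.

End Presentation.

(* A presentation without generators presents no (nonempty) ternary
   group: the generating type must be inhabited. *)
HB.instance Definition _ (G : pointedType) (eqn : tword G -> tword G -> Prop) :=
  isTernaryGroup.Build (presentedTG eqn)
    (@pbrA1 G eqn) (@pbrA2 G eqn)
    (@pbr_solve1 G eqn) (@pbr_solve2 G eqn) (@pbr_solve3 G eqn)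
    (inhabits (pgen eqn point)).

(* chain X n is C_n(X) for n >= 0, and bd : C_(n+1)(X) -> C_n(X). *)
Definition chain (X : ternaryGroupType) (n : nat) :=
  {freeg (n.+2.-tuple X) / int}.

Section Boundary.
Variables (X : ternaryGroupType) (n : nat).

Definition bd_tuple (x : n.+3.-tuple X) : chain X n :=
  let x_ k := tnth x (inord k) in
  << [tuple x_ j.+1 | j < n.+2] >>
  + \sum_(1 <= i < n.+2) (-1) ^+ i *:
      (<< [tuple if (j < i)%N then tbr (x_ j) (tskew (x_ i)) (x_ i.+1)
                 else x_ j.+1 | j < n.+2] >>
       + << [tuple if (j < i)%N then x_ j
                   else tbr (x_ i.-1) (tskew (x_ i)) (x_ j.+1) | j < n.+2] >>)
  + (-1) ^+ n.+2 *: << [tuple x_ j | j < n.+2] >>.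

Definition bd (c : chain X n.+1) : chain X n := fglift bd_tuple c.

End Boundary.

Section Degenerate.
Variables (X : ternaryGroupType) (n : nat).

(* The three consecutive coordinates are those of indices j, j+1, j+2 <= n+1;
   for n = 0 there are none, so that CD 0 = 0. *)
Definition degenerate (x : n.+2.-tuple X) : bool :=
  let x_ k := tnth x (inord k) in
  [exists j : 'I_n,
     (x_ j.+2 == tbr (x_ j.+1) (tskew (x_ j)) (x_ j.+1))
     || (x_ j == tbr (x_ j.+1) (tskew (x_ j.+2)) (x_ j.+1))].

Definition CD : {pred chain X n} := fun c => all degenerate (dom c).

Lemma CD_zmod_closed : zmod_closed CD.
Proof.
split=> [|c d /allP cD /allP dD]; first by rewrite unfold_in /CD dom0.
by apply/allP => x /domB; rewrite mem_cat => /orP[/cD|/dD].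
Qed.

HB.instance Definition _ :=
  GRing.isZmodClosed.Build (chain X n) CD CD_zmod_closed.

Definition CN := Quotient.quot (CD : zmodClosed (chain X n)).

End Degenerate.

(* Independent of the choice of the representative, since bd maps CD n.+1 to
   CD n. *)
Definition bdN (X : ternaryGroupType) (n : nat) (z : CN X n.+1) : CN X n :=
  \pi_(CN X n) (bd (repr z)).

(* The element of H_(n+1)^N(X) represented by a cycle z of CN X n.+1, as a
   coset of the group of boundaries. *)
Definition HNclass (X : ternaryGroupType) (n : nat) (z : CN X n.+1) :
    set (CN X n.+1) :=
  [set z + bdN b | b in [set: CN X n.+2]].

Definition piN (X : ternaryGroupType) (n : nat) (c : chain X n) : CN X n :=
  \pi_(CN X n) c.

Notation plane R := (R * R)%type.

Definition cross (R : realType) (u v : plane R) : R := u.1 * v.2 - u.2 * v.1.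

(* Parameters s, t in R are those of the circle R/Z: they denote the same
   parameter when s - t is an integer. *)
Definition double_point (R : realType) (c : R -> plane R) (s t : R) : Prop :=
  c s = c t /\ s - t \isn't a Num.int.

(* A regular closed C^1 curve whose only singularities are finitely many
   transverse double points; dover s tells whether the strand through the
   double point at parameter s is the over-strand, and is irrelevant at other
   parameters. *)
Record knotDiagram (R : realType) := KnotDiagram {
  dcurve : R -> plane R;
  dover : R -> bool;
  dcurve_periodic : forall t, dcurve (t + 1) = dcurve t;
  dover_periodic : forall t, dover (t + 1) = dover t;
  dcurve_derivable : forall t, derivable dcurve t 1;
  dcurve_C1 : continuous (derive1 dcurve);
  dcurve_regular : forall t, derive1 dcurve t != 0;
  dcurve_finite : finite_set [set p : R * R |
    [/\ 0 <= p.1 < 1, 0 <= p.2 < 1 & double_point dcurve p.1 p.2]];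
  dcurve_no_triple : forall s t u,
    double_point dcurve s t -> double_point dcurve s u -> t - u \is a Num.int;
  dcurve_transverse : forall s t, double_point dcurve s t ->
    cross (derive1 dcurve s) (derive1 dcurve t) != 0;
  dover_under : forall s t, double_point dcurve s t -> dover s != dover t
}.

Section Diagram.
Variables (R : realType) (D : knotDiagram R).

(* A crossing is recorded by the parameters of its over- and under-strands. *)
Definition crossings : set (R * R) :=
  [set p | [/\ 0 <= p.1 < 1, 0 <= p.2 < 1, double_point (dcurve D) p.1 p.2
             & dover D p.1]].

Definition complement : set (plane R) := ~` range (dcurve D).

Record region := Region {
  region_set : set (plane R);
  region_setP : exists2 q, complement q &
    region_set = connected_component complement q
}.

HB.instance Definition _ := gen_eqMixin region.
HB.instance Definition _ := gen_choiceMixin region.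

Lemma dcurve_periodicz (t : R) (k : int) : dcurve D (t + k%:~R) = dcurve D t.
Proof.
have natP (n : nat) s : dcurve D (s + n%:R) = dcurve D s.
  elim: n s => [|n IH] s; first by rewrite addr0.
  by rewrite -natr1 addrA dcurve_periodic IH.
case: k => n; first exact: natP.
by rewrite NegzE mulrNz -pmulrn; have := natP n.+1 (t - n.+1%:R); rewrite subrK.
Qed.

Lemma complement_nonempty : exists q, complement q.
Proof.
have cont : continuous (dcurve D).
  by move=> t; apply: differentiable_continuous;
     apply/derivable1_diffP; exact: dcurve_derivable.
have cont1 : {within `[0, 1], continuous (fun t => (dcurve D t).1)}.
  apply: continuous_subspaceT => t.
  by apply: continuous_comp; [exact: cont | exact: cvg_fst].
have [m _ mP] := EVT_max ler01 cont1.
exists ((dcurve D m).1 + 1, 0) => -[t _ /(congr1 fst) /= tE].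
have := mP (t - (Num.floor t)%:~R); rewrite -mulrNz dcurve_periodicz tE.
rewrite gerDl ler10 => notin; apply: notF; apply: notin.
rewrite in_itv /= mulrNz subr_ge0 floor_le /=.
by rewrite lerBlDr addrC -[1]/(1%:~R) -intrD ltW // floorD1_gt.
Qed.

Definition region_default : region :=
  Region (ex_intro2 _ _ (projT1 (cid complement_nonempty))
            (projT2 (cid complement_nonempty)) erefl).

HB.instance Definition _ := isPointed.Build region region_default.

(* At a crossing p, let u and v be the tangent vectors of the over- and the
   under-strand. The four quadrants cut out by the tangent lines are indexed by
   a pair of signs; quadrant p i j is the region that, seen from the crossing,
   lies in the direction of (-1)^i u + (-1)^j v. *)
Definition quadrant (p : R * R) (i j : bool) : region :=
  let u := derive1 (dcurve D) p.1 in
  let v := derive1 (dcurve D) p.2 in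
  xget point [set r : region | \forall e \near 0^'+,
    region_set r (dcurve D p.1 + e *: ((-1) ^+ i *: u + (-1) ^+ j *: v))].

(* The regions w = (i, j), x = (~~ i, j), y = (~~ i, ~~ j), z = (i, ~~ j) are in
   cyclic order around the crossing, and w, x are adjacent along the half of
   the under-strand of direction (-1)^j v. *)
Definition crossing_relation (a b : tword region) : Prop :=
  exists p, crossings p /\ exists i j : bool,
    a = TGen (quadrant p i j) /\
    b = TBr (TGen (quadrant p (~~ i) j)) (TSkew (TGen (quadrant p (~~ i) (~~ j))))
            (TGen (quadrant p i (~~ j))).

Definition pi1T : ternaryGroupType := presentedTG crossing_relation.

Definition region_gen (r : region) : pi1T := pgen crossing_relation r.

End Diagram.

Section CrossingChain.
Variables (R : realType) (X : ternaryGroupType) (D : knotDiagram R).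
Variable gamma : tgHom (pi1T D) X.

(* When both strands point upward, the direction u + v points to the top; a
   crossing is positive (over-strand from bottom left to top right) exactly when
   cross u v > 0, and then u - v points to the right. *)
Definition crossing_chain (p : R * R) : chain X 1 :=
  let col i j := gamma (region_gen (quadrant D p i j)) in
  if 0 < cross (derive1 (dcurve D) p.1) (derive1 (dcurve D) p.2)
  then << [tuple col true false; col true true; col false true] >>
  else - << [tuple col false true; col false false; col true false] >>.

Definition diagram_chain : chain X 1 :=
  \sum_(p \in crossings D) crossing_chain p.

End CrossingChain.

Section Moves.
Variable R : realType.

Definition C1_map (h : plane R -> plane R) : Prop :=
  (forall q, differentiable h q) /\
  (forall v : plane R, continuous (fun q => 'd h q v : plane R)).

Definition oriented_diffeo (h : plane R -> plane R) : Prop :=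
  [/\ C1_map h,
      exists g, [/\ C1_map g, cancel h g & cancel g h]
    & forall q, 0 < cross ('d h q (1, 0) : plane R) ('d h q (0, 1) : plane R)].

Definition std_disc : set (plane R) := [set q | q.1 ^+ 2 + q.2 ^+ 2 <= 4].

Inductive move_type := RI | RII | RIII.

Definition nstrands (m : move_type) : nat :=
  match m with RI => 1 | RII => 2 | RIII => 3 end.

(* The two sides of each move are the pictures in the disc std_disc, for e = 1
   and e = -1, of the generic deformations of a cusp (y^2 = x^3), of a tangency
   of a parabola with a line, and of a triple point of three lines:
   - RI: the nodal arc t |-> (t^2, t^3 - t), and the embedded arc
     t |-> (t^2, t^3 + t);
   - RII: the line y = 0 and the parabola y = x^2 - 1, which meet in two points,
     and the same line and the parabola y = x^2 + 1, which are disjoint;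
   - RIII: the lines y = x and y = -x, and the line y = 1, resp. y = -1. *)
Definition strand (m : move_type) (e : R) (i : nat) (t : R) : plane R :=
  match m, i with
  | RI, _ => (t ^+ 2, t ^+ 3 - e * t)
  | RII, 0 => (t, t ^+ 2 - e)
  | RII, _ => (t, 0)
  | RIII, 0 => (t, t)
  | RIII, 1 => (t, - t)
  | RIII, _ => (t, e)
  end.

(* The closed curve c meets the disc B exactly along the arcs c([a i, b i]),
   i < nstrands m, and an orientation-preserving diffeomorphism of the plane
   carries B to std_disc and these arcs to the strands of the picture
   (m, e); o i tells whether the i-th arc runs along its strand in the
   direction of increasing (false) or decreasing (true) parameter. *)
Definition tangle_picture (c : R -> plane R) (B : set (plane R))
    (m : move_type) (e : R) (a b : nat -> R) (o : nat -> bool) : Prop :=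
  exists h : plane R -> plane R, exists phi : nat -> R -> R,
  [/\ oriented_diffeo h,
      B = h @^-1` std_disc,
      forall t, B (c t) <->
        exists i (k : int), (i < nstrands m)%N /\ a i <= t + k%:~R <= b i
    & forall i, (i < nstrands m)%N ->
      [/\ a i < b i,
          forall t, a i <= t <= b i -> h (c t) = strand m e i (phi i t),
          forall t, a i <= t <= b i ->
            derivable (phi i) t 1 /\ 0 < (-1) ^+ o i * derive1 (phi i) t
        & phi i @` [set t | a i <= t <= b i] =
          [set t | std_disc (strand m e i t)]]].

(* D' is obtained from D by one Reidemeister move of type m inside the disc B.
   The reparametrization theta of the circle makes the relation independent of
   the parametrizations of the oriented curves D and D'; after it, the two
   curves coincide outside B, and their arcs in B correspond to each other with
   their directions. The diffeomorphisms identifying B with std_disc on the two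
   sides may differ: the pictures (m, 1) and (m, -1) do not coincide on the
   boundary of std_disc, but the labels and the directions of the arcs match
   their endpoints. Both directions of each move are included, by the sign of
   e. ht gives the height order of the arcs, the same on both
   sides of the move. *)
Definition reidemeister (m : move_type) (B : set (plane R))
    (D D' : knotDiagram R) : Prop :=
  exists theta : R -> R, let c' := dcurve D' \o theta in
  exists (e : R) (a b : nat -> R) (o : nat -> bool) (ht : nat -> nat),
  [/\ (forall t, derivable theta t 1 /\ 0 < derive1 theta t) /\
        (forall t, theta (t + 1) = theta t + 1),
      (e = 1 \/ e = -1) /\
        (forall i j, (i < nstrands m)%N -> (j < nstrands m)%N ->
           ht i = ht j -> i = j) /\
        (forall i j s t k, (i < nstrands m)%N -> (j < nstrands m)%N ->
           a i <= s <= b i -> a j <= t <= b j -> s - t = k%:~R :> R ->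
           i = j /\ k = 0),
      tangle_picture (dcurve D) B m e a b o /\
        tangle_picture c' B m (- e) a b o,
      forall t, ~ B (dcurve D t) -> c' t = dcurve D t /\
        forall s, double_point (dcurve D) t s -> dover D' (theta t) = dover D t
    & forall i j s t, (i < nstrands m)%N -> (j < nstrands m)%N -> i <> j ->
      a i <= s <= b i -> a j <= t <= b j ->
      (double_point (dcurve D) s t -> dover D s = (ht j < ht i)%N) /\
      (double_point c' s t -> dover D' (theta s) = (ht j < ht i)%N)].

End Moves.

Definition colors_agree_outside (R : realType) (X : ternaryGroupType)
    (B : set (plane R)) (D D' : knotDiagram R)
    (gamma : tgHom (pi1T D) X) (gamma' : tgHom (pi1T D') X) : Prop :=
  forall q, ~ B q -> forall (r : region D) (r' : region D'), region_set r q -> region_set r' q ->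
    gamma (region_gen r) = gamma' (region_gen r').

(* Main.v *)
Require Import Defs.
From HB Require Import structures.
From mathcomp Require Import all_boot all_order all_algebra.
From mathcomp Require Import generic_quotient ring_quotient.
From mathcomp Require Import all_classical all_reals all_analysis.
From mathcomp.multinomials Require Import freeg.
From mathcomp Require Import zify ring lra.
Import Order.TTheory GRing.Theory Num.Theory.
Import numFieldNormedType.Exports.

Set Implicit Arguments.
Unset Strict Implicit.
Unset Printing Implicit Defensive.

Local Open Scope classical_set_scope.
Local Open Scope ring_scope.
Local Open Scope quotient_scope.

(** The proof follows the curve and reads the colours on its two sides.

Let [side_pair t] be the pair of the colours on the left and on the right of the
curve at the parameter [t]. The local form of a regular [C^1] curve shows that
this pair is locally constant away from the double points ([germ_simple]) and
that it is given, next to a double point, by the colours of the quadrants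
([germ_double]): it is a periodic step function of [t]. By the heap relation at
a crossing, the boundary of the chain of the crossing is the sum of the jumps of
[<<left, right>>] at its two passages ([bd_crossing_chain]). Hence the boundary
of the chain of the diagram is the sum of the jumps of a periodic function over
a period, which is zero ([step_jumps], [bd_diagram_chain]).

Consider now a move inside [B]. Outside [B] the two curves coincide up to a
reparametrisation, so that the crossings there have the same chains ([sum_out]).
Inside [B], the arcs of each diagram are diffeomorphic to the strands of a
picture, so that the order of the crossings along each arc and their signs are
those of the picture; the colours are handed on from one crossing to the next
one along the arcs, and the colours at the ends of the arcs are the same for the
two diagrams. For the first move, the colours on the two sides of the kink
force the triple of its crossing to be degenerate ([RI_inside]). For the second
move, the two crossings have the same triple and opposite signs ([RII_inside]).
For the third move, the seven regions of either picture are told by the sides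
of the three strands on which they lie; six of them meet the boundary of [B],
and the small triangles on the two sides of the move are opposite vertices of
the cube of the eight possible positions. The colours of the two pictures
therefore form a family indexed by a cube, and the heap relation of a crossing
holds on each of its faces. The six triples of the faces are the terms of the
boundary of the 2-simplex of the colours met when the top, the middle and the
bottom strand are crossed in turn ([bd_triple]): the two chains differ by a
boundary ([triple_move]). *)

(** * Ternary groups and heaps *)

Section Heap.
Variable X : ternaryGroupType.
Implicit Types a b c d e : X.

Lemma tbr_inj a b : injective (tbr a b : X -> X).
Proof.
move=> x y /= xy; have [z [_ zU]] := tbr_solve3 a b (tbr a b x).
by rewrite -(zU x erefl); apply: zU.
Qed.

Lemma tbr_skew a : tbr a a (tskew a) = a.
Proof. exact/eqP/(xchooseP (skew_subproof a)). Qed.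

Lemma tbr_skewK a b : tbr b (tskew a) a = b.
Proof.
have aaa : tbr a (tskew a) a = a.
  by apply: (@tbr_inj a a); rewrite -tbrA2 tbr_skew.
have [y [<- _]] := tbr_solve1 a a b.
by rewrite tbrA1 tbr_skew.
Qed.

Lemma tbr_Kskew a b : tbr a (tskew a) b = b.
Proof.
have [y [<- _]] := tbr_solve3 a a b.
by rewrite -tbrA2 -tbrA1 tbr_skewK.
Qed.

(** The heap operation of a ternary group; all colours and all faces of the
chain complex are built from it. *)
Definition heap a b c : X := tbr a (tskew b) c.

Lemma heapK a b : heap a b b = a. Proof. exact: tbr_skewK. Qed.

Lemma heapKl a b : heap a a b = b. Proof. exact: tbr_Kskew. Qed.

Lemma heapA a b c d e : heap (heap a b c) d e = heap a b (heap c d e).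
Proof. by rewrite /heap tbrA1 tbrA2. Qed.

Lemma heap_inj3 a b c c' : heap a b c = heap a b c' -> c = c'.
Proof. exact: tbr_inj. Qed.

(** Para-associativity with the middle bracket. *)
Lemma heapAm a b c d e : heap a (heap b c d) e = heap a d (heap c b e).
Proof.
apply: (@heap_inj3 (heap b c d) a).
by rewrite -heapA heapK heapKl -heapA heapK heapA heapKl -heapA heapK heapKl.
Qed.

Lemma heap_inj1 b c a a' : heap a b c = heap a' b c -> a = a'.
Proof. by move=> /(congr1 (fun w => heap w c b)); rewrite /= !heapA !heapKl !heapK. Qed.

Lemma heap_inj2 a c b b' : heap a b c = heap a b' c -> b = b'.
Proof.
by move=> /(congr1 (fun w => heap c w a)); rewrite /= !heapAm !heapKl !heapK.
Qed.

End Heap.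

(** * The chain complex in low degrees *)

(* Identities of chains are checked coefficientwise. *)
Ltac chain_ring :=
  apply/eqP/freeg_eqP => ?; rewrite !(coeffD, coeffN, coeff0); ring.

Section Chains.
Variable X : ternaryGroupType.
Implicit Types a b c d : X.
Local Notation h := (@heap X).

Lemma bdU n (x : n.+3.-tuple X) : bd << x >> = bd_tuple x.
Proof. by rewrite /bd liftU scale1r. Qed.

HB.instance Definition _ n := GRing.isZmodMorphism.Build _ _ (@bd X n)
  (@lift_is_additive _ _ _ (@bd_tuple X n)).

Lemma bd_simplex3 a b c :
  bd (<< [tuple a; b; c] >> : chain X 1) =
  << [tuple b; c] >> - << [tuple h a b c; c] >> - << [tuple a; h a b c] >>
  + << [tuple a; b] >>.
Proof.
rewrite bdU /bd_tuple big_nat1 expr1 scaleN1r sqrrN expr1n scale1r opprD !addrA.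
congr (<< _ >> - << _ >> - << _ >> + << _ >>); apply: eq_from_tnth => i;
  by rewrite !tnth_mktuple; case: i => [[|[|i]] //= ?];
     rewrite !(tnth_nth a) /= ?inordK.
Qed.

Lemma bd_simplex4 a b c d :
  bd (<< [tuple a; b; c; d] >> : chain X 2) =
  << [tuple b; c; d] >> - << [tuple h a b c; c; d] >>
  - << [tuple a; h a b c; h a b d] >> + << [tuple h a c d; h b c d; d] >>
  + << [tuple a; b; h b c d] >> - << [tuple a; b; c] >>.
Proof.
rewrite bdU /bd_tuple big_nat_recr // big_nat1 /= expr1 sqrrN expr1n exprS.
rewrite sqrrN expr1n mulr1 !scaleN1r scale1r opprD !addrA.
congr (<< _ >> - << _ >> - << _ >> + << _ >> + << _ >> - << _ >>);
  apply: eq_from_tnth => i;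
  by rewrite !tnth_mktuple; case: i => [[|[|[|i]]] //= ?];
     rewrite !(tnth_nth a) /= ?inordK.
Qed.

Lemma degenerate3 a b c :
  degenerate [tuple a; b; c] = (c == h b a b) || (a == h b c b).
Proof.
apply/existsP/idP => [[j]|]; first by rewrite !(tnth_nth a) !inordK ?ord1.
by exists ord0; rewrite !(tnth_nth a) !inordK.
Qed.

Lemma degenerate4 a b c d :
  degenerate [tuple a; b; c; d] =
  degenerate [tuple a; b; c] || degenerate [tuple b; c; d].
Proof.
rewrite !degenerate3; apply/existsP/orP => [[[[|[|//]] ?]]|[H|H]].
- by rewrite !(tnth_nth a) !inordK //; left.
- by rewrite !(tnth_nth a) !inordK //; right.
- by exists ord0; rewrite !(tnth_nth a) !inordK.
- by exists (inord 1); rewrite !(tnth_nth a) !inordK.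
Qed.

Lemma CDU n (x : n.+2.-tuple X) : degenerate x -> << x >> \in @CD X n.
Proof. by move=> dx; rewrite unfold_in /CD domU1 /= dx. Qed.

Lemma CDZ n (k : int) (c : chain X n) : c \in @CD X n -> k *: c \in @CD X n.
Proof. by move=> /allP cD; apply/allP => x /domZ_subset/cD. Qed.

Lemma bdE n (c : chain X n.+1) : bd c = \sum_(x <- dom c) coeff x c *: bd << x >>.
Proof.
rewrite -[in LHS](freeg_sumE c) raddf_sum; apply: eq_bigr => x _.
by rewrite bdU /= /bd liftU.
Qed.

Lemma tuple3P (x : 3.-tuple X) : exists a b c, x = [tuple a; b; c].
Proof.
case: x => [[|a [|b [|c [|]]]] //= x3].
by exists a, b, c; apply: val_inj.
Qed.

Lemma tuple4P (x : 4.-tuple X) : exists a b c d, x = [tuple a; b; c; d].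
Proof.
case: x => [[|a [|b [|c [|d [|]]]]] //= x4].
by exists a, b, c, d; apply: val_inj.
Qed.

Lemma bd_degenerate3 (c : chain X 1) : c \in @CD X 1 -> bd c = 0.
Proof.
move=> /allP cD; rewrite bdE big_seq big1 // => x /cD.
have [p [q [r ->]]] := tuple3P x; rewrite degenerate3 => /orP[] /eqP ->.
  rewrite bd_simplex3 -heapA heapK heapKl subrr sub0r addNr scaler0 //.
rewrite bd_simplex3 heapA heapKl heapK.
by rewrite subrr sub0r addNr scaler0.
Qed.

(** Two of the six faces of a degenerate tuple are degenerate, and the other four
cancel in pairs. *)
Lemma bd_degenerate4 (c : chain X 2) : c \in @CD X 2 -> bd c \in @CD X 1.
Proof.
move=> /allP cD; rewrite bdE big_seq; apply: rpred_sum => x /cD dx; apply: CDZ.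
have [p [q [r [s xE]]]] := tuple4P x; move: dx; rewrite {x}xE => dx.
have cancel1 (A B C D E F : chain X 1) : D \in @CD X 1 -> F \in @CD X 1 ->
    A = B -> C = E -> A - B - C + D + E - F \in @CD X 1.
  move=> DD FD -> ->; rewrite [X in X \in _](_ : _ = D - F) ?rpredB //.
  by chain_ring.
have cancel2 (A B C D E F : chain X 1) : A \in @CD X 1 -> C \in @CD X 1 ->
    B = D -> E = F -> A - B - C + D + E - F \in @CD X 1.
  move=> DD FD -> ->; rewrite [X in X \in _](_ : _ = A - C) ?rpredB //.
  by chain_ring.
move: dx; rewrite degenerate4 => /orP[] dx; rewrite bd_simplex4.
- have [Er Es] : h p q r = q /\ h p q s = h q r s.
    move: dx; rewrite degenerate3 => /orP[] /eqP ->.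
      by rewrite heapAm heapKl -heapA heapK heapKl.
    by rewrite !heapA !heapKl heapK.
  apply: cancel1; rewrite ?CDU ?Er ?Es //.
  move: dx; rewrite !degenerate3 => /orP[] /eqP E; apply/orP; [left|right].
    by rewrite -Es {1}E (heapAm p q) heapAm heapKl -heapA heapK heapKl.
  by rewrite {1}E !heapA heapKl.
- have [Er Ep] : h q r s = r /\ h p r s = h p q r.
    move: dx; rewrite degenerate3 => /orP[] /eqP ->.
      by rewrite -!heapA !heapK heapKl.
    by rewrite heapA heapKl heapK heapAm heapK.
  apply: cancel2; rewrite ?CDU ?Er ?Ep //.
  move: dx; rewrite !degenerate3 => /orP[] /eqP E; apply/orP; [left|right].
    by rewrite [X in _ == X]heapA -[h r p _]heapA heapK -E.
  by rewrite heapAm -[h q p _]heapA heapK heapKl heapA -E heapK.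
Qed.

End Chains.

(** * Homology classes *)

Section HomologyClass.
Variable X : ternaryGroupType.

Lemma piN_eq n (c d : chain X n) : (piN c == piN d) = (c - d \in @CD X n).
Proof. by rewrite /piN -Quotient.equivE eqmodE. Qed.

Lemma bdN_cycle (c : chain X 1) : bd c = 0 -> bdN (piN c) = 0.
Proof.
move=> c0; rewrite /bdN (_ : bd _ = 0) ?raddf0 //.
have /bd_degenerate3 : repr (piN c) - c \in @CD X 1.
  by rewrite -piN_eq /piN reprK.
by move/eqP; rewrite raddfB /= c0 subr0 => /eqP.
Qed.

(** The quotient complex is handled through representatives: its boundary map is
well defined by [bd_degenerate4]. *)
Lemma HNclass_homologous (c d : chain X 1) (w : chain X 2) :
  c - d - bd w \in @CD X 1 -> HNclass (piN c) = HNclass (piN d).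
Proof.
have sub (x y : chain X 1) v : x - y - bd v \in @CD X 1 ->
    HNclass (piN x) `<=` HNclass (piN y).
  move=> xyD _ [b _ <-]; exists (piN (repr b + v)) => //.
  rewrite /bdN /piN -!raddfD; apply/eqP; rewrite eq_sym -/(piN _) -/(piN _).
  rewrite piN_eq; set r := repr (piN _).
  have /bd_degenerate4 : r - (repr b + v) \in @CD X 2.
    by rewrite -piN_eq /piN reprK.
  rewrite raddfB raddfD /= => rD.
  rewrite (_ : _ - _ = (x - y - bd v) - (bd r - (bd (repr b) + bd v))).
    exact: rpredB.
  by chain_ring.
move=> cdD; apply/seteqP; split; first exact: sub cdD.
apply: (sub _ _ (- w)); rewrite raddfN /= (_ : _ - _ = - (c - d - bd w)) ?rpredN //.
by chain_ring.
Qed.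

End HomologyClass.

(** * Plane vectors *)

Section Cross.
Variable R : realType.
Implicit Types (u v w : plane R) (k x y z : R).

Lemma plane_eq u v : u.1 = v.1 -> u.2 = v.2 -> u = v.
Proof. by case: u v => [? ?] [? ?] /= -> ->. Qed.

Let coordD u v : ((u + v).1 = u.1 + v.1) * ((u + v).2 = u.2 + v.2).
Proof. by []. Qed.

Let coordN u : ((- u).1 = - u.1) * ((- u).2 = - u.2).
Proof. by []. Qed.

Let coordZ k u : ((k *: u).1 = k * u.1) * ((k *: u).2 = k * u.2).
Proof. by []. Qed.

Definition coordE := (coordD, coordN, coordZ).

Lemma crossDl u v w : cross (u + v) w = cross u w + cross v w.
Proof. by rewrite /cross /=; ring. Qed.

Lemma crossDr u v w : cross w (u + v) = cross w u + cross w v.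
Proof. by rewrite /cross /=; ring. Qed.

Lemma crossZl k u v : cross (k *: u) v = k * cross u v.
Proof. by rewrite /cross !coordE; ring. Qed.

Lemma crossZr k u v : cross u (k *: v) = k * cross u v.
Proof. by rewrite /cross !coordE; ring. Qed.

Lemma crossNl u v : cross (- u) v = - cross u v.
Proof. by rewrite /cross /=; ring. Qed.

Lemma crossNr u v : cross u (- v) = - cross u v.
Proof. by rewrite /cross /=; ring. Qed.

Lemma crossC u v : cross u v = - cross v u.
Proof. by rewrite /cross /=; ring. Qed.

Lemma cross_id u : cross u u = 0.
Proof. by rewrite /cross mulrC subrr. Qed.

Lemma norm_plane_le u k : (`|u| <= k) = (`|u.1| <= k) && (`|u.2| <= k).
Proof. by rewrite prod_normE ge_max. Qed.

Lemma cross_le u v : `|cross u v| <= 2 * (`|u| * `|v|).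
Proof.
have /andP[u1 u2] : (`|u.1| <= `|u|) && (`|u.2| <= `|u|) by rewrite -norm_plane_le.
have /andP[v1 v2] : (`|v.1| <= `|v|) && (`|v.2| <= `|v|) by rewrite -norm_plane_le.
rewrite /cross (le_trans (ler_normB _ _)) // !normrM mulr2n mulrDl mul1r.
by rewrite lerD // ler_pM.
Qed.

(** A chord of a curve that is nearly tangent to [u] is not parallel to a
vector that is far from the direction of [u]. *)
Lemma chord_not_parallel k r e u n (w : plane R) :
  `|w - r *: u| <= k * `|r| -> w = e *: n ->
  2 * (k * `|n|) < `|cross u n| -> r = 0.
Proof.
move=> wr wn kn; apply: contraPeq kn => r0; apply/negP; rewrite -leNgt.
have : `|cross (w - r *: u) n| <= 2 * (k * `|r| * `|n|).
  by rewrite (le_trans (cross_le _ _)) // ler_pM2l // ler_wpM2r.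
rewrite crossDl crossNl crossZl wn crossZl cross_id mulr0 sub0r normrN normrM.
have r1 : 0 < `|r| by rewrite normr_gt0.
by rewrite -mulrA mulrCA [X in _ <= X](_ : _ = `|r| * (2 * (k * `|n|)));
  [rewrite ler_pM2l | ring].
Qed.

(** A point lying, up to a small error, in the sector spanned by [U] and
[U + V] is not close to the line spanned by [V]. *)
Lemma sector_off_line k M x y z (U V e1 e2 : plane R) :
  `|U| <= M -> `|V| <= M -> 8 * (k * M) <= `|cross U V| -> 0 <= k ->
  cross U V != 0 ->
  `|e1| <= k * `|z| -> `|e2| <= k * x -> 0 < y <= x ->
  z *: V + e1 = x *: U + e2 + y *: V -> False.
Proof.
move=> UM VM kM k0 d0 e1z e2x /andP[y0 yx] E.
have x0 : 0 < x by exact: lt_le_trans yx.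
have M0 : 0 <= M by exact: le_trans UM.
set d := `|cross U V| in kM; have dgt0 : 0 < d by rewrite normr_gt0.
have le W : `|W| <= M -> `|cross (e1 - e2) W| <= d / 4 * (`|z| + x).
  move=> WM; rewrite (le_trans (cross_le _ _)) //.
  have : `|e1 - e2| * `|W| <= (k * (`|z| + x)) * M.
    rewrite ler_pM // (le_trans (ler_normB _ _)) // mulrDr.
    exact: lerD.
  have := ler_wpM2r (_ : 0 <= `|z| + x) kM.
  rewrite addr_ge0 ?(ltW x0) // => /(_ isT); lra.
have e12 : e1 - e2 = x *: U + (y - z) *: V.
  move: (congr1 fst E) (congr1 snd E); rewrite !coordE => E1 E2.
  by apply: plane_eq; rewrite !coordE; lra.
have := le _ VM; rewrite e12 crossDl !crossZl cross_id mulr0 addr0 normrM.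
rewrite -/d (gtr0_norm x0) => h1.
have := le _ UM; rewrite e12 crossDl !crossZl cross_id mulr0 add0r normrM.
rewrite (crossC V U) normrN -/d => h2.
have xz : x <= (`|z| + x) / 4 by rewrite -(ler_pM2r dgt0); lra.
have yz : `|y - z| <= (`|z| + x) / 4 by rewrite -(ler_pM2r dgt0); lra.
have : `|z| <= `|y| + `|y - z|.
  by rewrite -[X in `|X| <= _](subKr y) ler_normB.
rewrite (gtr0_norm y0); lra.
Qed.

End Cross.

(** * Neighbourhoods in metric form *)

Section Near.
Variable R : realType.
Implicit Types (P : set R) (t e : R).

Lemma near_dist t P : (\forall x \near t, P x) <->
  exists2 e : R, 0 < e & forall x : R, `|x - t| < e -> P x.
Proof.
rewrite nbhs_normP; split=> [[e /= e0 eP]|[e e0 eP]]; exists e => //= x /= xt;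
  by apply: eP; rewrite /= distrC.
Qed.

Lemma near_right0 P : (\forall e \near 0^'+, P e) <->
  exists2 d : R, 0 < d & forall e : R, 0 < e < d -> P e.
Proof.
rewrite near_withinE; split=> [/near_dist|] [d d0 dP].
  exists d => // e.
  by move=> /andP[e0 ed]; apply: dP => //; rewrite subr0 gtr0_norm.
apply/near_dist; exists d => // e.
by rewrite subr0 => ed e0; apply: dP; rewrite e0 (le_lt_trans (ler_norm _)).
Qed.

End Near.

(** * Local form of a regular curve *)

(** The representative of a parameter of the circle between 0 and 1. *)
Definition frac (R : realType) (t : R) : R := t - (Num.floor t)%:~R.

Lemma frac_itv (R : realType) (t : R) : 0 <= frac t < 1.
Proof. by rewrite /frac; have := floor_itv t; rewrite intrD => /andP[]; lra. Qed.

(** Congruent parameters of one period are equal. *)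
Lemma period_eq (R : realType) (s t : R) : 0 <= s < 1 -> 0 <= t < 1 ->
  s - t \is a Num.int -> s = t.
Proof.
move=> /andP[s0 s1] /andP[t0 t1] /intrP[k kE]; apply/eqP; rewrite -subr_eq0 kE.
have : -1%:~R < k%:~R :> R /\ k%:~R < 1%:~R :> R by rewrite -kE; split; lra.
by rewrite -mulrNz !ltr_int => -[]; case: k {kE} => [[|n]|n].
Qed.

Section Curve.
Variables (R : realType) (D : knotDiagram R).
Local Notation c := (dcurve D).
Local Notation c' := (derive1 (dcurve D)).

Lemma dcurve_continuous : continuous c.
Proof.
by move=> t; apply: differentiable_continuous; apply/derivable1_diffP;
   exact: dcurve_derivable.
Qed.

(** The derivative of a plane curve is computed coordinatewise. *)
Lemma is_derive_coord (f : R -> plane R) (t : R) : derivable f t 1 ->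
  is_derive t 1 (fun x => (f x).1) (derive1 f t).1 /\
  is_derive t 1 (fun x => (f x).2) (derive1 f t).2.
Proof.
move=> df; rewrite derive1E; split.
  have H : (fun h => h^-1 *: ((f (h *: 1 + t)).1 - (f t).1)) @ 0^' -->
      ('D_1 f t).1.
    exact: (cvg_comp _ _ df cvg_fst).
  by split; [apply/cvg_ex; eexists; exact: H | exact: cvg_lim H].
have H : (fun h => h^-1 *: ((f (h *: 1 + t)).2 - (f t).2)) @ 0^' -->
    ('D_1 f t).2.
  exact: (cvg_comp _ _ df cvg_snd).
by split; [apply/cvg_ex; eexists; exact: H | exact: cvg_lim H].
Qed.

Lemma MVT_dist (f df : R -> R) (a k t0 eta : R) :
  (forall t : R, is_derive t (1 : R) f (df t)) ->
  (forall t, `|t - t0| < eta -> `|df t - a| <= k) ->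
  forall s t, `|s - t0| < eta -> `|t - t0| < eta ->
  `|f t - f s - (t - s) * a| <= k * `|t - s|.
Proof.
move=> fd dfa s t; wlog st : s t / s <= t => [H sE tE|sE tE].
  have [/H|/ltW/H] := leP s t; first exact.
  move=> /(_ tE sE); rewrite (distrC s) [X in `|X|](_ : _ =
    - (f t - f s - (t - s) * a)); [by rewrite normrN | by ring].
have [|z zst ->] := MVT_segment st (fun x _ => fd x).
  apply: continuous_subspaceT => x; apply: differentiable_continuous.
  by apply/derivable1_diffP; exact: ex_derive.
rewrite [X in `|X|](_ : _ = (df z - a) * (t - s)); last by ring.
rewrite normrM ler_wpM2r // dfa //.
move: zst sE tE; rewrite in_itv /= !ltr_norml; lra.
Qed.

(** A [C^1] curve is strictly differentiable. *)
Lemma dcurve_strict (t0 k : R) : 0 < k -> exists2 eta : R, 0 < eta &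
  forall s t, `|s - t0| < eta -> `|t - t0| < eta ->
  `|c t - c s - (t - s) *: c' t0| <= k * `|t - s|.
Proof.
move=> k0; have := @dcurve_C1 _ D t0.
move=> /cvgr_dist_le/(_ k k0)/near_dist[eta eta0 etaP].
exists eta => // s t sE tE; rewrite norm_plane_le.
have H i : `|i - t0| < eta -> `|(c' i).1 - (c' t0).1| <= k /\
                              `|(c' i).2 - (c' t0).2| <= k.
  by move=> /etaP; rewrite norm_plane_le (distrC (c' i).1) (distrC (c' i).2);
     move=> /andP.
apply/andP; split.
  by apply: (@MVT_dist (fun x => (c x).1) (fun x => (c' x).1) _ _ t0 eta) =>
     [x|x /H[]||] //; have [] := is_derive_coord (@dcurve_derivable _ D x).
by apply: (@MVT_dist (fun x => (c x).2) (fun x => (c' x).2) _ _ t0 eta) =>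
   [x|x /H[]||] //; have [] := is_derive_coord (@dcurve_derivable _ D x).
Qed.

Lemma dcurve_frac (t : R) : c (frac t) = c t.
Proof. by rewrite /frac -mulrNz dcurve_periodicz. Qed.

(** By compactness of the circle, a point of the curve close to [P] has a
parameter close to a parameter of [P]. *)
Lemma dcurve_near_preimage (P : plane R) (eta : R) : 0 < eta ->
  exists2 d : R, 0 < d & forall t, `|c t - P| < d ->
  exists z, c z = P /\ `|t - z| < eta.
Proof.
move=> eta0; pose good t := exists z, c z = P /\ `|t - z| < eta.
have /compact_near_coveringP H : compact (`[0, 1] : set R).
  exact: segment_compact.
have /near_right0[d d0 dP] : \forall d \near (0 : R)^'+,
    `[0, 1] `<=` (fun t : R => `|c t - P| < d -> good t).
  apply: (H R) => t _; have [ct|/eqP ct] := pselect (c t = P).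
    exists ([set x | `|x - t| < eta], setT) => [|[x d] [/= xt _] _]; last first.
      by exists t.
    by split => /=; [apply/near_dist; exists eta | exact: filterT].
  have d0 : 0 < `|c t - P| / 2 by rewrite divr_gt0 // normr_gt0 subr_eq0.
  exists ([set x | `|c t - c x| < `|c t - P| / 2], [set d | d < `|c t - P| / 2]).
    split => /=; last exact: nbhs_right_lt.
    by move: (@dcurve_continuous t) => /cvgrPdist_lt/(_ _ d0).
  move=> [x d] [/= xt dt] xd; suff : `|c t - P| < `|c t - P| by rewrite ltxx.
  rewrite -[X in `|X| < _](subrKA (c x)) (le_lt_trans (ler_normD _ _)) //.
  by rewrite [ltRHS](splitr (`|c t - P|)) ltrD // (lt_trans xd).
exists (d / 2) => [|t td]; first by rewrite divr_gt0.
have /andP[t0 t1] := frac_itv t; have := dP (d / 2) _ (frac t).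
rewrite dcurve_frac => /(_ _ _ td) [||z [zP tz]].
- by apply/andP; split; lra.
- by rewrite /= in_itv /= t0 ltW.
exists (z + (Num.floor t)%:~R); rewrite dcurve_periodicz zP; split => //.
by move: tz; rewrite /frac opprD addrCA addrC.
Qed.

End Curve.

(** * Regions along a curve *)

Section Regions.
Variables (R : realType) (D : knotDiagram R).
Local Notation c := (dcurve D).
Local Notation c' := (derive1 (dcurve D)).
Implicit Types (r : region D) (P q n v w : plane R) (t s e : R).

Lemma region_eq r r' q : region_set r q -> region_set r' q -> r = r'.
Proof.
have component S : (exists2 p, complement D p &
    S = connected_component (complement D) p) -> S q ->
    S = connected_component (complement D) q.
  by move=> [p _ ->] /same_connected_component.
case: r r' => [S SP] [S' SP'] /= Sq S'q.
have SS' : S = S' by rewrite (component _ SP Sq) -(component _ SP' S'q).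
by subst S'; rewrite (Prop_irrelevance SP SP').
Qed.

(** The region that contains a point off the curve. *)
Definition region_at q : region D :=
  match pselect (complement D q) with
  | left qc => Region (ex_intro2 _ _ q qc erefl)
  | right _ => point
  end.

Lemma region_at_mem q : complement D q -> region_set (region_at q) q.
Proof.
by rewrite /region_at; case: pselect => // qc _; exact: connected_component_refl.
Qed.

Lemma region_atE r q : complement D q -> region_set r q -> region_at q = r.
Proof. by move=> /region_at_mem qc rq; exact: region_eq qc rq. Qed.

(** Two points off the curve lie in one region as soon as a path joins them off
the curve; the path follows the curve and moves away from it linearly. *)
Lemma region_at_path (t b p k : R) v w :
  (forall l, 0 <= l <= 1 ->
    complement D (c (t + l * b) + (p + l * k) *: (v + l *: w))) ->
  region_at (c t + p *: v) = region_at (c (t + b) + (p + k) *: (v + w)).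
Proof.
set f := fun l : R => c (t + l * b) + (p + l * k) *: (v + l *: w).
move=> fc; have -> : c t + p *: v = f 0.
  by rewrite /f !mul0r scale0r !addr0.
have -> : c (t + b) + (p + k) *: (v + w) = f 1 by rewrite /f !mul1r scale1r.
have cont : continuous f.
  move=> l; apply: cvgD; last apply: cvgZ.
  - apply: (@cvg_comp _ _ _ (fun l => t + l * b) c); last exact: dcurve_continuous.
    by apply: cvgD; [exact: cvg_cst | apply: cvgMr_tmp; exact: cvg_id].
  - by apply: cvgD; [exact: cvg_cst | apply: cvgMr_tmp; exact: cvg_id].
  - by apply: cvgD; [exact: cvg_cst | apply: cvgZr_tmp; exact: cvg_id].
have f0 : complement D (f 0) by apply: fc; rewrite lexx ler01.
have f1 : complement D (f 1) by apply: fc; rewrite lexx ler01.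
apply: region_atE => //.
suff H : connected_component (complement D) (f 1) (f 0).
  rewrite /region_at; case: pselect => //= _.
exists (f @` `[0, 1]); last first.
  by exists 0 => //=; rewrite in_itv /= lexx ler01.
split.
- by exists 1 => //=; rewrite in_itv /= lexx ler01.
- by move=> _ [l l01 <-]; apply: fc; move: l01; rewrite /= in_itv.
- apply: connected_continuous_connected; first exact: segment_connected.
  exact: continuous_subspaceT.
Qed.

(** The region seen from [P] in the direction [n]. *)
Definition germ P n : region D :=
  xget point [set r | \forall e \near 0^'+, region_set r (P + e *: n)].

Lemma germE P n r d : 0 < d ->
  (forall e, 0 < e < d -> region_set r (P + e *: n)) -> germ P n = r.
Proof.
move=> d0 dP; have rn : \forall e \near 0^'+, region_set r (P + e *: n).
  by apply/near_right0; exists d.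
rewrite /germ; case: xgetP => [r' -> r'n|/(_ r)//].
move/near_right0: r'n => [d' d'0 d'P]; pose e := Num.min d d' / 2.
have /andP[ed ed'] : (e < d) && (e < d').
  rewrite -lt_min /e; have : 0 < Num.min d d' by rewrite lt_min d0.
  by move: (Num.min _ _) => m; lra.
have e0 : 0 < e by rewrite divr_gt0 // lt_min d0.
by apply: (@region_eq _ _ (P + e *: n)); [apply: d'P | apply: dP]; rewrite e0.
Qed.

(** A parameter of a double point. *)
Definition double_param t := exists s, double_point c t s.

Lemma simple_preimage t s : ~ double_param t -> c s = c t ->
  s - t \is a Num.int.
Proof.
move=> tN st; rewrite -[_ - _]opprB rpredN; apply/negPn/negP => ts.
by apply: tN; exists s.
Qed.

Lemma convex_pos (a b l : R) : 0 < a -> 0 < b -> 0 <= l <= 1 ->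
  Num.min a b <= a + l * (b - a).
Proof. by move=> a0 b0 /andP[l0 l1]; rewrite ge_min; case: (leP a b) => ab; nra. Qed.

(** Near a simple point the curve leaves one of its sides free: the directions
between [n] and [n'], on the side told by the sign of [s], never meet it. *)
Lemma simple_side_complement t0 (s : R) n n' : ~ double_param t0 ->
  0 < s * cross (c' t0) n -> 0 < s * cross (c' t0) n' ->
  exists2 d : R, 0 < d & forall t e l, `|t - t0| < d -> 0 < e < d -> 0 <= l <= 1 ->
  complement D (c t + e *: (n + l *: (n' - n))).
Proof.
move=> t0N nP n'P; set u := c' t0 in nP n'P.
pose m := Num.min (s * cross u n) (s * cross u n').
have m0 : 0 < m by rewrite lt_min nP.
pose M := `|n| + `|n'| + 1; have M0 : 0 < M by rewrite ltr_wpDl // addr_ge0.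
have nM l : 0 <= l <= 1 -> `|n + l *: (n' - n)| < M.
  move=> /andP[l0 l1]; rewrite (_ : _ + _ = (1 - l) *: n + l *: n'); last first.
    by rewrite scalerBl scale1r scalerBr addrAC addrA.
  rewrite (le_lt_trans (ler_normD _ _)) // !normrZ !ger0_norm ?subr_ge0 //.
  have := normr_ge0 n; have := normr_ge0 n'; rewrite /M; nra.
(* With this bound on the error of the tangent, no chord of the curve has the
   direction of a combination of [n] and [n'], by [chord_not_parallel]. *)
pose k := m / ((`|s| + 1) * M * 4).
have s1 : 0 < `|s| + 1 by rewrite ltr_wpDl.
have k0 : 0 < k by rewrite divr_gt0 // !mulr_gt0.
have [eta eta0 strict] := dcurve_strict D t0 k0.
have [d d0 pre] := @dcurve_near_preimage _ D (c t0) eta eta0.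
have /near_dist[d' d'0 cd'] : \forall t \near t0, `|c t - c t0| < d / 2.
  have := @dcurve_continuous _ D t0; move=> /cvgrPdist_lt/(_ (d / 2)).
  rewrite divr_gt0 // => /(_ isT); apply: filterS => t; by rewrite distrC.
pose d1 := Num.min eta (Num.min d' (d / 2 / M)).
have d10 : 0 < d1 by rewrite !lt_min eta0 d'0 !divr_gt0.
exists d1 => // t e l; rewrite !lt_min => /and3P[teta td' _].
move=> /andP[e0 /and3P[eeta ed' edM]] l01 [t' _ t'E].
set N := n + l *: (n' - n) in t'E.
have : `|c t' - c t0| < d.
  rewrite t'E addrAC (le_lt_trans (ler_normD _ _)) //.
  rewrite [ltRHS]splitr ltrD ?cd' // normrZ gtr0_norm //.
  move: edM; rewrite ltr_pdivlMr // => edM; apply: le_lt_trans edM.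
  by rewrite ler_pM2l // ltW // nM.
case/pre => z [/(simple_preimage t0N)/intrP[j zj] t'z].
have t'j : `|(t' - j%:~R) - t0| < eta.
  by rewrite -zj (_ : _ - t0 = t' - z) //; ring.
have mN : m <= s * cross u N.
  rewrite (_ : _ * _ = s * cross u n + l * (s * cross u n' - s * cross u n)).
    exact: convex_pos.
  by rewrite /N !(crossDr, crossZr, crossNr); ring.
have kM : k * M * (`|s| + 1) * 4 = m.
  by rewrite /k; field; rewrite !gt_eqF.
have cN : m <= `|s| * `|cross u N| by rewrite -normrM (le_trans mN) ?ler_norm.
have r0 : t' - j%:~R - t = 0.
  apply: (@chord_not_parallel _ k _ e u N (e *: N)) => //.
    have := strict _ _ teta t'j; rewrite -mulrNz dcurve_periodicz t'E.
    by rewrite (addrC (c t)) addrK.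
  have NM : k * `|N| * (`|s| + 1) <= k * M * (`|s| + 1).
    by rewrite ler_wpM2r ?(ltW s1) // ler_wpM2l ?(ltW k0) // ltW // nM.
  have := normr_ge0 (cross u N); rewrite -(ltr_pM2r s1); lra.
have t'jE : t' - j%:~R = t by apply/eqP; rewrite -subr_eq0 r0.
have : e *: N = 0.
  apply: (@addrI _ (c t)); rewrite addr0 -t'E -[in RHS]t'jE -mulrNz.
  by rewrite dcurve_periodicz.
move/eqP; rewrite scaler_eq0 gt_eqF //= => /eqP N0.
by move: mN; rewrite N0 /cross !mulr0 subrr mulr0 leNgt m0.
Qed.

(** Near a simple point, all the points on one side of the curve and close to
it lie in one region. *)
Lemma germ_simple t0 (s : R) n n' : ~ double_param t0 ->
  0 < s * cross (c' t0) n -> 0 < s * cross (c' t0) n' ->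
  exists2 d : R, 0 < d & forall t, `|t - t0| < d ->
  germ (c t) n = germ (c t0) n' /\
  forall e, 0 < e < d -> region_set (germ (c t0) n') (c t + e *: n).
Proof.
move=> t0N nP n'P.
have [d d0 dP] := simple_side_complement t0N nP n'P; exists d => //.
set r := region_at (c t0 + (d / 2) *: n').
have rE t e l : `|t - t0| < d -> 0 < e < d -> 0 <= l <= 1 ->
    region_at (c t + e *: (n + l *: (n' - n))) = r.
  move=> td /andP[e0 ed] /andP[l0 l1]; rewrite /r.
  have -> : c t0 = c (t + (t0 - t)) by rewrite addrC subrK.
  have -> : d / 2 = e + (d / 2 - e) by ring.
  have {2}-> : n' = (n + l *: (n' - n)) + (1 - l) *: (n' - n).
    by rewrite -addrA -scalerDl (_ : l + _ = 1) ?scale1r 1?addrC ?subrK //; ring.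
  apply: region_at_path => x /andP[x0 x1].
  rewrite scalerA -[_ + _ *: _ + _]addrA -scalerDl; apply: dP.
  - rewrite (_ : _ - t0 = (1 - x) * (t - t0)); last by ring.
    rewrite normrM ger0_norm ?subr_ge0 //.
    have := normr_ge0 (t - t0); nra.
  - by apply/andP; split; nra.
  - by apply/andP; split; nra.
have rP t e l : `|t - t0| < d -> 0 < e < d -> 0 <= l <= 1 ->
    region_set r (c t + e *: (n + l *: (n' - n))).
  by move=> td ed l01; rewrite -(rE t e l) //; apply: region_at_mem; exact: dP.
have nr t e : `|t - t0| < d -> 0 < e < d -> region_set r (c t + e *: n).
  by move=> td ed; have := rP t e 0 td ed; rewrite scale0r addr0 lexx ler01; apply.
have n'r : germ (c t0) n' = r.
  apply: (germE d0) => e ed; have := rP t0 e 1 _ ed.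
  by rewrite subrr normr0 scale1r (addrC n) subrK lexx ler01; apply.
move=> t td; rewrite n'r; split; last by move=> e; exact: nr.
by apply: (germE d0) => e; exact: nr.
Qed.

Lemma double_preimage s t z : double_point c s t -> c z = c s ->
  (exists j : int, z = s + j%:~R) \/ (exists j : int, z = t + j%:~R).
Proof.
move=> st zs; have [/intrP[j zj]|zN] := boolP (z - s \is a Num.int).
  by left; exists j; rewrite -zj addrC subrK.
right; have sz : double_point c s z by split; rewrite // -opprB rpredN.
have /intrP[j tz] := dcurve_no_triple sz st.
by exists j; rewrite -tz addrC subrK.
Qed.

(** The half-branch of the curve at [s] in the direction [a] is strictly
differentiable at its origin with derivative [U]. *)
Definition branch_strict s a U := forall k : R, 0 < k ->
  exists2 eta : R, 0 < eta & forall x y : R, `|x| < eta -> `|y| < eta ->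
  `|c (s + a * y) - c (s + a * x) - (y - x) *: U| <= k * `|y - x|.

Lemma dcurve_branch_strict s a : `|a| = 1 -> branch_strict s a (a *: c' s).
Proof.
move=> a1 k k0; have [eta eta0 H] := dcurve_strict D s k0; exists eta => // x y xe ye.
have := H (s + a * x) (s + a * y).
rewrite [s + a * x - s]addrC [s + a * y - s]addrC !addKr !normrM a1 !mul1r.
move=> /(_ xe ye); rewrite opprD addrACA subrr add0r -mulrBr normrM a1 mul1r.
by rewrite scalerA (mulrC _ a).
Qed.

Lemma norm1_sq (a : R) : `|a| = 1 -> a * a = 1.
Proof. by move=> a1; rewrite -expr2 -real_normK ?num_real // a1 expr1n. Qed.

(** In the sector between a half-branch and the bisecting direction [U + V] at a
double point, no point close to the double point lies on the curve. In
coordinates, the points are those at [x *: U + y *: V] with [0 < y <= x], up to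
an error [e2] that is either that of the half-branch, or arbitrary on the
bisecting ray. *)
Lemma sector_complement s t (a b : R) U V : double_point c s t ->
  `|a| = 1 -> `|b| = 1 -> branch_strict s a U -> branch_strict t b V ->
  cross U V != 0 ->
  exists k d : R, [/\ 0 < k, 0 < d,
    forall x, 0 < x < d -> `|c (s + a * x) - c s - x *: U| <= k * x &
    forall (x y : R) (e2 : plane R), 0 < x < d -> 0 < y <= x -> `|e2| <= k * x ->
      y = x \/ e2 = c (s + a * x) - c s - x *: U ->
      complement D (c s + (x *: U + e2 + y *: V))].
Proof.
move=> st a1 b1 sU sV uv0; have [cst _] := st.
have [M [M0 UM VM]] : exists M : R, [/\ 0 < M, `|U| <= M & `|V| <= M].
  exists (`|U| + `|V| + 1); have := normr_ge0 U; have := normr_ge0 V.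
  by split; lra.
(* The bound of [sector_off_line]. *)
have [k k0 kM] : exists2 k : R, 0 < k & 8 * (k * M) = `|cross U V|.
  exists (`|cross U V| / (8 * M)); last by field; rewrite gt_eqF.
  by rewrite divr_gt0 ?normr_gt0 // mulr_gt0.
have [eta1 eta10 strict1] := sU k k0; have [eta2 eta20 strict2] := sV k k0.
pose eta := Num.min eta1 eta2; have eta0 : 0 < eta by rewrite lt_min eta10.
have [del del0 pre] := @dcurve_near_preimage _ D (c s) eta eta0.
have Mk0 : 0 < 2 * M + k by apply: addr_gt0 => //; exact: mulr_gt0.
exists k, (Num.min eta1 (del / (2 * M + k))); split => // [|x|x y e2].
- by rewrite lt_min eta10 divr_gt0.
- move=> /andP[x0]; rewrite lt_min => /andP[x1 _].
  have := strict1 0 x; rewrite normr0 mulr0 addr0 subr0 (gtr0_norm x0).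
  exact.
move=> /andP[x0]; rewrite lt_min => /andP[xeta xdel] /andP[y0 yx] e2x yxe2.
move=> [t' _ t'E].
have : `|c t' - c s| < del.
  have xU : `|x *: U| <= x * M by rewrite normrZ (gtr0_norm x0) ler_wpM2l // ltW.
  have yV : `|y *: V| <= x * M.
    by rewrite normrZ (gtr0_norm y0); apply: ler_pM => //; exact: ltW.
  move: xdel; rewrite (ltr_pdivlMr _ _ Mk0) t'E [_ - c s]addrC addKr.
  have := ler_normD (x *: U + e2) (y *: V); have := ler_normD (x *: U) e2.
  lra.
case/pre => z [zs]; rewrite lt_min => /andP[z1 z2].
have shift (j : int) (w i : R) : `|i| = 1 ->
    c (w + i * (i * (t' - (w + j%:~R)))) = c s + (x *: U + e2 + y *: V).
  move=> i1; rewrite mulrA norm1_sq // mul1r opprD addrCA addNKr.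
  by rewrite -mulrNz dcurve_periodicz.
have [[j zj]|[j zj]] := double_preimage st zs; move: z1 z2; rewrite {z zs}zj => z1 z2.
  pose zt := a * (t' - (s + j%:~R)).
  have zt1 : `|zt| < eta1 by rewrite normrM a1 mul1r.
  have ztE : c (s + a * zt) = c s + (x *: U + e2 + y *: V) by exact: shift.
  (* On the branch of [s]: near the bisecting ray the point is too far from the
     tangent; otherwise the chord from [s + a * x] would be parallel to [V]. *)
  have [yE|eE] := yxe2.
    have := strict1 0 zt; rewrite normr0 mulr0 addr0 subr0 ztE => /(_ eta10 zt1).
    rewrite [_ - c s]addrC addKr => H.
    apply: (@sector_off_line _ k M x x zt V U
        (x *: U + e2 + y *: V - zt *: U) e2) => //.
    - by rewrite crossC normrN kM.
    - exact: ltW.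
    - by rewrite crossC oppr_eq0.
    - by rewrite x0 lexx.
    - by rewrite addrC subrK yE addrC addrA addrAC.
  have x1 : `|x| < eta1 by rewrite gtr0_norm.
  have := strict1 x zt x1 zt1; rewrite ztE eE; set w := _ - c (s + _) => H.
  have wE : w = y *: V.
    by rewrite /w; apply: plane_eq; rewrite !coordE; ring.
  have zx : zt - x = 0.
    apply: (chord_not_parallel H wE).
    have : k * `|V| <= k * M by rewrite ler_wpM2l // ltW.
    have : 0 < k * M by rewrite mulr_gt0.
    by rewrite -kM; lra.
  move: wE; rewrite /w -eE -ztE; move/eqP: zx; rewrite subr_eq0 => /eqP ->.
  rewrite subrr => /esym/eqP; rewrite scaler_eq0 gt_eqF //= => /eqP V0.
  by move: uv0; rewrite V0 /cross !mulr0 subrr eqxx.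
(* On the branch of [t]: the point is too far from the line of [V]. *)
pose zt := b * (t' - (t + j%:~R)).
have zt2 : `|zt| < eta2 by rewrite normrM b1 mul1r.
have ztE : c (t + b * zt) = c s + (x *: U + e2 + y *: V) by exact: shift.
have := strict2 0 zt; rewrite normr0 mulr0 addr0 subr0 ztE => /(_ eta20 zt2).
rewrite -cst [_ - c s]addrC addKr => H.
apply: (@sector_off_line _ k M x y zt U V
    (x *: U + e2 + y *: V - zt *: V) e2) => //.
- by rewrite kM.
- exact: ltW.
- by rewrite y0 yx.
- by rewrite addrC subrK.
Qed.

(** In a quadrant at a double point, the points close to the half-branch of
parameter [s + a * x], [x > 0], and the points on the bisecting ray lie in one
region. *)
Lemma germ_sector s t (a b : R) U V : double_point c s t ->
  `|a| = 1 -> `|b| = 1 -> branch_strict s a U -> branch_strict t b V ->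
  cross U V != 0 ->
  exists2 d : R, 0 < d & forall x : R, 0 < x < d ->
  germ (c (s + a * x)) V = germ (c s) (U + V).
Proof.
move=> st a1 b1 sU sV uv0.
have [k [d [k0 d0 errk off]]] := sector_complement st a1 b1 sU sV uv0.
exists d => //; pose r := region_at (c s + (d / 2) *: (U + V)).
have ray x : 0 < x < d -> complement D (c s + x *: (U + V)).
  move=> xd; have := off x x 0 xd; rewrite addr0 -scalerDr; apply.
  - by case/andP: xd => ->; rewrite lexx.
  - by rewrite normr0 mulr_ge0 ?(ltW k0) //; case/andP: xd => /ltW.
  - by left.
have rayE x : 0 < x < d -> region_at (c s + x *: (U + V)) = r.
  move=> /andP[x0 xd]; have := @region_at_path s 0 x (d / 2 - x) (U + V) 0.
  rewrite !addr0 (addrC x) subrK; apply=> l /andP[l0 l1].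
  by rewrite mulr0 scaler0 !addr0; apply: ray; apply/andP; split; nra.
have germ_ray : germ (c s) (U + V) = r.
  by apply: (germE d0) => x xd; rewrite -(rayE _ xd); exact/region_at_mem/ray.
have near x y : 0 < x < d -> 0 < y <= x -> complement D (c (s + a * x) + y *: V).
  move=> xd yx; have := off x y _ xd yx (errk _ xd) (or_intror erefl).
  by rewrite addrA addrC [x *: U + _]addrC subrK [_ - c s]addrC addNKr addrC.
move=> x xd; rewrite germ_ray; have /andP[x0 xd'] := xd; apply: (germE x0) => y.
move=> /andP[y0 yx]; have yx' : 0 < y <= x by rewrite y0 ltW.
suff <- : region_at (c (s + a * x) + y *: V) = r by exact/region_at_mem/near.
have -> : region_at (c (s + a * x) + y *: V) = region_at (c (s + a * x) + x *: V).
  have := @region_at_path (s + a * x) 0 y (x - y) V 0.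
  rewrite !addr0 (addrC y) subrK; apply=> l /andP[l0 l1].
  rewrite mulr0 scaler0 !addr0; apply: near => //; apply/andP; split; nra.
(* A last segment absorbs the error of the half-branch. *)
rewrite -(rayE _ xd); set e := c (s + a * x) - c s - x *: U.
have := @region_at_path s 0 1 0 (c (s + a * x) - c s + x *: V) (- e).
rewrite !addr0 !scale1r => H.
transitivity (region_at (c s + (c (s + a * x) - c s + x *: V))).
  by congr region_at; apply: plane_eq; rewrite !coordE; ring.
rewrite {}H; first by congr region_at; apply: plane_eq; rewrite /e !coordE; ring.
move=> l /andP[l0 l1]; rewrite !mulr0 !addr0 scale1r.
have := off x x ((1 - l) *: e) xd; rewrite x0 lexx => /(_ isT).
rewrite (_ : c s + _ = c s + (c (s + a * x) - c s + x *: V + l *: - e)); last first.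
  by apply: plane_eq; rewrite /e !coordE; ring.
apply; last by left.
rewrite normrZ ger0_norm ?subr_ge0 //; have := errk _ xd; rewrite -/e.
have := normr_ge0 e; nra.
Qed.

(** Next to a double point, each side of a half-branch lies in a quadrant. *)
Lemma germ_double s t (a b : R) : double_point c s t -> `|a| = 1 -> `|b| = 1 ->
  exists2 d : R, 0 < d & forall x : R, 0 < x < d ->
  germ (c (s + a * x)) (b *: c' t) = germ (c s) (a *: c' s + b *: c' t).
Proof.
move=> st a1 b1; apply: (germ_sector st a1 b1); try exact: dcurve_branch_strict.
rewrite crossZl crossZr !mulf_neq0 ?(dcurve_transverse st) //.
- by rewrite -normr_eq0 a1 oner_eq0.
- by rewrite -normr_eq0 b1 oner_eq0.
Qed.

End Regions.

(** * Step functions on the line *)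

Section Step.
Variables (R : realType) (T : choiceType).
Implicit Types (f : R -> T) (s t x y : R) (a : R) (v w : T).

(** [f] has the constant value [v] at the points [t + a * x], [x > 0] small. *)
Definition side_value f a t v :=
  exists2 d : R, 0 < d & forall x : R, 0 < x < d -> f (t + a * x) = v.

(** The value of [f] on a one-sided neighbourhood of [t]: on the right for
[a = 1] and on the left for [a = -1]. *)
Definition side f a t : T := xget (f t) [set v | side_value f a t v].

Lemma sideE f a t v : side_value f a t v -> side f a t = v.
Proof.
move=> [d d0 dv]; rewrite /side; case: xgetP => [w -> [d' d'0 d'w]|/(_ v)]; last first.
  by case; exists d.
have m0 : 0 < Num.min d d' by rewrite lt_min d0.
pose x := Num.min d d' / 2; have /andP[xd xd'] : (x < d) && (x < d').
  by rewrite -lt_min ltr_pdivrMr // ltr_pMr // ltr1n.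
have x0 : 0 < x by rewrite divr_gt0.
by rewrite -(dv x) ?x0 // -(d'w x) ?x0.
Qed.

(** Every point has punctured one-sided neighbourhoods on which [f] is
constant. *)
Definition step f := forall t, exists v w, side_value f 1 t v /\ side_value f (-1) t w.

Lemma sideP f t : step f ->
  side_value f 1 t (side f 1 t) /\ side_value f (-1) t (side f (-1) t).
Proof. by move=> /(_ t) [v [w [/[dup]/sideE-> + /[dup]/sideE->]]]. Qed.

Lemma side_local f t d v : 0 < d -> (forall x, `|x - t| < d -> f x = v) ->
  side f 1 t = v /\ side f (-1) t = v.
Proof.
move=> d0 fv; split; apply: sideE; exists d => // x /andP[x0 xd]; apply: fv;
  by rewrite addrC addKr normrM ?normrN normr1 mul1r gtr0_norm.
Qed.

Lemma side_near f t d v (a : R) : `|a| = 1 ->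
  (forall x, 0 < x < d -> f (t + a * x) = v) ->
  forall x, 0 < x < d -> side f 1 (t + a * x) = v /\ side f (-1) (t + a * x) = v.
Proof.
move=> a1 fv x /andP[x0 xd].
have m0 : 0 < Num.min x (d - x) by rewrite lt_min x0 subr_gt0.
apply: (side_local m0) => y; rewrite lt_min => /andP[y1 y2].
have aa : a * a = 1 by exact: norm1_sq.
have -> : y = t + a * (a * (y - t)) by rewrite mulrA aa mul1r addrC subrK.
apply: fv.
have : `|a * (y - t) - x| = `|y - (t + a * x)|.
  rewrite -[LHS]mul1r -a1 -normrM; congr (`|_|); rewrite mulrBr mulrA aa; ring.
by move: (`|y - _|) y1 y2 => z z1 z2 /eqP; rewrite eq_le ler_norml => /andP[/andP[]]; lra.
Qed.

(** A locally constant map on an open interval is constant: the indicator of one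
of its values has zero derivative. *)
Lemma locally_constant (g : R -> T) s t :
  (forall x, s < x < t -> exists2 d : R, 0 < d & forall y, `|y - x| < d -> g y = g x) ->
  forall x y, s < x -> x <= y -> y < t -> g x = g y.
Proof.
move=> gc x y sx xy yt; pose h z : R := (g z == g x)%:R.
have dh z : s < z < t -> is_derive z (1 : R) h 0.
  move=> /gc [d d0 gd].
  have H : (fun e => e^-1 *: (h (e *: 1 + z) - h z)) @ 0^' --> (0 : R).
    apply: cvg_near_cst; rewrite near_withinE; apply/near_dist; exists d => // e.
    by rewrite subr0 => ed _; rewrite /h gd ?subrr ?scaler0 // [_%:A]mulr1 addrK.
  by split; [apply/cvg_ex; eexists; exact: H | exact: cvg_lim H].
have [| |z zI /eqP] := @MVT_segment R h (fun=> 0) x y xy.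
  move=> z; rewrite in_itv /= => /andP[xz zy].
  by apply: dh; rewrite (lt_trans sx xz) (lt_trans zy yt).
  apply: derivable_within_continuous => z; rewrite in_itv /= => /andP[xz zy].
  by have [] := dh z _; rewrite // (lt_le_trans sx xz) (le_lt_trans zy yt).
rewrite mul0r subr_eq0 /h eqxx; case: (g y =P g x) => [-> //|_].
by rewrite eq_sym oner_eq0.
Qed.

(** If a step function has no jump between [s] and [t], its value after [s] is
its value before [t]. *)
Lemma step_constant f s t : step f -> s < t ->
  (forall x, s < x < t -> side f (-1) x = side f 1 x) ->
  side f 1 s = side f (-1) t.
Proof.
move=> fstep st nojump.
have pm1 : (`|1| = 1 :> R) * (`|-1| = 1 :> R) by rewrite normrN normr1.
have [[d1 d10 s1] _] := sideP s fstep; have [_ [d2 d20 t2]] := sideP t fstep.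
have lc x : s < x < t ->
    exists2 d : R, 0 < d & forall y, `|y - x| < d -> side f 1 y = side f 1 x.
  move=> xst; have [[d d0 fx] [d' d'0 fx']] := sideP x fstep.
  rewrite nojump // in fx'.
  exists (Num.min d d') => [|y]; first by rewrite lt_min d0.
  rewrite lt_min => /andP[yd yd'].
  have [xy|yx|-> //] := ltgtP x y.
    have := side_near pm1.1 fx (x := y - x); rewrite mul1r (addrC x) subrK.
    by rewrite gtr0_norm ?subr_gt0 // in yd; rewrite subr_gt0 xy yd => /(_ isT) [].
  have := side_near pm1.2 fx' (x := x - y); rewrite mulN1r (_ : x - (x - y) = y); last by ring.
  rewrite ltr0_norm ?subr_lt0 // opprB in yd'.
  by rewrite subr_gt0 yx yd' => /(_ isT) [].
pose m := Num.min (Num.min d1 d2) (t - s).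
have m0 : 0 < m by rewrite !lt_min d10 d20 subr_gt0.
have [[md1 md2] mst] : (m <= d1 /\ m <= d2) /\ m <= t - s.
  by rewrite /m !ge_min !lexx !orbT.
have := side_near pm1.1 s1 (x := m / 3); have := side_near pm1.2 t2 (x := m / 3).
rewrite mul1r mulN1r => -[|<- _]; first by apply/andP; split; lra.
move=> -[|<- _]; first by apply/andP; split; lra.
by apply: (locally_constant lc); lra.
Qed.

(** The jumps of a periodic step function sum up to zero over a period. *)
Lemma step_jumps (A : zmodType) (F : T -> A) f (S : set R) : step f ->
  (forall t, f (t + 1) = f t) -> finite_set S -> (forall x, S x -> 0 <= x < 1) ->
  (forall x, 0 <= x < 1 -> ~ S x -> side f (-1) x = side f 1 x) ->
  \sum_(x \in S) (F (side f (-1) x) - F (side f 1 x)) = 0.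
Proof.
move=> fstep fper Sfin S01 nojump.
have side1 a t : side f a (t + 1) = side f a t.
  rewrite /side fper; congr xget; apply/seteqP; split=> v [d d0 dv];
    exists d => // x /dv; first by rewrite addrAC fper.
  by rewrite addrAC fper.
have [r rlt SE] : exists2 r, sorted <%O r & S = [set` r].
  have /finite_seqP[r0 ->] := Sfin; exists (sort <=%O (undup r0)).
    by rewrite lt_sorted_uniq_le sort_le_sorted sort_uniq undup_uniq.
  by apply/seteqP; split=> x /=; rewrite mem_sort mem_undup.
have uniq_r : uniq r by move: rlt; rewrite lt_sorted_uniq_le => /andP[].
rewrite SE -(fsbig_seq _ _ uniq_r) in S01 nojump *.
have last_ge (x : R) l : path <%O x l -> forall y, y \in x :: l -> y <= last x l.
  elim: l x => [|z l IH] x /= => [_ y|/andP[/ltW xz zl] y].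
    by rewrite inE => /eqP ->.
  rewrite in_cons => /orP[/eqP ->|]; last exact: IH.
  by apply: (le_trans xz); apply: IH; rewrite ?mem_head.
(* The sum telescopes along the increasing list of the jumps, and periodicity
   closes it up. *)
have tel l (x : R) : path <%O x l ->
    (forall y, x < y < last x l -> y \notin l -> side f (-1) y = side f 1 y) ->
    \sum_(z <- l) (F (side f (-1) z) - F (side f 1 z)) =
    F (side f 1 x) - F (side f 1 (last x l)).
  elim: l x => [|z l IH] x /=; first by rewrite big_nil subrr.
  move=> /andP[xz zl] nj; rewrite big_cons (IH z) // => [|y /andP[zy yl] yNl].
    rewrite -(step_constant fstep xz) ?addrA ?subrK // => y /andP[xy yz].
    apply: nj; first by rewrite xy (lt_le_trans yz) ?last_ge ?mem_head.
    rewrite in_cons lt_eqF //=; apply/negP => yl.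
    by have /allP/(_ _ yl) := order_path_min lt_trans zl; rewrite ltNge ltW.
  apply: nj; rewrite ?(lt_trans xz) ?zy // in_cons negb_or yNl andbT.
  by rewrite gt_eqF.
case: r rlt {uniq_r SE} S01 nojump => [|x l] /= rlt S01 nojump.
  by rewrite big_nil.
have /andP[x0 x1] := S01 x (mem_head _ _).
have /andP[l0 l1] := S01 _ (mem_last x l).
rewrite big_cons (tel _ x) // => [|y /andP[xy yl] yNl]; last first.
  apply: nojump; first by rewrite (le_trans x0 (ltW xy)) (lt_trans yl).
  by rewrite in_cons (negbTE yNl) gt_eqF.
have -> : side f 1 (last x l) = side f (-1) x.
  rewrite -[RHS]side1; apply: step_constant => // [|y /andP[ly yx]].
    by rewrite (lt_le_trans l1) // lerDr.
  have [y1|y1] := ltP y 1.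
    apply: nojump; first by rewrite y1 (le_trans l0 (ltW ly)).
    by move=> /(last_ge _ _ rlt); rewrite leNgt ly.
  rewrite -[y](subrK 1) !side1; apply: nojump => [|]; first by apply/andP; split; lra.
  rewrite in_cons => /orP[/eqP yE|yl]; first by move: yx; rewrite -yE subrK ltxx.
  have /allP/(_ _ yl) := order_path_min lt_trans rlt.
  by rewrite ltrBrDr ltNge ltW.
by rewrite addrA subrK subrr.
Qed.

End Step.

(** * Colours on the two sides of the curve *)

Section Sides.
Variables (R : realType) (D : knotDiagram R).
Local Notation c := (dcurve D).
Local Notation c' := (derive1 (dcurve D)).
Implicit Types (s t x y : R) (u v : plane R).

Lemma derive1_periodicz t (k : int) : c' (t + k%:~R) = c' t.
Proof.
rewrite /derive1 (_ : (fun h => h^-1 *: (c (h + (t + k%:~R)) - c (t + k%:~R))) =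
  (fun h => h^-1 *: (c (h + t) - c t))) //.
by apply/funext => e; rewrite addrA !dcurve_periodicz.
Qed.

Lemma double_pointC s t : double_point c s t -> double_point c t s.
Proof. by move=> [st stN]; split; rewrite // -opprB rpredN. Qed.

Lemma double_pointD s t (j k : int) : double_point c s t ->
  double_point c (s + j%:~R) (t + k%:~R).
Proof.
move=> [st stN]; split; first by rewrite !dcurve_periodicz.
apply: contra stN => H.
have -> : s - t = (s + j%:~R - (t + k%:~R)) + (k - j)%:~R by rewrite intrB; ring.
by rewrite rpredD ?intr_int.
Qed.

Lemma double_param_periodicz s (j : int) : double_param D (s + j%:~R) <-> double_param D s.
Proof.
split=> -[t st]; exists t; have := double_pointD (- j) 0 st; have := double_pointD j 0 st;
  by rewrite !addr0 ?mulrNz ?addrK.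
Qed.

Lemma double_param_finite :
  finite_set [set t | 0 <= t < 1 /\ double_param D t].
Proof.
apply: sub_finite_set (finite_image fst (@dcurve_finite _ D)) => s [s01 [t st]].
exists (s, t - (Num.floor t)%:~R) => //=; split => //=.
  by have := floor_itv t; rewrite intrD => /andP[]; lra.
by have := double_pointD 0 (- Num.floor t) st; rewrite addr0 mulrNz.
Qed.

(** Double points are isolated. *)
Lemma double_param_isolated t : exists2 d : R, 0 < d &
  forall x, 0 < `|x - t| < d -> ~ double_param D x.
Proof.
pose A := [set t | 0 <= t < 1 /\ double_param D t].
(* The double parameters at distance less than 1 from [t] lie in three periods. *)
pose B := \bigcup_(k in [set` [:: -1; 0; 1 : int]])
  ((fun x => x + (Num.floor t + k)%:~R) @` A).
have Bfin : finite_set (B `\ t).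
  apply: finite_setD; apply: bigcup_finite => // k _.
  exact: finite_image double_param_finite.
have Bc : closed (B `\ t).
  exact: (accessible_finite_set_closed.1 (hausdorff_accessible (@Rhausdorff R))).
have /near_dist[d d0 dB] : nbhs t (~` (B `\ t)).
  by apply: open_nbhs_nbhs; split; [exact: closed_openC | case => _; apply].
exists (Num.min 1 d) => [|x]; first by rewrite lt_min ltr01.
rewrite lt_min => /and3P[xt xt1 xtd] xD; apply: (dB x xtd); split; last first.
  by move=> /= xtE; rewrite xtE subrr normr0 ltxx in xt.
have fx := floor_itv x; have ft := floor_itv t.
pose k := Num.floor x - Num.floor t.
have kE : (k%:~R : R) = (Num.floor x)%:~R - (Num.floor t)%:~R by rewrite intrB.
exists k => /=.
  have [k1 k2] : -1 - 1 < k /\ k < 1 + 1.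
    move: fx ft xt1; rewrite !intrD ltr_norml -!(@ltr_int R) kE.
    by move=> /andP[? ?] /andP[? ?] /andP[? ?]; rewrite !intrD mulrN1z; split; lra.
  rewrite !inE; move: k k1 k2 {kE} => [[|[|n]]|[|n]] //=.
exists (x - (Num.floor x)%:~R); last by rewrite intrD kE; ring.
split; first by move: fx; rewrite intrD => /andP[]; lra.
by rewrite -mulrNz; exact/double_param_periodicz.
Qed.

(** The normal vector on the left of [u]. *)
Definition lnormal u : plane R := (- u.2, u.1).

Lemma cross_lnormal u : u != 0 -> 0 < cross u (lnormal u).
Proof.
move=> u0; rewrite /cross /= mulrN opprK -!expr2 lt_neqAle eq_sym.
rewrite addr_ge0 ?sqr_ge0 // andbT paddr_eq0 ?sqr_ge0 // !sqrf_eq0.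
by apply: contra u0 => /andP[/eqP u1 /eqP u2]; apply/eqP/plane_eq.
Qed.

(** The regions seen from the curve on its left and on its right. *)
Definition left_region t := germ D (c t) (lnormal (c' t)).
Definition right_region t := germ D (c t) (- lnormal (c' t)).

Lemma left_region_simple t u : ~ double_param D t -> 0 < cross (c' t) u ->
  germ D (c t) u = left_region t /\
  exists2 d : R, 0 < d & forall e, 0 < e < d ->
    region_set (left_region t) (c t + e *: u).
Proof.
move=> tN tu; have tn := cross_lnormal (@dcurve_regular _ D t).
have [|| d d0 /(_ t)] := @germ_simple _ D t 1 u (lnormal (c' t)) tN;
  rewrite ?mul1r // subrr normr0 => /(_ d0) [-> tE].
by split=> //; exists d.
Qed.

Lemma right_region_simple t u : ~ double_param D t -> cross (c' t) u < 0 ->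
  germ D (c t) u = right_region t /\
  exists2 d : R, 0 < d & forall e, 0 < e < d ->
    region_set (right_region t) (c t + e *: u).
Proof.
move=> tN tu; have tn := cross_lnormal (@dcurve_regular _ D t).
have [|| d d0 /(_ t)] := @germ_simple _ D t (-1) u (- lnormal (c' t)) tN;
  rewrite ?crossNr ?mulN1r ?oppr_gt0 ?oppr_lt0 // subrr normr0 => /(_ d0) [-> tE].
by split=> //; exists d.
Qed.

(** A direction transverse to the curve remains so, on the same side, at nearby
points. *)
Lemma cross_derive_near t u : cross (c' t) u != 0 ->
  exists2 d : R, 0 < d & forall x, `|x - t| < d ->
  0 < cross (c' t) u * cross (c' x) u.
Proof.
move=> tu; pose k := `|cross (c' t) u| / (2 * `|u| + 1).
have u0 : 0 < 2 * `|u| + 1 by rewrite ltr_wpDl // mulr_ge0.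
have k0 : 0 < k by rewrite divr_gt0 // normr_gt0.
have := @dcurve_C1 _ D t; move=> /cvgr_dist_le/(_ k k0)/near_dist[d d0 dP].
exists d => // x /dP {d d0 dP}; have := cross_le (c' t - c' x) u.
rewrite crossDl crossNl; move: (c' x) (c' t) @k k0 tu => v w k k0 tu.
set C := cross w u in k k0 tu *; set E := cross v u => H wv.
have : `|C - E| < `|C|.
  apply: le_lt_trans H _; apply: (@le_lt_trans _ _ (2 * (k * `|u|))).
    by rewrite ler_pM2l // ler_wpM2r.
  have -> : `|C| = k * (2 * `|u| + 1) by rewrite /k divfK // gt_eqF.
  rewrite mulrDr mulr1 (mulrCA k); lra.
rewrite ltr_norml; case: (ltgtP C 0) tu => // C0 _.
  by rewrite ltr0_norm // => /andP[]; nra.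
by rewrite gtr0_norm // => /andP[]; nra.
Qed.

(** Near a simple point the regions on both sides are constant. *)
Lemma regions_simple_near t : ~ double_param D t -> exists2 d : R, 0 < d &
  forall x, `|x - t| < d ->
  left_region x = left_region t /\ right_region x = right_region t.
Proof.
move=> tN; have tn := cross_lnormal (@dcurve_regular _ D t).
set n := lnormal (c' t) in tn.
have [d1 d10 iso] := double_param_isolated t.
have [d2 d20 near2] := cross_derive_near (lt0r_neq0 tn).
have [|| d3 d30 near3] := @germ_simple _ D t 1 n n tN; rewrite ?mul1r //.
have [|| d4 d40 near4] := @germ_simple _ D t (-1) (- n) (- n) tN;
  rewrite ?crossNr ?mulN1r ?opprK //.
exists (Num.min (Num.min d1 d2) (Num.min d3 d4)) => [|x].
  by rewrite !lt_min d10 d20 d30.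
rewrite !lt_min => /andP[/andP[x1 x2] /andP[x3 x4]].
have xN : ~ double_param D x.
  by have [-> //|xt] := eqVneq x t; apply: iso; rewrite normr_gt0 subr_eq0 xt.
have xn : 0 < cross (c' x) n by have := near2 x x2; rewrite pmulr_rgt0.
have [<- _] := left_region_simple xN xn.
have [|<- _] := @right_region_simple x (- n) xN; first by rewrite crossNr oppr_lt0.
by split; [have [-> _] := near3 x x3 | have [-> _] := near4 x x4].
Qed.

(** Next to a double point the regions on both sides are the quadrants. *)
Lemma regions_double s t (a : R) : double_point c s t -> `|a| = 1 ->
  let sg := Num.sg (cross (c' s) (c' t)) in
  exists2 d : R, 0 < d & forall x, 0 < x < d ->
  left_region (s + a * x) = germ D (c s) (a *: c' s + sg *: c' t) /\
  right_region (s + a * x) = germ D (c s) (a *: c' s - sg *: c' t).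
Proof.
move=> st a1; have uv0 := dcurve_transverse st.
move: (erefl (Num.sg (cross (c' s) (c' t)))); move: {2}(Num.sg _) => sg sgE sg'.
have sg1 : `|sg| = 1 by rewrite -sgE normr_sg uv0.
have [d1 d10 near1] := germ_double st a1 sg1.
have [|d2 d20 near2] := @germ_double _ D s t a (- sg) st a1; first by rewrite normrN.
have [d3 d30 near3] := cross_derive_near uv0.
have [d4 d40 iso] := double_param_isolated s.
exists (Num.min (Num.min d1 d2) (Num.min d3 d4)) => [|x].
  by rewrite !lt_min d10 d20 d30.
rewrite !lt_min => /andP[x0 /andP[/andP[x1 x2] /andP[x3 x4]]].
have nx : `|s + a * x - s| = x by rewrite addrC addKr normrM a1 mul1r gtr0_norm.
have xN : ~ double_param D (s + a * x) by apply: iso; rewrite nx x0.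
have xn : 0 < cross (c' (s + a * x)) (sg *: c' t).
  have := near3 (s + a * x); rewrite nx => /(_ x3).
  by rewrite {1}(numEsg (cross (c' s) (c' t))) sgE crossZr mulrAC pmulr_lgt0 // normr_gt0.
have [<- _] := left_region_simple xN xn.
have [|<- _] := @right_region_simple _ (- (sg *: c' t)) xN.
  by rewrite crossNr oppr_lt0.
rewrite near1 ?x0 // -scaleNr near2 ?x0 // /sg' sgE scaleNr.
by [].
Qed.

End Sides.

(** * Coloured crossings *)

Section Colours.
Variables (R : realType) (X : ternaryGroupType) (D : knotDiagram R).
Variable gamma : tgHom (pi1T D) X.
Local Notation c := (dcurve D).
Local Notation c' := (derive1 (dcurve D)).
Implicit Types (s t x y : R) (p : R * R).

(** The colour of a region. *)
Definition colour (r : region D) : X := gamma (region_gen r).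

(** A pair of parameters of the over- and the under-strand of a crossing, not
necessarily in the fundamental domain. *)
Definition crossing_param p := double_point c p.1 p.2 /\ dover D p.1.

Lemma derive1_frac t : c' (frac t) = c' t.
Proof. by rewrite /frac -mulrNz derive1_periodicz. Qed.

Lemma dover_frac t : dover D (frac t) = dover D t.
Proof.
have natP (n : nat) s : dover D (s + n%:R) = dover D s.
  elim: n s => [|n IH] s; first by rewrite addr0.
  by rewrite -natr1 addrA dover_periodic IH.
rewrite /frac; case: (Num.floor t) => n; last first.
  by rewrite NegzE mulrNz opprK -pmulrn natP.
by have := natP n (t - n%:R); rewrite subrK => ->.
Qed.

(** The representative of a crossing in the fundamental domain. *)
Definition frac2 p : R * R := (frac p.1, frac p.2).

Lemma crossing_frac p : crossing_param p -> crossings D (frac2 p).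
Proof.
move=> [p12 po]; split; rewrite /= ?frac_itv ?dover_frac //.
by rewrite /frac -!mulrNz; exact: double_pointD.
Qed.

Lemma crossings_param p : crossings D p -> crossing_param p.
Proof. by case. Qed.

Lemma quadrant_frac p i j : quadrant D (frac2 p) i j = quadrant D p i j.
Proof. by rewrite /quadrant /= dcurve_frac !derive1_frac. Qed.

Lemma crossing_chain_frac p : crossing_chain gamma (frac2 p) = crossing_chain gamma p.
Proof. by rewrite /crossing_chain /= !quadrant_frac !derive1_frac. Qed.

(** The defining relation of the presentation, carried over to the colours. *)
Lemma colour_relation p (i j : bool) : crossing_param p ->
  colour (quadrant D p i j) =
  heap (colour (quadrant D p (~~ i) j)) (colour (quadrant D p (~~ i) (~~ j)))
       (colour (quadrant D p i (~~ j))).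
Proof.
move=> /crossing_frac pD; rewrite -!(quadrant_frac p) /colour /region_gen /pgen.
move: (frac2 p) pD => {}p pD.
have /pi_tweq -> : tweq (@crossing_relation R D) (TGen (quadrant D p i j))
    (TBr (TGen (quadrant D p (~~ i) j)) (TSkew (TGen (quadrant D p (~~ i) (~~ j))))
         (TGen (quadrant D p i (~~ j)))).
  by apply: tweq_rel; exists p; split=> //; exists i, j.
rewrite -pbrE -pskewE; set a := \pi _; set b := \pi _; set d := \pi _.
have -> : gamma (pbr a (pskew b) d) = tbr (gamma a) (gamma (pskew b)) (gamma d).
  exact: (tgHom_tbr gamma).
suff -> : gamma (pskew b) = tskew (gamma b) by [].
apply: (@tbr_inj X (gamma b) (gamma b)); rewrite tbr_skew.
have <- : gamma (pbr b b (pskew b)) = tbr (gamma b) (gamma b) (gamma (pskew b)).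
  exact: (tgHom_tbr gamma).
by rewrite pskew1.
Qed.

Lemma colour_germC (P u v : plane R) :
  colour (germ D P (u + v)) = colour (germ D P (v + u)).
Proof. by rewrite addrC. Qed.

(** The sign of a crossing, as a boolean: [true] for a negative crossing. *)
Definition crossing_neg p : bool := cross (c' p.1) (c' p.2) < 0.

(** The colour of the region that lies on the right of the over-strand iff [x]
and on the right of the under-strand iff [y]. For a positive crossing the right
of the over-strand [u] is in the direction of [- v] and the right of the
under-strand [v] in the direction of [u]; the sign exchanges both. *)
Definition side_colour p (x y : bool) : X :=
  colour (quadrant D p (~~ y (+) crossing_neg p) (x (+) crossing_neg p)).

Lemma side_colour_heap p : crossing_param p ->
  side_colour p false true =
  heap (side_colour p false false) (side_colour p true false)
       (side_colour p true true).
Proof.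
by move=> pD; rewrite /side_colour colour_relation //; case: crossing_neg.
Qed.

Lemma crossing_chainE p : crossing_param p ->
  crossing_chain gamma p = (-1) ^+ crossing_neg p *:
  << [tuple side_colour p false false; side_colour p true false;
            side_colour p true true] >>.
Proof.
move=> [/dcurve_transverse p0 _]; rewrite /crossing_chain /side_colour.
rewrite /crossing_neg; case: ltgtP p0 => //= _ _; first by rewrite scale1r.
by rewrite expr1 scaleN1r.
Qed.

(** The colours on the left and on the right of the curve. *)
Definition side_pair t : X * X :=
  (colour (left_region D t), colour (right_region D t)).

(** These colours just before and just after [t]. *)
Definition before t := side side_pair (-1) t.
Definition after t := side side_pair 1 t.

Lemma side_pair_periodic t : side_pair (t + 1) = side_pair t.
Proof.
have ct : c (t + 1) = c t by exact: dcurve_periodic.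
have c't : c' (t + 1) = c' t by exact: (derive1_periodicz D t 1).
by rewrite /side_pair /left_region /right_region ct c't.
Qed.

Lemma side_pair_simple t : ~ double_param D t ->
  before t = side_pair t /\ after t = side_pair t.
Proof.
move=> /regions_simple_near[d d0 near_t].
have H x : `|x - t| < d -> side_pair x = side_pair t.
  by move=> /near_t [lE rE]; rewrite /side_pair lE rE.
have [h1 h2] := side_local d0 H; exact: (conj h2 h1).
Qed.

Lemma side_pair_double s t (a : R) : double_point c s t -> `|a| = 1 ->
  let sg := Num.sg (cross (c' s) (c' t)) in
  side_value side_pair a s (colour (germ D (c s) (a *: c' s + sg *: c' t)),
                            colour (germ D (c s) (a *: c' s - sg *: c' t))).
Proof.
move=> st a1 sg; have [d d0 near_s] := regions_double st a1.
by exists d => // x /near_s [lE rE]; rewrite /side_pair lE rE.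
Qed.

Lemma side_pair_step : step side_pair.
Proof.
have pm1 : (`|1| = 1 :> R) * (`|-1| = 1 :> R) by rewrite normrN normr1.
move=> t; have [[s ts]|/regions_simple_near[d d0 near_t]] := pselect (double_param D t).
  by do 2!eexists; split; apply: side_pair_double ts _; rewrite pm1.
have H x : `|x - t| < d -> side_pair x = side_pair t.
  by move=> /near_t [lE rE]; rewrite /side_pair lE rE.
exists (side_pair t), (side_pair t).
split; exists d; first [exact: d0 | move=> x /andP[x0 xd]; apply: H];
  by rewrite (addrC t) addrK normrM pm1 mul1r gtr0_norm.
Qed.

Lemma side_pair_constant s t : s < t ->
  (forall x, s < x < t -> ~ double_param D x) -> after s = before t.
Proof.
move=> st simple; apply: (step_constant side_pair_step st) => x xst.
by have [h1 h2] := side_pair_simple (simple x xst); exact: etrans h1 (esym h2).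
Qed.

(** The colours before and after both passages through a crossing. *)
Lemma crossing_sides p : crossing_param p -> let n := crossing_neg p in
  [/\ before p.1 = (side_colour p false n, side_colour p true n),
      after p.1 = (side_colour p false (~~ n), side_colour p true (~~ n)),
      before p.2 = (side_colour p (~~ n) false, side_colour p (~~ n) true) &
      after p.2 = (side_colour p n false, side_colour p n true)].
Proof.
move=> [p12 _] n; have p21 := double_pointC p12; have [cE _] := p12.
have sign1 (i : bool) : `|(-1) ^+ i| = 1 :> R by rewrite normrX normrN normr1 expr1n.
have signN (i : bool) : - (-1) ^+ i = (-1) ^+ (~~ i) :> R.
  by case: i; rewrite ?expr1 ?expr0 ?opprK.
have N : Num.sg (cross (c' p.1) (c' p.2)) = (-1) ^+ n.
  have := dcurve_transverse p12; rewrite /n /crossing_neg.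
  by case: ltgtP => [/ltr0_sg|/gtr0_sg|//] ->.
have N' : Num.sg (cross (c' p.2) (c' p.1)) = (-1) ^+ (~~ n).
  by rewrite crossC sgrN N signN.
have H1 (i : bool) : side side_pair ((-1) ^+ i) p.1 =
    (colour (quadrant D p i n), colour (quadrant D p i (~~ n))).
  apply: etrans (sideE (side_pair_double p12 (sign1 i))) _.
  by rewrite N -scaleNr signN.
have H2 (j : bool) : side side_pair ((-1) ^+ j) p.2 =
    (colour (quadrant D p (~~ n) j), colour (quadrant D p n j)).
  apply: etrans (sideE (side_pair_double p21 (sign1 j))) _.
  rewrite N' -scaleNr signN negbK -cE.
  exact: (congr2 pair (colour_germC _ _ _) (colour_germC _ _ _)).
have Hn : (~~ n (+) n = true) * (n (+) n = false) by case: (n).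
rewrite /side_colour -/n; split.
- by apply: etrans (H1 true) _; case: (n).
- by apply: etrans (H1 false) _; case: (n).
- by apply: etrans (H2 true) _; case: (n).
- by apply: etrans (H2 false) _; case: (n).
Qed.

(** The 0-chain of an edge of the diagram whose two sides have the colours [v]. *)
Definition edge_chain (v : X * X) : chain X 0 := << [tuple v.1; v.2] >>.

Lemma bd_crossing_chain p : crossing_param p ->
  bd (crossing_chain gamma p) =
  (edge_chain (before p.1) - edge_chain (after p.1)) +
  (edge_chain (before p.2) - edge_chain (after p.2)).
Proof.
move=> pD; rewrite crossing_chainE //; have [-> -> -> ->] := crossing_sides pD.
rewrite /edge_chain /=; have := side_colour_heap pD.
move: (side_colour p) (crossing_neg p) => C n CE.
have E := bd_simplex3 (C false false) (C true false) (C true true).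
rewrite -CE in E; case: n => /=.
  by rewrite expr1 scaleN1r raddfN /= E; chain_ring.
by rewrite expr0 scale1r E; chain_ring.
Qed.

Lemma crossings_finite : finite_set (crossings D).
Proof. by apply: sub_finite_set (@dcurve_finite _ D) => p []. Qed.

Lemma crossings_inj1 p q : crossings D p -> crossings D q -> p.1 = q.1 -> p = q.
Proof.
move: p q => [s t] [s' t'] /= [/= _ t01 st _] [/= _ t'01 st' _] ss'.
rewrite -ss' in st' *; congr pair; exact: period_eq t01 t'01 (dcurve_no_triple st st').
Qed.

Lemma crossings_inj2 p q : crossings D p -> crossings D q -> p.2 = q.2 -> p = q.
Proof.
move: p q => [t s] [t' s'] /= [/= t01 _ ts _] [/= t'01 _ ts' _] ss'.
rewrite -ss' in ts' *; congr pair.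
exact: period_eq t01 t'01 (dcurve_no_triple (double_pointC ts) (double_pointC ts')).
Qed.

Lemma double_crossing s t : 0 <= s < 1 -> double_point c s t ->
  exists t', crossings D (s, t') \/ crossings D (t', s).
Proof.
move=> s01 st; exists (frac t).
have st' : double_point c s (frac t).
  by have := double_pointD 0 (- Num.floor t) st; rewrite addr0 mulrNz.
have := dover_under st'; have t01 := frac_itv t.
have [so _|so /=] := boolP (dover D s); first by left; split.
by case: (boolP (dover D _)) => // t'o _; right; split=> //; exact: double_pointC.
Qed.

(** The chain of a coloured diagram is a cycle: each double parameter is the over-
or the under-passage of exactly one crossing, so that the boundary is the sum of
all the jumps of the colours along the curve. *)
Lemma bd_diagram_chain : bd (diagram_chain gamma) = 0.
Proof.
rewrite /diagram_chain fsbig_finite ?raddf_sum /=; last exact: crossings_finite.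
rewrite -fsbig_finite; last exact: crossings_finite.
(* The jumps are kept abstract. *)
have [J JE] : {J : R -> chain X 0 |
    forall t, J t = edge_chain (before t) - edge_chain (after t)}.
  by exists (fun t => edge_chain (before t) - edge_chain (after t)).
have -> : \sum_(p \in crossings D) bd (crossing_chain gamma p) =
    \sum_(p \in crossings D) (J p.1 + J p.2).
  by apply: eq_fsbigr => p; rewrite inE !JE => /crossings_param; exact: bd_crossing_chain.
rewrite fsbig_split /=; last exact: crossings_finite.
pose O := fst @` crossings D; pose U := snd @` crossings D.
have <- : \sum_(t \in O) J t = \sum_(p \in crossings D) J p.1.
  by apply: fsbig_image => p q; rewrite !inE; exact: crossings_inj1.
have <- : \sum_(t \in U) J t = \sum_(p \in crossings D) J p.2.
  by apply: fsbig_image => p q; rewrite !inE; exact: crossings_inj2.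
have Ofin : finite_set O by exact: finite_image crossings_finite.
have Ufin : finite_set U by exact: finite_image crossings_finite.
rewrite -fsbigU0 //; last first.
  move=> _ [[[s t] /= [_ _ /dover_under st so] <-] [[s' t'] /= [_ _ /dover_under st' s'o] ss']].
  by move: st'; rewrite s'o ss' so.
have O01 t : (O `|` U) t -> 0 <= t < 1 by case=> -[p [p1 p2 _ _] <-].
rewrite (eq_fsbigr _ _ (fun t _ => JE t)).
apply: (@step_jumps _ _ _ edge_chain side_pair (O `|` U) side_pair_step
  side_pair_periodic _ O01).
  by rewrite finite_setU.
move=> t t01 tN; suff /side_pair_simple[h1 h2] : ~ double_param D t.
  exact: etrans h1 (esym h2).
move=> [s ts]; have [s' [tD|tD]] := double_crossing t01 ts; apply: tN.
  by left; exists (t, s').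
by right; exists (s', t).
Qed.

End Colours.

(** * Reparametrisation of the circle *)

Section Reparam.
Variables (R : realType) (theta : R -> R).

(** An orientation-preserving reparametrisation of the circle, lifted to the
line. *)
Definition circle_reparam :=
  (forall t, derivable theta t 1 /\ 0 < derive1 theta t) /\
  (forall t, theta (t + 1) = theta t + 1).

Hypothesis thetaP : circle_reparam.

Lemma reparamD t (k : int) : theta (t + k%:~R) = theta t + k%:~R.
Proof.
have natP (n : nat) s : theta (s + n%:R) = theta s + n%:R.
  elim: n s => [|n IH] s; first by rewrite !addr0.
  by rewrite -natr1 !addrA thetaP.2 IH.
case: k => n; first exact: natP.
rewrite NegzE mulrNz -pmulrn; have := natP n.+1 (t - n.+1%:R).
by rewrite subrK => ->; rewrite addrK.
Qed.

Lemma reparam_continuous : continuous theta.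
Proof.
move=> t; apply: differentiable_continuous; apply/derivable1_diffP.
by have [] := thetaP.1 t.
Qed.

Lemma reparam_lt s t : s < t -> theta s < theta t.
Proof.
move=> st; apply: (@gtr0_derive1_incr R theta s t) => // [x _|x _|].
- by have [] := thetaP.1 x.
- by have [] := thetaP.1 x.
- exact: continuous_subspaceT reparam_continuous.
Qed.

Lemma reparam_lt_iff s t : (theta s < theta t) = (s < t).
Proof.
case: (ltgtP s t) => [/reparam_lt//|/reparam_lt/ltW|->]; last by rewrite ltxx.
by rewrite leNgt => /negbTE.
Qed.

Lemma reparam_inj : injective theta.
Proof. by move=> s t st; case: (ltgtP s t) => // /reparam_lt; rewrite st ltxx. Qed.

Lemma reparam_int s t : (theta s - theta t \is a Num.int) = (s - t \is a Num.int).
Proof.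
apply/intrP/intrP => -[k kE]; exists k; last first.
  have -> : s = t + k%:~R by rewrite -kE addrC subrK.
  by rewrite reparamD addrC addKr.
apply/eqP; rewrite subr_eq; apply/eqP/reparam_inj.
by rewrite addrC reparamD -kE addrC subrK.
Qed.

Lemma reparam_surj u : exists t, theta t = u.
Proof.
pose n := Num.floor (u - theta 0); have := floor_itv (u - theta 0).
rewrite -/n intrD => /andP[n1 n2].
have [| |t _ tE] := @IVT R theta n%:~R (n + 1)%:~R u _ (continuous_subspaceT reparam_continuous).
- by rewrite ler_int lerDl.
- rewrite -[n%:~R]add0r -[(n + 1)%:~R]add0r !reparamD ge_min le_max intrD.
  by apply/andP; split; apply/orP; [left|right]; lra.
by exists t.
Qed.

Lemma derive1_reparam (f : R -> plane R) t : derivable f (theta t) 1 ->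
  derivable (f \o theta) t 1 /\
  derive1 (f \o theta) t = derive1 theta t *: derive1 f (theta t).
Proof.
move=> /derivable1_diffP df; have [/derivable1_diffP dt _] := thetaP.1 t.
have dft := differentiable_comp dt df; split; first exact/derivable1_diffP.
have E1 := derive1E' dft; have E2 := derive1E' df; have E3 := derive1E' dt.
apply: etrans E1 _; apply: etrans (congr1 (@^~ 1) (diff_comp dt df)) _.
rewrite {}E2 {}E3 -linearZ; congr ('d f (theta t) _); exact: (esym (mulr1 _)).
Qed.

End Reparam.

(** * Crossings away from a disc *)

Section Outside.
Variables (R : realType) (X : ternaryGroupType) (D D' : knotDiagram R).
Variables (gamma : tgHom (pi1T D) X) (gamma' : tgHom (pi1T D') X).
Variables (theta : R -> R) (B : set (plane R)).
Local Notation c := (dcurve D).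
Local Notation c2 := (dcurve D').

Hypothesis thetaP : circle_reparam theta.
Hypothesis Bclosed : closed B.
Hypothesis same : forall t, ~ B (c t) -> c2 (theta t) = c t /\
  forall s, double_point c t s -> dover D' (theta t) = dover D t.
Hypothesis sameB : forall t, B (c t) <-> B (c2 (theta t)).
Hypothesis agree : colors_agree_outside B gamma gamma'.

(** The hypotheses only compare the diagrams at points off [B]; a double point
involves two parameters, and both are off [B] or none is. *)
Lemma double_out s t : ~ B (c s) ->
  double_point c s t <-> double_point c2 (theta s) (theta t).
Proof.
move=> sB; have [sE _] := same sB.
rewrite /double_point reparam_int //; split=> -[st stN]; split=> //.
  have tB : ~ B (c t) by rewrite -st.
  by have [-> _] := same tB; rewrite sE.
have tB : ~ B (c t) by move=> /sameB; rewrite -st sE.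
by have [<- _] := same tB; rewrite -sE.
Qed.

Lemma near_out q : ~ B q -> exists2 d : R, 0 < d & forall q', `|q' - q| < d -> ~ B q'.
Proof.
move=> qB; have /nbhs_normP[d /= d0 dP] : \forall q' \near q, (~` B) q'.
  by apply: open_nbhs_nbhs; split; [exact: closed_openC|].
exists d => // q' q'q; apply: dP.
by rewrite /= distrC.
Qed.

Lemma curve_near_out t : ~ B (c t) ->
  exists2 d : R, 0 < d & forall x, `|x - t| < d -> ~ B (c x).
Proof.
move=> /near_out[d d0 dP].
have := @dcurve_continuous _ D t; move=> /cvgrPdist_lt/(_ d d0)/near_dist[d' d'0 d'P].
by exists d' => // x /d'P xd; apply: dP; rewrite distrC.
Qed.

Lemma derive1_out t : ~ B (c t) ->
  derive1 c t = derive1 theta t *: derive1 c2 (theta t).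
Proof.
move=> tB; have [_ <-] := derive1_reparam thetaP (@dcurve_derivable _ D' (theta t)).
rewrite !derive1E; apply: near_eq_derive; have [d d0 dP] := curve_near_out tB.
by apply/near_dist; exists d => // x /dP xB; have [] := same xB.
Qed.

(** Regions seen from a point off [B] in the same direction have the same colour,
since they share points off [B]. *)
Lemma region_out (u : plane R) (q : plane R) (r : region D) (r' : region D') (d d' : R) :
  ~ B q -> 0 < d -> 0 < d' ->
  (forall e : R, 0 < e < d -> region_set r (q + e *: u)) ->
  (forall e : R, 0 < e < d' -> region_set r' (q + e *: u)) ->
  colour gamma r = colour gamma' r'.
Proof.
move=> /near_out[d1 d10 d1P] d0 d'0 dP d'P.
pose m := Num.min (Num.min d d') (d1 / (`|u| + 1)).
have u1 : 0 < `|u| + 1 by rewrite ltr_wpDl.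
have m0 : 0 < m by rewrite !lt_min d0 d'0 divr_gt0.
have [e e0 em] : exists2 e : R, 0 < e & e < m by exists (m / 2); lra.
move: em; rewrite !lt_min => /andP[/andP[ed ed'] ed1].
apply: (@agree (q + e *: u)); [|by apply: dP; rewrite e0|by apply: d'P; rewrite e0].
apply: d1P; rewrite addrC addKr normrZ gtr0_norm //.
move: ed1; rewrite ltr_pdivlMr // mulrDr mulr1; lra.
Qed.

Lemma side_pair_out t : ~ B (c t) -> ~ double_param D t ->
  side_pair gamma t = side_pair gamma' (theta t).
Proof.
move=> tB tN; have [tE _] := same tB; have dE := derive1_out tB.
have tN' : ~ double_param D' (theta t).
  move=> [u]; have [s <-] := reparam_surj thetaP u.
  by move=> /(double_out _ tB) ts; apply: tN; exists s.
have [_ dt0] := thetaP.1 t.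
have tn := cross_lnormal (@dcurve_regular _ D t); set n := lnormal _ in tn.
have tn' : 0 < cross (derive1 c2 (theta t)) n.
  by move: tn; rewrite {1}dE crossZl pmulr_rgt0.
have [_ [d d0 dP]] := left_region_simple tN tn.
have [_ [d' d'0 d'P]] := left_region_simple tN' tn'.
have [|_ [d1 d10 d1P]] := @right_region_simple _ _ _ (- n) tN.
  by rewrite crossNr oppr_lt0; exact: tn.
have [|_ [d1' d1'0 d1'P]] := @right_region_simple _ _ _ (- n) tN'.
  by rewrite crossNr oppr_lt0; exact: tn'.
rewrite tE in d'P d1'P.
exact: (congr2 pair (region_out tB d0 d'0 dP d'P) (region_out tB d10 d1'0 d1P d1'P)).
Qed.

(** It suffices that the curve is off [B] on the side of [t] under consideration:
[t] may be an end of an arc in [B]. *)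
Lemma side_out t (a : R) : `|a| = 1 ->
  (exists2 d : R, 0 < d & forall x, 0 < x < d -> ~ B (c (t + a * x))) ->
  side (side_pair gamma) a t = side (side_pair gamma') a (theta t).
Proof.
move=> a1 [d d0 dB]; apply: sideE.
have aa := norm1_sq a1.
have [w [d' d'0 d'w]] : exists w, side_value (side_pair gamma') a (theta t) w.
  have [v [w [vP wP]]] := side_pair_step gamma' (theta t).
  have /orP[/eqP->|/eqP->] : (a == 1) || (a == -1) by rewrite -sqrf_eq1 expr2 aa.
    by exists v.
  by exists w.
have -> : side (side_pair gamma') a (theta t) = w by apply: sideE; exists d'.
have [d1 d10 iso] := double_param_isolated D t.
have := reparam_continuous thetaP (x := t).
move=> /cvgrPdist_lt/(_ d' d'0)/near_dist[d2 d20 near2].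
exists (Num.min d (Num.min d1 d2)) => [|x]; first by rewrite !lt_min d0 d10.
rewrite !lt_min => /andP[x0 /and3P[xd xd1 xd2]].
have nx : `|t + a * x - t| = x by rewrite addrC addKr normrM a1 mul1r gtr0_norm.
rewrite side_pair_out; last by apply: iso; rewrite nx x0.
  have -> : theta (t + a * x) = theta t + a * (a * (theta (t + a * x) - theta t)).
    by rewrite mulrA aa mul1r [theta t + _]addrC subrK.
  apply: d'w; apply/andP; split; last first.
    apply: le_lt_trans (ler_norm _) _; rewrite normrM a1 mul1r distrC.
    by apply: near2; rewrite nx.
  have [a0|a0|a0] := ltgtP a 0.
  - rewrite nmulr_rgt0 // subr_lt0 reparam_lt_iff // gtrDl nmulr_rlt0 //.
  - by rewrite pmulr_rgt0 // subr_gt0 reparam_lt_iff // ltrDl mulr_gt0.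
  - by move: a1; rewrite a0 normr0 => /esym/eqP; rewrite oner_eq0.
by apply: dB; rewrite x0.
Qed.

(** The pair of parameters of [D'] of a crossing of [D] off [B]. *)
Definition theta2 (p : R * R) : R * R := (theta p.1, theta p.2).

Lemma crossing_chain_out p : crossing_param D p -> ~ B (c p.1) ->
  crossing_param D' (theta2 p) /\
  crossing_chain gamma p = crossing_chain gamma' (theta2 p).
Proof.
move=> pD pB; have [p12 po] := pD.
have p2B : ~ B (c p.2) by have [<- _] := p12.
have pD' : crossing_param D' (theta2 p).
  by split; [exact/(double_out _ pB) | have [_ /(_ _ p12) ->] := same pB].
split=> //; rewrite !crossing_chainE //.
have out (t a : R) : ~ B (c t) -> `|a| = 1 ->
    side (side_pair gamma) a t = side (side_pair gamma') a (theta t).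
  move=> tB a1; apply: side_out => //; have [d d0 dP] := curve_near_out tB.
  exists d => // x /andP[x0 xd]; apply: dP.
  by rewrite addrC addKr normrM a1 mul1r gtr0_norm.
have negE : crossing_neg D (p.1, p.2) = crossing_neg D' (theta2 p).
  rewrite /crossing_neg /= (derive1_out pB) (derive1_out p2B) crossZl crossZr.
  by rewrite !pmulr_rlt0 //; [have [] := thetaP.1 p.2 | have [] := thetaP.1 p.1].
rewrite -surjective_pairing in negE.
have [b1 a1 _ _] := crossing_sides gamma pD; have [b1' a1' _ _] := crossing_sides gamma' pD'.
have bE := out p.1 (-1) pB; have aE := out p.1 1 pB.
rewrite normrN normr1 in bE aE.
have [bF bT] : side_colour gamma p false (crossing_neg D p) =
    side_colour gamma' (theta2 p) false (crossing_neg D p) /\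
    side_colour gamma p true (crossing_neg D p) =
    side_colour gamma' (theta2 p) true (crossing_neg D p).
  rewrite {2 4}negE; have := etrans (esym b1) (etrans (bE erefl) b1').
  by case=> E1 E2; split; [exact: E1 | exact: E2].
have [aF aT] : side_colour gamma p false (~~ crossing_neg D p) =
    side_colour gamma' (theta2 p) false (~~ crossing_neg D p) /\
    side_colour gamma p true (~~ crossing_neg D p) =
    side_colour gamma' (theta2 p) true (~~ crossing_neg D p).
  rewrite {2 4}negE; have := etrans (esym a1) (etrans (aE erefl) a1').
  by case=> E1 E2; split; [exact: E1 | exact: E2].
rewrite -negE; move: bF bT aF aT; case: crossing_neg => /= E1 E2 E3 E4.
  by rewrite E2 E3 E4.
by rewrite E1 E2 E4.
Qed.

(** The crossings off [B] contribute the same chain to both diagrams. *)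
Lemma sum_out :
  \sum_(p \in crossings D `&` [set p | ~ B (c p.1)]) crossing_chain gamma p =
  \sum_(p \in crossings D' `&` [set p | ~ B (c2 p.1)]) crossing_chain gamma' p.
Proof.
rewrite [RHS](reindex_fsbig (fun p => frac2 (theta2 p))
  (crossings D `&` [set p | ~ B (c p.1)])).
  apply: eq_fsbigr => p; rewrite inE => -[/crossings_param pD pB].
  by rewrite crossing_chain_frac; have [] := crossing_chain_out pD pB.
have frac_eq (s t : R) : 0 <= s < 1 -> 0 <= t < 1 ->
    frac (theta s) = frac (theta t) -> s = t.
  move=> s01 t01; rewrite /frac => /eqP; rewrite -subr_eq0 => /eqP st.
  have : theta s - theta t \is a Num.int.
    have -> : theta s - theta t = (Num.floor (theta s) - Num.floor (theta t))%:~R.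
      by rewrite intrB; lra.
    exact: intr_int.
  by rewrite reparam_int //; exact: period_eq.
split.
- move=> p [/crossings_param pD pB] /=; have [pD' _] := crossing_chain_out pD pB.
  split; first exact: crossing_frac.
  by rewrite /= dcurve_frac => /sameB.
- move=> [s t] [s' t']; rewrite !inE => -[[/= s01 t01 _ _] _] [[/= s'01 t'01 _ _] _].
  by move=> [ss' tt']; congr pair; exact: frac_eq.
move=> [u v] [[/= u01 v01 uv uo] uB].
have [s su] := reparam_surj thetaP u; have [t tv] := reparam_surj thetaP v.
have sB : ~ B (c s) by move=> /sameB; rewrite su.
have st : double_point c s t by apply/(double_out _ sB); rewrite su tv.
have so : dover D s by have [_ /(_ _ st) <-] := same sB; rewrite su.
have frac_theta (w x : R) : theta x = w -> 0 <= w < 1 -> frac (theta (frac x)) = w.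
  move=> xw w01; rewrite /frac -mulrNz reparamD // xw mulrNz.
  rewrite (_ : Num.floor (w - (Num.floor x)%:~R) = - Num.floor x).
    by rewrite mulrNz opprK subrK.
  apply: floor_def; rewrite intrD mulrNz; move: w01 (Num.floor x)%:~R => /andP[w0 w1] k.
  by apply/andP; split; lra.
exists (frac s, frac t); last first.
  by rewrite /frac2 /theta2 /= (frac_theta u s) // (frac_theta v t).
split; last by rewrite /= dcurve_frac.
by have /crossing_frac : crossing_param D (s, t) by split.
Qed.

End Outside.

(** * The part of a diagram inside a disc *)

Section Inside.
Variables (R : realType) (X : ternaryGroupType) (D : knotDiagram R).
Variable gamma : tgHom (pi1T D) X.
Local Notation c := (dcurve D).

(** A crossing is determined by its position. *)
Lemma crossings_point_inj p q : crossings D p -> crossings D q ->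
  c p.1 = c q.1 -> p = q.
Proof.
move=> pD qD pq; have [[p01 p02 p12 po] [q01 _ _ qo]] := (pD, qD).
have [pqZ|pqN] := boolP (p.1 - q.1 \is a Num.int).
  by apply: (crossings_inj1 pD qD); exact: period_eq p01 q01 pqZ.
have p1q1 : double_point c p.1 q.1 by split.
have := dover_under p12; rewrite po.
by rewrite (period_eq p02 q01 (dcurve_no_triple p12 p1q1)) qo.
Qed.

(** The crossings in [B] are listed by [L] as soon as their positions are. *)
Lemma sum_in (B : set (plane R)) (L : seq (R * R)) :
  uniq [seq c p.1 | p <- L] ->
  (forall p, p \in L -> crossing_param D p /\ B (c p.1)) ->
  (forall s t, double_point c s t -> B (c s) -> c s \in [seq c p.1 | p <- L]) ->
  \sum_(p \in crossings D `&` [set p | B (c p.1)]) crossing_chain gamma p =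
  \sum_(p <- L) crossing_chain gamma p.
Proof.
move=> Luniq LP Lall.
have -> : \sum_(p <- L) crossing_chain gamma p =
    \sum_(p <- map (@frac2 R) L) crossing_chain gamma p.
  by rewrite big_map; apply: eq_bigr => p _; rewrite crossing_chain_frac.
rewrite [RHS]fsbig_seq; last first.
  apply: (@map_uniq _ _ (fun p => c p.1)).
  have <- : [seq c p.1 | p <- L] = [seq c p.1 | p <- map (@frac2 R) L].
    by elim: (L) => //= p l ->; rewrite dcurve_frac.
  exact: Luniq.
suff -> : crossings D `&` [set p | B (c p.1)] = [set` map (@frac2 R) L] by [].
apply/seteqP; split=> p /=.
  move=> [pD pB]; have [_ _ p12 _] := pD.
  have /mapP[q qL pq] := Lall _ _ p12 pB; apply/mapP; exists q => //.
  have [qD _] := LP q qL; apply: (crossings_point_inj pD (crossing_frac qD)).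
  by rewrite /= dcurve_frac.
move=> /mapP[q /LP[qD qB] ->]; split; first exact: crossing_frac.
by rewrite /= dcurve_frac.
Qed.

Lemma diagram_chain_split (B : set (plane R)) :
  diagram_chain gamma =
  \sum_(p \in crossings D `&` [set p | B (c p.1)]) crossing_chain gamma p +
  \sum_(p \in crossings D `&` [set p | ~ B (c p.1)]) crossing_chain gamma p.
Proof. exact: (fsbigID [set p | B (c p.1)] _ _ (crossings_finite D)). Qed.

End Inside.

Lemma cross_linear (R : realType) (L : {linear plane R -> plane R}) (u v : plane R) :
  cross (L u) (L v) = cross u v * cross (L (1, 0)) (L (0, 1)).
Proof.
have E (w : plane R) : w = w.1 *: (1, 0) + w.2 *: (0, 1).
  by apply: plane_eq; rewrite !coordE /=; ring.
rewrite [in LHS](E u) [in LHS](E v) !linearD !linearZ /=.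
rewrite !(crossDl, crossDr, crossZl, crossZr) !cross_id.
by rewrite (crossC (L (0, 1)) (L (1, 0))) /cross; ring.
Qed.

(** The colours around the three crossings of the third picture fit together into
one family indexed by the sides of the three strands. *)
Lemma triple_family (T : Type) (eps : bool) (K L M : bool -> bool -> T) :
  (forall z, K z (~~ eps) = M z eps) -> (forall z, K (~~ eps) z = L eps z) ->
  (forall z, M (~~ eps) z = L z (~~ eps)) ->
  exists P : bool -> bool -> bool -> T,
  [/\ K = (fun z w => P w z eps), L = (fun z w => P w (~~ eps) z) &
      M = (fun z w => P (~~ eps) z w)].
Proof.
move=> KM KL ML.
exists (fun x0 x1 x2 : bool => if x2 == eps then K x1 x0
                        else if x1 == ~~ eps then L x2 x0 else M x1 x2).
move: KM KL ML; case: eps => KM KL ML; split; apply/funext => -[];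
  by apply/funext => -[]; rewrite ?(KM, KL, ML) //= -?(KM, KL, ML).
Qed.

(** * Arcs in a disc *)

(** The arcs of the diagram in [B] are parametrised through [theta], the identity
for one of the diagrams of a move and the given reparametrisation for the
other one. *)
Section Picture.
Variables (R : realType) (X : ternaryGroupType) (D : knotDiagram R).
Variables (gamma : tgHom (pi1T D) X) (theta : R -> R).
Local Notation c := (dcurve D).
Local Notation C := (dcurve D \o theta).
Hypothesis thetaP : circle_reparam theta.

Variables (m : move_type) (e : R) (B : set (plane R)).
Variables (a b : nat -> R) (o : nat -> bool) (h : plane R -> plane R).
Variable phi : nat -> R -> R.
Local Notation n := (nstrands m).
Hypothesis hP : oriented_diffeo h.
Hypothesis Barc : forall t, B (C t) <->
  exists i (k : int), (i < n)%N /\ a i <= t + k%:~R <= b i.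
Hypothesis arcP : forall i, (i < n)%N ->
  [/\ a i < b i,
      forall t, a i <= t <= b i -> h (C t) = strand m e i (phi i t),
      forall t, a i <= t <= b i ->
        derivable (phi i) t 1 /\ 0 < (-1) ^+ o i * derive1 (phi i) t
    & phi i @` [set t | a i <= t <= b i] =
      [set t | std_disc (strand m e i t)]].
Hypothesis arc_disjoint : forall i j s t (k : int), (i < n)%N -> (j < n)%N ->
  a i <= s <= b i -> a j <= t <= b j -> s - t = k%:~R -> i = j /\ k = 0.

Implicit Types (i j : nat) (s t x y : R).

(** [phi i] is strictly monotone on the arc, in the direction told by [o i]. *)
Lemma phi_mono i s t : (i < n)%N -> a i <= s -> s < t -> t <= b i ->
  0 < (-1) ^+ o i * (phi i t - phi i s).
Proof.
move=> ni as_ st tb; have [_ _ dphi _] := arcP ni.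
have arc z : s <= z <= t -> a i <= z <= b i.
  by move=> /andP[sz zt]; rewrite (le_trans as_ sz) (le_trans zt tb).
have [z|z|z zst ->] := @MVT_segment R (phi i) (derive1 (phi i)) s t (ltW st).
- rewrite in_itv /= => /andP[sz zt]; have zst : s <= z <= t by rewrite !ltW.
  have [dz _] := dphi z (arc z zst); by rewrite derive1E; exact: derivableP.
- apply: derivable_within_continuous => u; rewrite in_itv /= => /arc/dphi[] //.
rewrite in_itv /= in zst; have [_ dz] := dphi z (arc z zst).
by rewrite mulrA mulr_gt0 // subr_gt0.
Qed.

Lemma phi_lt i s t : (i < n)%N -> a i <= s <= b i -> a i <= t <= b i ->
  phi i s < phi i t -> if o i then t < s else s < t.
Proof.
move=> ni /andP[as_ sb] /andP[at_ tb] st.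
have [tlts|slt|E] := ltgtP t s; last by move: st; rewrite E ltxx.
- by have := phi_mono ni at_ tlts sb; case: (o i) => //=; rewrite expr0 mul1r; lra.
- by have := phi_mono ni as_ slt tb; case: (o i) => //=; rewrite expr1 mulN1r; lra.
Qed.

Lemma phi_inj i s t : (i < n)%N -> a i <= s <= b i -> a i <= t <= b i ->
  phi i s = phi i t -> s = t.
Proof.
move=> ni /andP[as_ sb] /andP[at_ tb] st.
have [tlts|slt|->//] := ltgtP t s.
- by have := phi_mono ni at_ tlts sb; rewrite st subrr mulr0 ltxx.
- by have := phi_mono ni as_ slt tb; rewrite st subrr mulr0 ltxx.
Qed.

Lemma phi_surj i x : (i < n)%N -> std_disc (strand m e i x) ->
  exists2 s, a i <= s <= b i & phi i s = x.
Proof.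
move=> ni xd; have [_ _ _ E] := arcP ni.
have : (phi i @` [set t | a i <= t <= b i]) x by rewrite E.
by move=> [s /= si sx]; exists s.
Qed.

Lemma h_inj : injective h.
Proof. by case: hP => _ [g [_ hK _]] _; exact: can_inj hK. Qed.

Lemma arc_B i s : (i < n)%N -> a i <= s <= b i -> B (C s).
Proof. by move=> ni si; apply/Barc; exists i, 0; rewrite addr0. Qed.

Lemma C_shift t (k : int) : C (t + k%:~R) = C t.
Proof. by rewrite /= reparamD // dcurve_periodicz. Qed.

Lemma double_reparam s t : double_point c (theta s) (theta t) <->
  C s = C t /\ s - t \isn't a Num.int.
Proof. by rewrite /double_point reparam_int. Qed.

(** A double point on an arc is an intersection of strands. *)
Lemma arc_double i s : (i < n)%N -> a i <= s <= b i -> double_param D (theta s) ->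
  exists j t, [/\ (j < n)%N, a j <= t <= b j,
    strand m e i (phi i s) = strand m e j (phi j t),
    i = j -> phi i s <> phi j t & C s = C t].
Proof.
move=> ni si [u]; have [t <-] := reparam_surj thetaP u.
move=> /double_reparam[st stN].
have /Barc[j [k [nj tj]]] : B (C t) by rewrite -st; exact: arc_B ni si.
exists j, (t + k%:~R); split=> //.
- have [_ hi _ _] := arcP ni; have [_ hj _ _] := arcP nj.
  by rewrite -hi // -hj // C_shift st.
- move=> ij; subst j => /(phi_inj ni si tj) sE; apply/negP: stN.
  by rewrite sE [t + _]addrC addrK intr_int.
- by rewrite C_shift.
Qed.

Lemma strand_double i j s t : (i < n)%N -> (j < n)%N ->
  a i <= s <= b i -> a j <= t <= b j ->
  strand m e i (phi i s) = strand m e j (phi j t) ->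
  (i = j -> phi i s <> phi j t) -> double_point c (theta s) (theta t).
Proof.
move=> ni nj si tj st ij; apply/double_reparam; split.
  have [_ hi _ _] := arcP ni; have [_ hj _ _] := arcP nj.
  by apply: h_inj; rewrite hi // hj.
apply/negP => /intrP[k kE]; have [E k0] := arc_disjoint ni nj si tj kE.
by apply: (ij E); rewrite -E; congr (phi i); apply/eqP; rewrite -subr_eq0 kE k0.
Qed.

(** The curve is read in the direction of increasing parameter of the strands,
from west to east: [west i s] and [east i s] are the pairs of colours on both
sides of the [i]-th strand, first on the left of this direction, just to the
west and just to the east of the parameter [s]; the ends of the arcs are read
in the same direction. *)
Definition swap (v : X * X) : X * X := (v.2, v.1).
Definition west i s := if o i then swap (after gamma (theta s)) else before gamma (theta s).
Definition east i s := if o i then swap (before gamma (theta s)) else after gamma (theta s).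
Definition arc_start i := if o i then b i else a i.
Definition arc_end i := if o i then a i else b i.

Lemma after_before s t : s < t ->
  (forall z, s < z < t -> ~ double_param D (theta z)) ->
  after gamma (theta s) = before gamma (theta t).
Proof.
move=> st simple; apply: side_pair_constant; first exact: reparam_lt.
move=> x; have [z <-] := reparam_surj thetaP x.
by rewrite !reparam_lt_iff //; exact: simple.
Qed.

Lemma phi_ltE i s t : (i < n)%N -> a i <= s <= b i -> a i <= t <= b i ->
  (phi i s < phi i t) = if o i then t < s else s < t.
Proof.
move=> ni si ti; apply/idP/idP; first exact: phi_lt.
move=> st; rewrite ltNge le_eqVlt negb_or; apply/andP; split.
  by apply: contraTN st => /eqP/(phi_inj ni ti si) ->; case: (o i); rewrite ltxx.
by apply: contraTN st => /(phi_lt ni ti si); case: (o i) => /ltW; rewrite leNgt.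
Qed.

(** Colours do not change between consecutive double points of an arc, nor up to
its ends. *)
Lemma east_west i s t : (i < n)%N -> a i <= s <= b i -> a i <= t <= b i ->
  phi i s < phi i t ->
  (forall z, a i <= z <= b i -> phi i s < phi i z < phi i t ->
    ~ double_param D (theta z)) -> east i s = west i t.
Proof.
move=> ni si ti st simple; have := phi_lt ni si ti st.
have arc z : Num.min s t < z < Num.max s t -> a i <= z <= b i.
  move: si ti => /andP[as_ sb] /andP[at_ tb] /andP[]; rewrite gt_min lt_max.
  by move=> /orP[] z1 /orP[] z2; apply/andP; split; lra.
rewrite /east /west; case oi : (o i) => lt_st.
  apply: (congr1 swap); apply/esym; apply: (after_before lt_st) => z /andP[tz zs].
  have zi : a i <= z <= b i.
    by apply: arc; rewrite min_r ?max_l ?(ltW lt_st) // tz zs.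
  by apply: simple => //; rewrite !phi_ltE // oi tz zs.
apply: (after_before lt_st) => z /andP[sz zt].
have zi : a i <= z <= b i.
  by apply: arc; rewrite min_l ?max_r ?(ltW lt_st) // sz zt.
by apply: simple => //; rewrite !phi_ltE // oi sz zt.
Qed.

Lemma west_start i s : (i < n)%N -> a i <= s <= b i ->
  (forall z, a i <= z <= b i -> phi i z < phi i s -> ~ double_param D (theta z)) ->
  west i (arc_start i) = west i s.
Proof.
move=> ni si simple; have [ab _ _ _] := arcP ni; have /andP[as_ sb] := si.
have ai : a i <= a i <= b i by rewrite lexx ltW.
have bi : a i <= b i <= b i by rewrite lexx ltW.
rewrite /west /arc_start; case oi : (o i).
  have [sbi|sbi] : s < b i \/ s = b i by move: sb; rewrite le_eqVlt => /orP[/eqP|]; [right|left].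
  2: rewrite sbi; exact: erefl.
  apply: (congr1 swap).
  have [|h1 h2] := side_pair_simple gamma (simple (b i) bi _).
    by rewrite (phi_ltE ni) // oi.
   apply: etrans h2 _; apply: etrans (esym h1) _.
  apply/esym; apply: (after_before sbi) => z /andP[sz zb].
  have zi : a i <= z <= b i by rewrite (le_trans as_ (ltW sz)) ltW.
  by apply: simple => //; rewrite phi_ltE // oi.
have [ais|ais] : a i < s \/ a i = s by move: as_; rewrite le_eqVlt => /orP[/eqP|]; [right|left].
  2: rewrite -ais; exact: erefl.
have [|h1 h2] := side_pair_simple gamma (simple (a i) ai _).
  by rewrite (phi_ltE ni) // oi.
 apply: etrans h1 _; apply: etrans (esym h2) _.
apply: (after_before ais) => z /andP[az zs].
have zi : a i <= z <= b i by rewrite ltW //= (le_trans (ltW zs)).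
by apply: simple => //; rewrite phi_ltE // oi.
Qed.

Lemma east_end i s : (i < n)%N -> a i <= s <= b i ->
  (forall z, a i <= z <= b i -> phi i s < phi i z -> ~ double_param D (theta z)) ->
  east i s = east i (arc_end i).
Proof.
move=> ni si simple; have [ab _ _ _] := arcP ni; have /andP[as_ sb] := si.
have ai : a i <= a i <= b i by rewrite lexx ltW.
have bi : a i <= b i <= b i by rewrite lexx ltW.
rewrite /east /arc_end; case oi : (o i).
  have [ais|ais] : a i < s \/ a i = s by move: as_; rewrite le_eqVlt => /orP[/eqP|]; [right|left].
  2: rewrite -ais; exact: erefl.
  apply: (congr1 swap).
  have [|h1 h2] := side_pair_simple gamma (simple (a i) ai _).
    by rewrite (phi_ltE ni) // oi.
   apply/esym.
  apply: etrans h1 _; apply: etrans (esym h2) _.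
  apply: (after_before ais) => z /andP[az zs].
  have zi : a i <= z <= b i by rewrite ltW //= (le_trans (ltW zs)).
  by apply: simple => //; rewrite phi_ltE // oi.
have [sbi|sbi] : s < b i \/ s = b i by move: sb; rewrite le_eqVlt => /orP[/eqP|]; [right|left].
  2: rewrite sbi; exact: erefl.
have [|h1 h2] := side_pair_simple gamma (simple (b i) bi _).
  by rewrite (phi_ltE ni) // oi.
 apply/esym.
apply: etrans h2 _; apply: etrans (esym h1) _.
apply/esym; apply: (after_before sbi) => z /andP[sz zb].
have zi : a i <= z <= b i by rewrite (le_trans as_ (ltW sz)) ltW.
by apply: simple => //; rewrite phi_ltE // oi.
Qed.

(** The slope of a strand that is the graph of a function. *)
Definition slope i x : R :=
  match m, i with RII, 0 => 2 * x | RIII, 0 => 1 | RIII, 1 => -1 | _, _ => 0 end.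

Lemma is_derive_near (f g : R -> R) t (df dg : R) :
  (\near t, f t = g t) -> is_derive t (1 : R) f df -> is_derive t (1 : R) g dg -> df = dg.
Proof.
by move=> fg [_ <-] [_ <-]; exact: near_eq_derive.
Qed.

(** The differential of [h] maps the tangent of an arc to that of its strand. *)
Lemma arc_tangent i s : m <> RI -> (i < n)%N -> a i < s < b i ->
  'd h (C s) (derive1 C s) = derive1 (phi i) s *: (1, slope i (phi i s)) :> plane R.
Proof.
move=> mI ni /andP[as_ sb]; have [_ hC dphi _] := arcP ni.
have si : a i <= s <= b i by rewrite !ltW.
have [dps _] := dphi s si.
have [dC _] := derive1_reparam thetaP (@dcurve_derivable _ D (theta s)).
have /derivable1_diffP dC' := dC.
have dh : differentiable h (C s) by case: hP => -[].
have dhC := differentiable_comp dC' dh.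
have E1 := derive1E' dhC; have E2 := derive1E' dC'.
have <- : derive1 (h \o C) s = 'd h (C s) (derive1 C s).
  by apply: etrans E1 _; apply: etrans (congr1 (@^~ 1) (diff_comp dC' dh)) _; rewrite E2.
have [d1 d2] := is_derive_coord ((derivable1_diffP _ _).2 dhC).
have near_s : \near s, a i <= s <= b i.
  apply/near_dist; exists (Num.min (s - a i) (b i - s)).
    by rewrite lt_min !subr_gt0 as_.
  move=> x; rewrite lt_min !ltr_norml => /andP[/andP[? ?] /andP[? ?]].
  by apply/andP; split; lra.
have dphi' : is_derive s (1 : R) (phi i) (derive1 (phi i) s).
  by rewrite derive1E; exact: derivableP.
have fst_strand x : (strand m e i x).1 = x by case: (m) mI (i) => [//|_ [|k]|_ [|[|k]]].
apply: plane_eq; rewrite coordE.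
  apply: (is_derive_near (g := phi i) _ d1); last by rewrite /= mulr1; exact: dphi'.
  by apply: filterS near_s => x xi; rewrite /= hC // fst_strand.
pose g x := (strand m e i (phi i x)).2.
apply: (is_derive_near (g := g) _ d2).
  by apply: filterS near_s => x xi; rewrite /= hC.
rewrite /g /slope /=; case: (m) mI ni => [//|_|_] ni.
  case: (i) dphi' => [|k] dphi'.
    have H := is_deriveB (is_deriveM dphi' dphi') (is_derive_cst e s (1 : R)).
    by apply: is_derive_eq H _; rewrite subr0 /GRing.scale /=; ring.
  by apply: is_derive_eq (is_derive_cst (0 : R) s (1 : R)) _; rewrite mulr0.
case: (i) dphi' => [|[|k]] dphi'.
- by rewrite mulr1; exact: dphi'.
- by apply: is_derive_eq (is_deriveN dphi') _; rewrite mulrN1.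
- by apply: is_derive_eq (is_derive_cst e s (1 : R)) _; rewrite mulr0.
Qed.

(** Since [h] preserves the orientation, the sign of a crossing is told by the
slopes of the strands and by their orientations. *)
Lemma arc_cross i j s t : m <> RI -> (i < n)%N -> (j < n)%N ->
  a i < s < b i -> a j < t < b j -> C s = C t ->
  slope i (phi i s) < slope j (phi j t) ->
  crossing_neg D (theta s, theta t) = o i (+) o j /\
  crossing_neg D (theta t, theta s) = ~~ (o i (+) o j).
Proof.
move=> mI ni nj si tj st sl.
have Hs := arc_tangent mI ni si; have Ht := arc_tangent mI nj tj.
have [_ _ dphi_i _] := arcP ni; have [_ _ dphi_j _] := arcP nj.
have [_ ps] : derivable (phi i) s 1 /\ 0 < (-1) ^+ o i * derive1 (phi i) s.
  by apply: dphi_i; move: si => /andP[/ltW-> /ltW->].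
have [_ pt] : derivable (phi j) t 1 /\ 0 < (-1) ^+ o j * derive1 (phi j) t.
  by apply: dphi_j; move: tj => /andP[/ltW-> /ltW->].
have [_ _ det] := hP; have {}det := det (C s).
rewrite -st in Ht.
have := cross_linear ('d h (C s)) (derive1 C s) (derive1 C t).
have -> : cross ('d h (C s) (derive1 C s)) ('d h (C s) (derive1 C t)) =
    derive1 (phi i) s * derive1 (phi j) t * (slope j (phi j t) - slope i (phi i s)).
  rewrite Hs Ht crossZl crossZr {1}/cross /=; ring.
have [_ ->] := derive1_reparam thetaP (@dcurve_derivable _ D (theta s)).
have [_ ->] := derive1_reparam thetaP (@dcurve_derivable _ D (theta t)).
have [_ ts] := thetaP.1 s; have [_ tt] := thetaP.1 t.
rewrite /crossing_neg /= (crossC (derive1 c (theta t))) crossZl crossZr oppr_lt0.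
move: (derive1 (phi i) s) (derive1 (phi j) t) ps pt (cross _ (derive1 c _)) => p q ps pt w.
move: (cross _ _) det (derive1 theta s) (derive1 theta t) ts tt => det det0 d1 d2 d10 d20.
move=> E; have sl0 : 0 < slope j (phi j t) - slope i (phi i s) by rewrite subr_gt0.
have k0 : 0 < d1 * d2 * det by rewrite !mulr_gt0.
have {}E : p * q * (slope j (phi j t) - slope i (phi i s)) = w * (d1 * d2 * det).
  by rewrite E; ring.
have wlt : (w < 0) = (p * q < 0).
  by rewrite -(pmulr_llt0 w k0) -E pmulr_llt0.
have wgt : (0 < w) = (0 < p * q).
  by rewrite -(pmulr_lgt0 w k0) -E pmulr_lgt0.
rewrite wlt wgt; case: (o i) ps; case: (o j) pt; rewrite ?expr1 ?expr0 ?mul1r ?mulN1r ?oppr_gt0.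
- by move=> q0 p0; rewrite ltNge ltW ?nmulr_lgt0 //= nmulr_lgt0.
- by move=> q0 p0; rewrite pmulr_llt0 // p0 ltNge ltW // pmulr_llt0.
- by move=> q0 p0; rewrite nmulr_llt0 // p0 ltNge ltW // nmulr_llt0.
- by move=> q0 p0; rewrite ltNge ltW ?mulr_gt0 //= mulr_gt0.
Qed.

(** The heap relation at a crossing. The argument [x] of a family of four
colours is [true] on the right of the over-strand, and [y] on the right of the
under-strand. *)
Definition crossing_rel (K : bool -> bool -> X) : Prop :=
  K false true = heap (K false false) (K true false) (K true true).

(** The triple of a crossing with colours [K], without its sign. *)
Definition crossing_simplex (K : bool -> bool -> X) : chain X 1 :=
  << [tuple K false false; K true false; K true true] >>.

(** The heap relation and the chain of a crossing with colours [K], given in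
terms of the sides of a strand [i] and a strand [j] for a direction of reading
that [oi] and [oj] compare with the orientation; [g] tells whether the [i]-th
strand is the over-strand. *)
Definition over_first (g oi oj : bool) (K : bool -> bool -> X) (x y : bool) : X :=
  if g then K (x (+) oi) (y (+) oj) else K (y (+) oi) (x (+) oj).

Definition pair_rel (g oi oj : bool) K := crossing_rel (over_first g oi oj K).

Definition pair_chain (g oi oj : bool) K : chain X 1 :=
  (-1) ^+ (g (+) ~~ (oi (+) oj)) *: crossing_simplex (over_first g oi oj K).

(** A crossing seen in the picture: the [i]-th strand comes from above and the
[j]-th one from below; [K x y] is the colour of the region that lies below the
[i]-th strand iff [x] and below the [j]-th one iff [y]. *)
Lemma picture_crossing i j s t : m <> RI -> (i < n)%N -> (j < n)%N ->
  a i < s < b i -> a j < t < b j -> double_point c (theta s) (theta t) ->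
  slope i (phi i s) < slope j (phi j t) ->
  let g := dover D (theta s) in
  exists K : bool -> bool -> X,
  [/\ west i s = (K false false, K true false),
      east i s = (K false true, K true true),
      west j t = (K true false, K true true),
      east j t = (K false false, K false true) &
      pair_rel g (o i) (o j) K /\
      exists p, [/\ crossing_param D p, c p.1 = C s &
        crossing_chain gamma p = pair_chain g (o i) (o j) K]].
Proof.
move=> mI ni nj si tj st sl g; have [Cst _] := st.
have [neg1 neg2] := arc_cross mI ni nj si tj Cst sl.
have := dover_under st; rewrite -/g /pair_rel /pair_chain /crossing_rel.
case gE : g => /= to.
  have pD : crossing_param D (theta s, theta t) by [].
  have := crossing_sides gamma pD; rewrite neg1 /=.
  have := crossing_chainE gamma pD; rewrite neg1.
  have := side_colour_heap gamma pD.
  move: (side_colour gamma _) => Q rel chainE [b1 a1 b2 a2].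
  exists (fun x y : bool => Q (x (+) o i) (y (+) o j)).
  rewrite /west /east b1 a1 b2 a2 /crossing_simplex /over_first negbK.
  have sub : exists p, [/\ crossing_param D p, c p.1 = C s &
      crossing_chain gamma p = (-1) ^+ (o i (+) o j) *:
        << [tuple Q false false; Q true false; Q true true] >>].
    by exists (theta s, theta t).
  by case: (o i) sub; case: (o j) => sub; split.
have pD : crossing_param D (theta t, theta s).
  by split; [exact: double_pointC | apply/negPn/negP => /negbTE tN; rewrite tN in to].
have := crossing_sides gamma pD; rewrite neg2 /=.
have := crossing_chainE gamma pD; rewrite neg2.
have := side_colour_heap gamma pD.
move: (side_colour gamma _) => Q rel chainE [b1 a1 b2 a2].
exists (fun x y : bool => Q (y (+) o j) (x (+) o i)).
rewrite /west /east b1 a1 b2 a2 /crossing_simplex /over_first.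
have sub : exists p, [/\ crossing_param D p, c p.1 = C s &
    crossing_chain gamma p = (-1) ^+ (~~ (o i (+) o j)) *:
      << [tuple Q false false; Q true false; Q true true] >>].
  by exists (theta t, theta s).
by case: (o i) sub; case: (o j) => sub; split.
Qed.

Lemma arc_interior i x1 x x2 s : (i < n)%N -> std_disc (strand m e i x1) ->
  std_disc (strand m e i x2) -> x1 < x < x2 -> a i <= s <= b i -> phi i s = x ->
  a i < s < b i.
Proof.
move=> ni /(phi_surj ni)[s1 s1i <-] /(phi_surj ni)[s2 s2i <-] s12 si sx.
move: s12; rewrite -sx !phi_ltE //; move: s1i s2i => /andP[? ?] /andP[? ?].
by case: (o i) => /andP[? ?]; apply/andP; split; lra.
Qed.

(** The double points in [B] are the intersections of the strands. *)
Lemma B_double s t : double_point c s t -> B (c s) -> exists i j u v,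
  [/\ (i < n)%N /\ (j < n)%N, a i <= u <= b i, a j <= v <= b j,
    strand m e i (phi i u) = strand m e j (phi j v) &
    (i = j -> phi i u <> phi j v) /\ C u = c s].
Proof.
have [s' <-] := reparam_surj thetaP s => st sB.
have /Barc[i [k [ni si]]] : B (C s') by [].
have sD : double_param D (theta (s' + k%:~R)).
  by rewrite reparamD //; apply/double_param_periodicz; exists t.
have [j [v [nj vj E ij CE]]] := arc_double ni si sD.
by exists i, j, (s' + k%:~R), v; split; rewrite ?C_shift.
Qed.

Lemma arc_point_eq i j s t : (i < n)%N -> (j < n)%N -> a i <= s <= b i ->
  a j <= t <= b j -> strand m e i (phi i s) = strand m e j (phi j t) <-> C s = C t.
Proof.
move=> ni nj si tj; have [_ hi _ _] := arcP ni; have [_ hj _ _] := arcP nj.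
by rewrite -hi // -hj //; split=> [/h_inj|->].
Qed.

(** * The first move *)

(** The chain of a kink is degenerate: the loop imposes the same pair of colours
at the two passages, so that two opposite regions have the same colour. *)
Lemma kink_degenerate p : crossing_param D p ->
  after gamma p.1 = before gamma p.2 \/ after gamma p.2 = before gamma p.1 ->
  crossing_chain gamma p \in @CD X 1.
Proof.
move=> pD loop; rewrite crossing_chainE //; apply: CDZ; apply: CDU.
have := side_colour_heap gamma pD; rewrite degenerate3.
have [b1 a1 b2 a2] := crossing_sides gamma pD.
rewrite b1 a1 b2 a2 {b1 a1 b2 a2} in loop.
move: (side_colour gamma p) (crossing_neg D p) loop => Q neg loop QE.
have E : Q false true = Q true false.
  by case: loop; case: neg => -[].
by rewrite -E {2}QE -E; apply/orP; left; apply/eqP; rewrite -heapA heapK heapKl.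
Qed.

Lemma RI_inside : m = RI -> e = 1 \/ e = -1 ->
  \sum_(p \in crossings D `&` [set p | B (c p.1)]) crossing_chain gamma p
    \in @CD X 1.
Proof.
move=> mE eE; have n0 : (0 < n)%N by rewrite mE.
have i0 i : (i < n)%N -> i = 0%N by rewrite mE; case: i.
(* The nodal cubic has its double point at the parameters [1] and [-1]. *)
have solve x y : strand m e 0 x = strand m e 0 y -> x <> y -> e = 1 /\ x = - y /\ y ^+ 2 = 1.
  rewrite mE /= => -[E1 E2] xyN.
  have xy : x = - y.
    have /eqP : (x - y) * (x + y) = 0 by rewrite -subr_sqr E1 subrr.
    by rewrite mulf_eq0 subr_eq0 addr_eq0 => /orP[/eqP|/eqP].
  have y0 : y != 0 by apply/eqP => y0; apply: xyN; rewrite xy y0 oppr0.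
  have /eqP : y * (y ^+ 2 - e) = 0 by move: E2; rewrite xy; lra.
  rewrite mulf_eq0 (negbTE y0) /= subr_eq0 => /eqP ye; rewrite ye.
  by case: eE ye => -> // ye; have := sqr_ge0 y; rewrite ye; lra.
have disc0 x : x ^+ 2 = 1 -> std_disc (strand m 1 0 x).
  move=> x1; have x3 : x ^+ 3 = x by rewrite exprS x1 mulr1.
  by rewrite mE /std_disc /= x3 x1 mul1r subrr expr0n /= addr0 expr1n; lra.
have [e1|e1] := eE; last first.
  rewrite (@sum_in _ _ _ gamma B [::]) //; first by rewrite big_nil rpred0.
  move=> s t st sB; have [i [j [u [v [[ni nj] ui vj E [ij _]]]]]] := B_double st sB.
  rewrite (i0 _ ni) (i0 _ nj) in E ij ui vj.
  by have [e1' _] := solve _ _ E (ij erefl); move: e1'; rewrite e1; lra.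
have [s1 s1i s1E] : exists2 s, a 0 <= s <= b 0 & phi 0 s = -1.
  by apply: phi_surj => //; rewrite e1; apply: disc0; rewrite sqrrN expr1n.
have [s2 s2i s2E] : exists2 s, a 0 <= s <= b 0 & phi 0 s = 1.
  by apply: phi_surj => //; rewrite e1; apply: disc0; rewrite expr1n.
have [s [t [st si ti [sE tE]]]] : exists s t, [/\ s < t, a 0 <= s <= b 0,
    a 0 <= t <= b 0 & phi 0 s ^+ 2 = 1 /\ phi 0 t = - phi 0 s].
  have [lt|lt|E] := ltgtP s1 s2.
  - by exists s1, s2; split=> //; rewrite s1E s2E sqrrN expr1n opprK.
  - by exists s2, s1; split=> //; rewrite s1E s2E expr1n.
  - by move: s1E; rewrite E s2E; lra.
have stE : strand m e 0 (phi 0 s) = strand m e 0 (phi 0 t).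
  rewrite mE /= e1 tE sqrrN; congr pair; rewrite !exprS expr0; move: sE; rewrite exprS expr1.
  move: (phi 0 s) => w ww; have -> : w * (w * (w * 1)) = w by rewrite mulr1 ww mulr1.
  by rewrite mulr1 mulrNN mulrN ww; lra.
have neq : phi 0 s <> phi 0 t by move=> E; move: sE; rewrite tE in E; nra.
have dst : double_point c (theta s) (theta t) by apply: strand_double stE _.
have AB : after gamma (theta s) = before gamma (theta t).
  apply: (after_before st) => z /andP[sz zt].
  have zi : a 0 <= z <= b 0.
    move: si ti => /andP[? ?] /andP[? ?]; apply/andP; split; lra.
  move=> /(arc_double n0 zi)[j [v [nj vj E ij _]]].
  rewrite (i0 _ nj) in E ij vj; have [_ [E1 E2]] := solve _ _ E (ij erefl).
  have : phi 0 z ^+ 2 = phi 0 s ^+ 2 by rewrite E1 sqrrN E2 sE.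
  move=> /eqP; rewrite eqf_sqr -tE => /orP[] /eqP /(phi_inj n0 zi) zE.
    by move: sz; rewrite (zE si) ltxx.
  by move: zt; rewrite (zE ti) ltxx.
have [p [pD pE loop]] : exists p, [/\ crossing_param D p, c p.1 = C s &
    after gamma p.1 = before gamma p.2 \/ after gamma p.2 = before gamma p.1].
  have := dover_under dst; case so : (dover D (theta s)) => /= to.
    exists (theta s, theta t).
    by split; [split; [exact: dst | exact: so] | exact: erefl | left; exact: AB].
  exists (theta t, theta s); split; last by right; exact: AB.
    by split; [exact: double_pointC | apply/negPn/negP => /negbTE tN; rewrite tN in to].
  by case: dst.
have L1 : uniq [seq c q.1 | q <- [:: p]] by [].
have L2 q : q \in [:: p] -> crossing_param D q /\ B (c q.1).
  by rewrite inE => /eqP ->; rewrite pE; split; [exact: pD | exact: arc_B si].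
rewrite (sum_in gamma L1 L2); first by rewrite big_seq1; exact: kink_degenerate.
move=> s' t' st' sB; have [i [j [u [v [[ni nj] ui vj E [ij uE]]]]]] := B_double st' sB.
rewrite (i0 _ ni) (i0 _ nj) in E ij ui vj uE; have [_ [E1 E2]] := solve _ _ E (ij erefl).
rewrite /= inE pE -uE; apply/eqP.
have : phi 0 u ^+ 2 = phi 0 s ^+ 2 by rewrite E1 sqrrN E2 sE.
move=> /eqP; rewrite eqf_sqr -tE => /orP[] /eqP /(phi_inj n0 ui) uv.
  by rewrite (uv si).
by rewrite (uv ti); apply/esym; case: dst.
Qed.

(** * The second move *)

Variable ht : nat -> nat.
Hypothesis heights : forall i j s t, (i < n)%N -> (j < n)%N -> i <> j ->
  a i <= s <= b i -> a j <= t <= b j -> double_point c (theta s) (theta t) ->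
  dover D (theta s) = (ht j < ht i)%N.

Lemma RII_strands i j x y : m = RII -> (i < n)%N -> (j < n)%N ->
  strand m e i x = strand m e j y -> (i = j -> x <> y) ->
  [/\ i <> j, x = y & x ^+ 2 = e].
Proof.
rewrite /n => ->; case: i => [|[|//]] _; case: j => [|[|//]] _ /= [xy] //.
- by move=> _ /(_ erefl).
- by rewrite -xy => /eqP; rewrite subr_eq0 => /eqP.
- by rewrite -xy => /esym/eqP; rewrite subr_eq0 => /eqP.
- by move=> /(_ erefl).
Qed.

Lemma RII_inside : m = RII -> e = 1 \/ e = -1 ->
  \sum_(p \in crossings D `&` [set p | B (c p.1)]) crossing_chain gamma p = 0.
Proof.
move=> mE eE; have n0 : (0 < n)%N by rewrite mE.
have n1 : (1 < n)%N by rewrite mE.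
have nE i : (i < n)%N -> i = 0%N \/ i = 1%N by rewrite mE; case: i => [|[|]]; [left|right|].
have [e1|e1] := eE; last first.
  rewrite (@sum_in _ _ _ gamma B [::]) //; first by rewrite big_nil.
  move=> s t st sB; have [i [j [u [v [[ni nj] ui vj E [ij _]]]]]] := B_double st sB.
  have [_ _ x2] := RII_strands mE ni nj E ij.
  by have := sqr_ge0 (phi i u); rewrite x2 e1; lra.
(* Any bound larger than 1 that keeps the strands in the disc will do. *)
have disc i x : (i < n)%N -> x ^+ 2 <= 3 / 2 -> std_disc (strand m e i x).
  move=> /nE ni; have := sqr_ge0 x; rewrite /std_disc mE e1.
  by case: ni => -> /=; move: (x ^+ 2) => w; nra.
have param i x : (i < n)%N -> x ^+ 2 = 1 ->
    exists s, [/\ a i <= s <= b i, a i < s < b i & phi i s = x].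
  move=> ni x1; have [|s si sx] := phi_surj ni (disc i x ni _); first by rewrite x1; lra.
  exists s; split=> //; apply: (@arc_interior i (- (6 / 5)) x (6 / 5) s ni) => //.
  - by apply: disc => //; lra.
  - by apply: disc => //; lra.
  - by apply/andP; split; nra.
have m1 : (-1) ^+ 2 = 1 :> R by rewrite sqrrN expr1n.
have p1 : 1 ^+ 2 = 1 :> R by rewrite expr1n.
have [s0 [s0i s0i' s0E]] := param 0 (-1) n0 m1.
have [s1 [s1i s1i' s1E]] := param 1 (-1) n1 m1.
have [t0 [t0i t0i' t0E]] := param 0 1 n0 p1.
have [t1 [t1i t1i' t1E]] := param 1 1 n1 p1.
(* The two strands cross at the abscissas [-1] and [1] only. *)
have between i s t : (i < n)%N -> a i <= s <= b i -> a i <= t <= b i ->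
    phi i s = -1 -> phi i t = 1 -> east i s = west i t.
  move=> ni si ti sE tE; apply: east_west => //; rewrite sE tE; first by lra.
  move=> z zi /andP[z1 z2] /(arc_double ni zi)[j [v [nj vj E ij _]]].
  by have [_ _] := RII_strands mE ni nj E ij; rewrite e1; nra.
have strandE x : x ^+ 2 = 1 -> strand m e 0 x = strand m e 1 x.
  by move=> x1; rewrite mE /= x1 e1 subrr.
have ds : double_point c (theta s0) (theta s1).
  by apply: (strand_double n0 n1 s0i s1i) => //; rewrite s0E s1E; exact: strandE.
have dt : double_point c (theta t1) (theta t0).
  apply: (strand_double n1 n0 t1i t0i) => //; rewrite t0E t1E; apply/esym; exact: strandE.
have mI : m <> RI by rewrite mE.
have [|KA [wA0 eA0 wA1 eA1 [relA [pA [pAD pAE chainA]]]]] :=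
  picture_crossing mI n0 n1 s0i' s1i' ds _.
  by rewrite /slope mE s0E; lra.
have [|KB [wB1 eB1 wB0 eB0 [relB [pB [pBD pBE chainB]]]]] :=
  picture_crossing mI n1 n0 t1i' t0i' dt _.
  by rewrite /slope mE t0E; lra.
have gE : dover D (theta t1) = ~~ dover D (theta s0).
  have := dover_under dt; have dt' := double_pointC dt.
  rewrite (heights n0 n1 _ t0i t1i dt') // -(heights n0 n1 _ s0i s1i ds) //.
  by case: (dover D (theta t1)); case: (dover D (theta s0)).
have := between 0%N s0 t0 n0 s0i t0i s0E t0E; rewrite eA0 wB0 => -[KFT KTT].
have := between 1%N s1 t1 n1 s1i t1i s1E t1E; rewrite eA1 wB1 => -[KFF _].
move: relB chainB; rewrite gE => relB chainB.
(* Three of the four colours are shared by the two crossings, and the heap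
   relation determines the last one. *)
have KTF : KA true false = KB false true.
  move: relA relB; rewrite /pair_rel /crossing_rel /over_first.
  case: (dover D _); case: (o 0); case: (o 1) => /=; rewrite ?KFT ?KTT ?KFF => E1 E2;
    first [ exact: etrans E1 (esym E2)
          | exact: heap_inj1 (etrans (esym E1) E2)
          | exact: heap_inj2 (etrans (esym E1) E2)
          | exact: heap_inj3 (etrans (esym E1) E2) ].
have L1 : uniq [seq c q.1 | q <- [:: pA; pB]].
  rewrite /= inE andbT pAE pBE; apply/eqP => /(arc_point_eq n0 n1 s0i t1i).
  by rewrite s0E t1E mE /= => -[]; lra.
have L2 q : q \in [:: pA; pB] -> crossing_param D q /\ B (c q.1).
  rewrite !inE => /orP[] /eqP ->; rewrite ?pAE ?pBE.
    by split; [exact: pAD | exact: arc_B s0i].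
  by split; [exact: pBD | exact: arc_B t1i].
rewrite (sum_in gamma L1 L2); last first.
  move=> s' t' st' sB; have [i [j [u [v [[ni nj] ui vj E [ij <-]]]]]] := B_double st' sB.
  have [ne xy] := RII_strands mE ni nj E ij; rewrite e1 => /eqP.
  rewrite sqrf_eq1 /= !inE pAE pBE => /orP[] /eqP x1; apply/orP; [right|left]; apply/eqP.
    apply: (arc_point_eq ni n1 ui t1i).1; rewrite t1E x1.
    by case: (nE _ ni) => -> //; exact: strandE.
  apply: (arc_point_eq ni n0 ui s0i).1; rewrite s0E x1.
  by case: (nE _ ni) => -> //; rewrite strandE.
rewrite big_cons big_seq1 chainA chainB /pair_chain.
have -> : over_first (~~ dover D (theta s0)) (o 1) (o 0) KB =
          over_first (dover D (theta s0)) (o 0) (o 1) KA.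
  apply/funext => x; apply/funext => y; rewrite /over_first.
  by case: (dover D _); case: (o 0); case: (o 1); case: x; case: y => /=;
     rewrite ?KFT ?KTT ?KFF ?KTF.
by case: (dover D _); case: (o 0); case: (o 1) => /=; rewrite ?expr0 ?expr1 scale1r scaleN1r ?subrr ?addNr.
Qed.

(** * The third move *)

(** The abscissa of the crossing of two of the three strands. *)
Definition isect (i j : nat) : R :=
  match (i + j)%N with 1 => 0 | 2 => e | _ => - e end.

Lemma RIII_strands i j x y : m = RIII -> (i < n)%N -> (j < n)%N ->
  strand m e i x = strand m e j y -> (i = j -> x <> y) ->
  [/\ i <> j, x = y & x = isect i j].
Proof.
rewrite /isect => ->.
case: i => [|[|[|//]]] _; case: j => [|[|[|//]]] _ /= E ij;
  have /= E1 := congr1 fst E; have /= E2 := congr1 snd E;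
  first [by case: (ij erefl E1) | by split=> //; lra].
Qed.

(** An arc of the third picture passes through two crossings, at [u] and [v]. *)
Lemma arc_two i u v : m = RIII -> (i < n)%N -> a i <= u <= b i -> a i <= v <= b i ->
  phi i u < phi i v ->
  (forall j, (j < n)%N -> i <> j -> isect i j = phi i u \/ isect i j = phi i v) ->
  [/\ west i (arc_start i) = west i u, east i u = west i v &
      east i v = east i (arc_end i)].
Proof.
move=> mE ni ui vi uv all.
have dbl z : a i <= z <= b i -> double_param D (theta z) ->
    phi i z = phi i u \/ phi i z = phi i v.
  move=> zi /(arc_double ni zi)[j [w [nj wj E ij _]]].
  by have [ne _ ->] := RIII_strands mE ni nj E ij; exact: all.
move: mE => _; split.
- by apply: west_start => // z zi zu /(dbl z zi)[] zE; lra.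
- by apply: east_west => // z zi /andP[z1 z2] /(dbl z zi)[] zE; lra.
- by apply: east_end => // z zi zu /(dbl z zi)[] zE; lra.
Qed.

(** The conditions on the colours [P x0 x1 x2] of the regions of the third
picture, where [xi] tells whether the region lies below the [i]-th strand, and
the chain of its three crossings; [eps] tells whether the crossing of the
strands [y = x] and [y = - x] lies below the strand [y = e]. The position of
each crossing relative to the remaining strand selects a face of the cube. *)
Definition triple_rel (eps : bool) (P : bool -> bool -> bool -> X) :=
  [/\ pair_rel (ht 0 < ht 1)%N (o 1) (o 0) (fun x y : bool => P y x eps),
      pair_rel (ht 0 < ht 2)%N (o 2) (o 0) (fun x y : bool => P y (~~ eps) x) &
      pair_rel (ht 2 < ht 1)%N (o 1) (o 2) (fun x y : bool => P (~~ eps) x y)].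

Definition triple_chain (eps : bool) (P : bool -> bool -> bool -> X) : chain X 1 :=
  pair_chain (ht 0 < ht 1)%N (o 1) (o 0) (fun x y : bool => P y x eps) +
  pair_chain (ht 0 < ht 2)%N (o 2) (o 0) (fun x y : bool => P y (~~ eps) x) +
  pair_chain (ht 2 < ht 1)%N (o 1) (o 2) (fun x y : bool => P (~~ eps) x y).

(** The chain of the third picture, and the colours at the ends of the arcs: six of
the seven regions meet the boundary of [B]. *)
Lemma RIII_inside : m = RIII -> e = 1 \/ e = -1 -> exists P,
  [/\ [/\ west 1 (arc_start 1) = (P false false false, P false true false),
          west 2 (arc_start 2) = (P false true false, P false true true) &
          west 0 (arc_start 0) = (P false true true, P true true true)],
      [/\ east 0 (arc_end 0) = (P false false false, P true false false),
          east 2 (arc_end 2) = (P true false false, P true false true) &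
          east 1 (arc_end 1) = (P true false true, P true true true)],
      triple_rel (0 < e) P &
      \sum_(p \in crossings D `&` [set p | B (c p.1)]) crossing_chain gamma p =
      triple_chain (0 < e) P].
Proof.
move=> mE eE; have n0 : (0 < n)%N by rewrite mE.
have n1 : (1 < n)%N by rewrite mE.
have n2 : (2 < n)%N by rewrite mE.
have mI : m <> RI by rewrite mE.
have nE i : (i < n)%N -> [\/ i = 0%N, i = 1%N | i = 2%N].
  by rewrite mE; case: i => [|[|[|//]]] _; [constructor 1|constructor 2|constructor 3].
have ee : e * e = 1 by case: eE => ->; rewrite ?mulrNN mulr1.
have disc i x : (i < n)%N -> x * x <= 3 / 2 -> std_disc (strand m e i x).
  move=> /nE ni xx; rewrite /std_disc mE.
  by case: ni => -> /=; rewrite !expr2 ?mulrNN ?ee; lra.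
have param i x : (i < n)%N -> x = 0 \/ x * x = 1 ->
    exists s, [/\ a i <= s <= b i, a i < s < b i & phi i s = x].
  move=> ni x1; have xx : x * x <= 1 by case: x1 => [->|->]; rewrite ?mulr0 ?ler01.
  have [|s si sx] := phi_surj ni (disc i x ni _); first by lra.
  exists s; split=> //; apply: (@arc_interior i (- (6 / 5)) x (6 / 5) s ni) => //.
  - by apply: disc => //; lra.
  - by apply: disc => //; lra.
  - by apply/andP; split; nra.
have [s1 [s1i s1i' s1E]] := param 1 0 n1 (or_introl erefl).
have [s0 [s0i s0i' s0E]] := param 0 0 n0 (or_introl erefl).
have [r2 [r2i r2i' r2E]] := param 2 e n2 (or_intror ee).
have [r0 [r0i r0i' r0E]] := param 0 e n0 (or_intror ee).
have ee' : - e * - e = 1 by rewrite mulrNN.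
have [q1 [q1i q1i' q1E]] := param 1 (- e) n1 (or_intror ee').
have [q2 [q2i q2i' q2E]] := param 2 (- e) n2 (or_intror ee').
have ds : double_point c (theta s1) (theta s0).
  by apply: (strand_double n1 n0 s1i s0i) => //; rewrite s1E s0E mE /= oppr0.
have dr : double_point c (theta r2) (theta r0).
  by apply: (strand_double n2 n0 r2i r0i) => //; rewrite r2E r0E mE.
have dq : double_point c (theta q1) (theta q2).
  by apply: (strand_double n1 n2 q1i q2i) => //; rewrite q1E q2E mE /= opprK.
have [|K [wK1 eK1 wK0 eK0 [relK [p [pD pE chainK]]]]] :=
  picture_crossing mI n1 n0 s1i' s0i' ds _; first by rewrite /slope mE; lra.
have [|L [wL2 eL2 wL0 eL0 [relL [l [lD lE chainL]]]]] :=
  picture_crossing mI n2 n0 r2i' r0i' dr _; first by rewrite /slope mE; lra.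
have [|M [wM1 eM1 wM2 eM2 [relM [w [wD wE chainM]]]]] :=
  picture_crossing mI n1 n2 q1i' q2i' dq _; first by rewrite /slope mE; lra.
rewrite (heights n1 n0 _ s1i s0i ds) // in relK chainK.
rewrite (heights n2 n0 _ r2i r0i dr) // in relL chainL.
rewrite (heights n1 n2 _ q1i q2i dq) // in relM chainM.
have e0 : e != 0 by apply/eqP => e0; move: ee; rewrite e0 mul0r => /esym/eqP; rewrite oner_eq0.
have L1 : uniq [seq c q.1 | q <- [:: p; l; w]].
  rewrite /= !inE andbT negb_or pE lE wE; apply/andP; split; [apply/andP; split|];
    apply/eqP.
  - move=> /(arc_point_eq n1 n2 s1i r2i); rewrite s1E r2E mE /= => -[/esym/eqP].
    by rewrite (negbTE e0).
  - move=> /(arc_point_eq n1 n1 s1i q1i); rewrite s1E q1E mE /= => -[/esym/eqP].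
    by rewrite oppr_eq0 (negbTE e0).
  - move=> /(arc_point_eq n2 n1 r2i q1i); rewrite r2E q1E mE /= => -[E _].
    by move/eqP: e0; lra.
have L2 q : q \in [:: p; l; w] -> crossing_param D q /\ B (c q.1).
  rewrite !inE => /or3P[] /eqP ->; rewrite ?pE ?lE ?wE.
  - by split; [exact: pD | exact: arc_B s1i].
  - by split; [exact: lD | exact: arc_B r2i].
  - by split; [exact: wD | exact: arc_B q1i].
have L3 s t : double_point c s t -> B (c s) -> c s \in [seq c q.1 | q <- [:: p; l; w]].
  move=> st sB; have [i [j [u [v [[ni nj] ui vj E [ij <-]]]]]] := B_double st sB.
  have [ne _ uE] := RIII_strands mE ni nj E ij.
  rewrite /= !inE pE lE wE; apply/or3P.
  have pick k z : (k < n)%N -> a k <= z <= b k ->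
      strand m e i (isect i j) = strand m e k (phi k z) -> C u == C z.
    by move=> nk zk; rewrite -uE => /(arc_point_eq ni nk ui zk) ->.
  case: (nE _ ni) pick ne => ->; case: (nE _ nj) => -> // pick ne.
  - by apply: Or31; apply: (pick 1%N) => //; rewrite s1E mE /= oppr0.
  - by apply: Or32; apply: (pick 2%N) => //; rewrite r2E mE.
  - by apply: Or31; apply: (pick 1%N) => //; rewrite s1E mE.
  - by apply: Or33; apply: (pick 1%N) => //; rewrite q1E mE.
  - by apply: Or32; apply: (pick 2%N) => //; rewrite r2E mE.
  - by apply: Or33; apply: (pick 1%N) => //; rewrite q1E mE /= opprK.
have sumE : \sum_(p \in crossings D `&` [set p | B (c p.1)]) crossing_chain gamma p =
    pair_chain (ht 0 < ht 1)%N (o 1) (o 0) K +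
    pair_chain (ht 0 < ht 2)%N (o 2) (o 0) L +
    pair_chain (ht 2 < ht 1)%N (o 1) (o 2) M.
  apply: etrans (sum_in gamma L1 L2 L3) _; rewrite -chainK -chainL -chainM.
  rewrite big_cons big_cons big_seq1; exact: addrA.
rewrite sumE => {sumE L1 L2 L3 chainK chainL chainM pE lE wE pD lD wD}.
(* The sign of [e] decides which crossing each arc meets first. *)
case: eE => eE.
  have [eP eN eNP] : [/\ 0 < e, - e < 0 & - e < e] by rewrite eE; split; lra.
  have [S1 M1 E1] : [/\ west 1 (arc_start 1) = west 1 q1, east 1 q1 = west 1 s1 &
      east 1 s1 = east 1 (arc_end 1)].
    apply: (arc_two mE n1 q1i s1i); rewrite q1E s1E; first exact: eN.
    by move=> j /nE[] -> ne; [right | case: ne | left].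
  have [S0 M0 E0] : [/\ west 0 (arc_start 0) = west 0 s0, east 0 s0 = west 0 r0 &
      east 0 r0 = east 0 (arc_end 0)].
    apply: (arc_two mE n0 s0i r0i); rewrite s0E r0E; first exact: eP.
    by move=> j /nE[] -> ne; [case: ne | left | right].
  have [S2 M2 E2] : [/\ west 2 (arc_start 2) = west 2 q2, east 2 q2 = west 2 r2 &
      east 2 r2 = east 2 (arc_end 2)].
    apply: (arc_two mE n2 q2i r2i); rewrite q2E r2E; first exact: eNP.
    by move=> j /nE[] -> ne; [right | left | case: ne].
  rewrite S1 S0 S2 -E1 -E0 -E2 wM1 wM2 wK0 eK1 eL0 eL2 eP.
  move: M1 M0 M2; rewrite eM1 wK1 eK0 wL0 eM2 wL2 => -[M1 M1'] [M0 M0'] [M2 M2'].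
  have [|||P [KP LP MP]] := @triple_family _ true K L M; [by case|by case|by case|].
  rewrite {}KP {}LP {}MP in relK relL relM *; exists P.
  split; [split; exact: erefl | split; exact: erefl | | exact: erefl].
  by split; [exact: relK | exact: relL | exact: relM].
have [eP eN eNP] : [/\ e < 0, 0 < - e & e < - e] by rewrite eE; split; lra.
have [S1 M1 E1] : [/\ west 1 (arc_start 1) = west 1 s1, east 1 s1 = west 1 q1 &
    east 1 q1 = east 1 (arc_end 1)].
  apply: (arc_two mE n1 s1i q1i); rewrite q1E s1E; first exact: eN.
  by move=> j /nE[] -> ne; [left | case: ne | right].
have [S0 M0 E0] : [/\ west 0 (arc_start 0) = west 0 r0, east 0 r0 = west 0 s0 &
    east 0 s0 = east 0 (arc_end 0)].
  apply: (arc_two mE n0 r0i s0i); rewrite s0E r0E; first exact: eP.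
  by move=> j /nE[] -> ne; [case: ne | right | left].
have [S2 M2 E2] : [/\ west 2 (arc_start 2) = west 2 r2, east 2 r2 = west 2 q2 &
    east 2 q2 = east 2 (arc_end 2)].
  apply: (arc_two mE n2 r2i q2i); rewrite q2E r2E; first exact: eNP.
  by move=> j /nE[] -> ne; [left | right | case: ne].
have e0F : (0 < e) = false by rewrite ltNge ltW.
rewrite S1 S0 S2 -E1 -E0 -E2 wK1 wL2 wL0 eM1 eK0 eM2 e0F.
move: M1 M0 M2; rewrite eK1 wM1 eL0 wK0 eL2 wM2 => -[M1 M1'] [M0 M0'] [M2 M2'].
have [|||P [KP LP MP]] := @triple_family _ false K L M; [by case|by case|by case|].
rewrite {}KP {}LP {}MP in relK relL relM *; exists P.
split; [split; exact: erefl | split; exact: erefl | | exact: erefl].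
by split; [exact: relK | exact: relL | exact: relM].
Qed.

End Picture.

(** * The boundary of a 2-simplex and the third move *)

(* The signs of the six terms depend on four bits; up to a global sign their sum
   is the boundary [bd w] given by [wE]. *)
Ltac close_signs o eps w wE :=
  move: wE; case: (o 0); case: (o 1); case: (o 2); case: (eps);
  rewrite /= ?expr0 ?expr1 ?scale1r ?scaleN1r => wE;
  first [ by exists w; rewrite wE; chain_ring
        | by exists (- w); rewrite raddfN /= wE; chain_ring ].

Section ThirdMove.
Variable X : ternaryGroupType.
Implicit Types (Q : bool -> bool -> bool -> X).

(** Let [Q x y z] be the colour of the region that lies on the right of the top
strand iff [x], of the middle strand iff [y] and of the bottom strand iff [z].
The triples of the crossings on the six faces of the cube add up to a boundary
as soon as each face satisfies the heap relation. *)
Lemma bd_triple Q :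
  (forall z, crossing_rel (fun x y => Q x y z)) ->
  (forall z, crossing_rel (fun x y => Q x z y)) ->
  (forall z, crossing_rel (fun x y => Q z x y)) ->
  exists w : chain X 2, bd w =
  (crossing_simplex (fun x y => Q true x y) - crossing_simplex (fun x y => Q false x y)) -
  (crossing_simplex (fun x y => Q x true y) - crossing_simplex (fun x y => Q x false y)) +
  (crossing_simplex (fun x y => Q x y true) - crossing_simplex (fun x y => Q x y false)).
Proof.
move=> rTM rTW rMW.
exists << [tuple Q false false false; Q true false false; Q true true false;
               Q true true true] >>.
rewrite bd_simplex4 /crossing_simplex.
have E1 := rTM false; have E2 := rMW true; have E3 := rTW true; have E4 := rTW false.
rewrite /crossing_rel /= in E1 E2 E3 E4.
have -> : heap (Q false false false) (Q true false false) (Q true true true) = Q false true true.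
  by rewrite E3 E1 heapA heapKl.
have -> : heap (Q false false false) (Q true true false) (Q true true true) = Q false false true.
  by rewrite E4 E2 -heapA heapK.
by rewrite -E1 -E2; chain_ring.
Qed.

Variables (o : nat -> bool) (ht : nat -> nat).

(** The colours in terms of the sides, left or right, of the three oriented
strands, instead of their positions above or below. *)
Definition by_side Q (x0 x1 x2 : bool) : X :=
  Q (x0 (+) o 0%N) (x1 (+) o 1%N) (x2 (+) o 2%N).

Lemma triple_rel_sides Q eps : triple_rel o ht eps Q -> triple_rel o ht (~~ eps) Q ->
  let S := by_side Q in
  [/\ forall z, crossing_rel (fun x y => if (ht 0 < ht 1)%N then S y x z else S x y z),
      forall z, crossing_rel (fun x y => if (ht 0 < ht 2)%N then S y z x else S x z y) &
      forall z, crossing_rel (fun x y => if (ht 2 < ht 1)%N then S z x y else S z y x)].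
Proof.
move=> [r10 r20 r12] [r10' r20' r12'] S; rewrite /S /by_side.
split=> z.
- have [zE|zE] : z (+) o 2 = eps \/ z (+) o 2 = ~~ eps by case: (z (+) _); case: (eps); auto.
    by rewrite zE; move: r10; rewrite /pair_rel /crossing_rel /over_first; case: ifP.
  by rewrite zE; move: r10'; rewrite /pair_rel /crossing_rel /over_first; case: ifP.
- have [zE|zE] : z (+) o 1 = ~~ eps \/ z (+) o 1 = ~~ ~~ eps.
    by case: (z (+) _); case: (eps); auto.
    by rewrite zE; move: r20; rewrite /pair_rel /crossing_rel /over_first; case: ifP.
  by rewrite zE; move: r20'; rewrite /pair_rel /crossing_rel /over_first; case: ifP.
- have [zE|zE] : z (+) o 0 = ~~ eps \/ z (+) o 0 = ~~ ~~ eps.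
    by case: (z (+) _); case: (eps); auto.
    by rewrite zE; move: r12; rewrite /pair_rel /crossing_rel /over_first; case: ifP.
  by rewrite zE; move: r12'; rewrite /pair_rel /crossing_rel /over_first; case: ifP.
Qed.

(** Reading a crossing along the strands rather than along its orientation. *)
Lemma pair_chain_side g oi oj (K S : bool -> bool -> X) :
  (forall x y, K x y = S (x (+) oi) (y (+) oj)) ->
  pair_chain g oi oj K = (-1) ^+ (g (+) ~~ (oi (+) oj)) *:
    crossing_simplex (fun x y => if g then S x y else S y x).
Proof.
move=> KS; rewrite /pair_chain; congr (_ *: crossing_simplex _).
apply/funext => x; apply/funext => y; rewrite /over_first !KS.
by case: g; rewrite -!addbA !addbb !addbF.
Qed.

Lemma triple_boundary Q eps : triple_rel o ht eps Q -> triple_rel o ht (~~ eps) Q ->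
  exists w : chain X 2, triple_chain o ht eps Q - triple_chain o ht (~~ eps) Q = bd w.
Proof.
move=> r r'; have [] := triple_rel_sides r r'; rewrite /triple_chain.
have Q10 z : pair_chain (ht 0 < ht 1)%N (o 1) (o 0) (fun x y : bool => Q y x z) =
    (-1) ^+ ((ht 0 < ht 1)%N (+) ~~ (o 1 (+) o 0)) *: crossing_simplex (fun x y =>
      if (ht 0 < ht 1)%N then by_side Q y x (z (+) o 2) else by_side Q x y (z (+) o 2)).
  apply: (@pair_chain_side _ _ _ _ (fun x y => by_side Q y x (z (+) o 2))) => x y.
  by rewrite /by_side -!addbA !addbb !addbF.
have Q20 z : pair_chain (ht 0 < ht 2)%N (o 2) (o 0) (fun x y : bool => Q y z x) =
    (-1) ^+ ((ht 0 < ht 2)%N (+) ~~ (o 2 (+) o 0)) *: crossing_simplex (fun x y =>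
      if (ht 0 < ht 2)%N then by_side Q y (z (+) o 1) x else by_side Q x (z (+) o 1) y).
  apply: (@pair_chain_side _ _ _ _ (fun x y => by_side Q y (z (+) o 1) x)) => x y.
  by rewrite /by_side -!addbA !addbb !addbF.
have Q12 z : pair_chain (ht 2 < ht 1)%N (o 1) (o 2) (fun x y : bool => Q z x y) =
    (-1) ^+ ((ht 2 < ht 1)%N (+) ~~ (o 1 (+) o 2)) *: crossing_simplex (fun x y =>
      if (ht 2 < ht 1)%N then by_side Q (z (+) o 0) x y else by_side Q (z (+) o 0) y x).
  apply: (@pair_chain_side _ _ _ _ (fun x y => by_side Q (z (+) o 0) x y)) => x y.
  by rewrite /by_side -!addbA !addbb !addbF.
rewrite !Q10 !Q20 !Q12 {Q10 Q20 Q12 r r'}; move: (by_side Q) => S.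
(* The three comparisons of heights form one of the six linear orders. *)
have transitive : [|| (ht 0 < ht 2)%N, ~~ (ht 0 < ht 1)%N | (ht 2 < ht 1)%N] &&
    [|| ~~ (ht 0 < ht 2)%N, (ht 0 < ht 1)%N | ~~ (ht 2 < ht 1)%N].
  by apply/andP; split; do 3! (case: ltnP => //=) => *; lia.
move: transitive; case: ltnP => _; case: ltnP => _; case: ltnP => _ //= _ r10 r20 r12.
- by have [w wE] := bd_triple (Q := fun x y z => S z x y) r12 r10 r20; close_signs o eps w wE.
- by have [w wE] := bd_triple (Q := fun x y z => S z y x) r12 r20 r10; close_signs o eps w wE.
- by have [w wE] := bd_triple (Q := fun x y z => S y z x) r20 r12 r10; close_signs o eps w wE.
- by have [w wE] := bd_triple (Q := fun x y z => S y x z) r10 r12 r20; close_signs o eps w wE.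
- by have [w wE] := bd_triple (Q := fun x y z => S x y z) r10 r20 r12; close_signs o eps w wE.
- by have [w wE] := bd_triple (Q := fun x y z => S x z y) r20 r10 r12; close_signs o eps w wE.
Qed.

(** The two sides of the third move only differ in the colour of the triangle
between the three strands. *)
Lemma triple_move P P' eps :
  [/\ P false false false = P' false false false, P false true false = P' false true false &
      P false true true = P' false true true] ->
  [/\ P true true true = P' true true true, P true false false = P' true false false &
      P true false true = P' true false true] ->
  triple_rel o ht eps P -> triple_rel o ht (~~ eps) P' ->
  exists w : chain X 2, triple_chain o ht eps P - triple_chain o ht (~~ eps) P' = bd w.
Proof.
(* At each vertex of the cube, take the colour of a picture where it occurs. *)
move=> [e000 e010 e011] [e111 e100 e101].
pose Q (x y z : bool) := if [&& x == eps, y == eps & z == ~~ eps] then P' x y z else P x y z.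
have QP x y z : [|| x == ~~ eps, y == ~~ eps | z == eps] -> P x y z = Q x y z.
  by rewrite /Q; case: (eps); case: x; case: y; case: z => //= _; rewrite ?e000 ?e010 ?e011.
have QP' x y z : [|| x == eps, y == eps | z == ~~ eps] -> P' x y z = Q x y z.
  rewrite /Q; case: (eps); case: x; case: y; case: z => //= _; symmetry;
    by [exact: e000|exact: e010|exact: e011|exact: e111|exact: e100|exact: e101].
have E1 : (fun x y : bool => P y x eps) = (fun x y : bool => Q y x eps).
  by apply/funext => x; apply/funext => y; apply: QP; case: (eps); case: x; case: y.
have E2 : (fun x y : bool => P y (~~ eps) x) = (fun x y : bool => Q y (~~ eps) x).
  by apply/funext => x; apply/funext => y; apply: QP; case: (eps); case: x; case: y.
have E3 : (fun x y : bool => P (~~ eps) x y) = (fun x y : bool => Q (~~ eps) x y).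
  by apply/funext => x; apply/funext => y; apply: QP; case: (eps); case: x; case: y.
have E1' : (fun x y : bool => P' y x (~~ eps)) = (fun x y : bool => Q y x (~~ eps)).
  by apply/funext => x; apply/funext => y; apply: QP'; case: (eps); case: x; case: y.
have E2' : (fun x y : bool => P' y (~~ ~~ eps) x) = (fun x y : bool => Q y (~~ ~~ eps) x).
  by apply/funext => x; apply/funext => y; apply: QP'; case: (eps); case: x; case: y.
have E3' : (fun x y : bool => P' (~~ ~~ eps) x y) = (fun x y : bool => Q (~~ ~~ eps) x y).
  by apply/funext => x; apply/funext => y; apply: QP'; case: (eps); case: x; case: y.
have rE : triple_rel o ht eps P = triple_rel o ht eps Q by rewrite /triple_rel E1 E2 E3.
have rE' : triple_rel o ht (~~ eps) P' = triple_rel o ht (~~ eps) Q.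
  by rewrite /triple_rel E1' E2' E3'.
have cE : triple_chain o ht eps P = triple_chain o ht eps Q by rewrite /triple_chain E1 E2 E3.
have cE' : triple_chain o ht (~~ eps) P' = triple_chain o ht (~~ eps) Q.
  by rewrite /triple_chain E1' E2' E3'.
by rewrite rE rE' cE cE'; exact: triple_boundary.
Qed.

End ThirdMove.

(** * Reidemeister moves *)

Section Arcs.
Variable R : realType.
Implicit Types (a b : nat -> R) (n i j : nat).

(** Just before an arc starts, the curve is on no arc: the arcs are finitely many
closed intervals that are disjoint on the circle. *)
Lemma arc_isolated_left n a b i : (n <= 3)%N -> (i < n)%N ->
  (forall i, (i < n)%N -> a i < b i) ->
  (forall i j s t (k : int), (i < n)%N -> (j < n)%N ->
    a i <= s <= b i -> a j <= t <= b j -> s - t = k%:~R -> i = j /\ k = 0) ->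
  exists2 d : R, 0 < d & forall x, 0 < x < d -> forall j (k : int), (j < n)%N ->
    ~ (a j <= a i - x + k%:~R <= b j).
Proof.
move=> n3 ni ab disj.
(* The distance from [a i] to the last translate of [b j] before it. *)
pose d j := a i - b j + (Num.floor (b j - a i) + 1)%:~R.
have d0 j : 0 < d j by rewrite /d; have := floorD1_gt (b j - a i); lra.
exists (Num.min (d 0%N) (Num.min (d 1%N) (d 2%N))) => [|x]; first by rewrite !lt_min !d0.
rewrite !lt_min => /andP[x0 /and3P[x1 x2 x3]] j k nj /andP[jk1 jk2].
have xd : x < d j by move: (leq_trans nj n3); case: (j) => [|[|[|]]].
have [bk|bk] := ltP (b j) (a i + k%:~R).
  have : (Num.floor (b j - a i) + 1)%:~R <= k%:~R :> R.
    by rewrite ler_int lezD1 floor_lt_int; lra.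
  by move: xd; rewrite /d; lra.
have [||| ij k0] := disj j i (a i + k%:~R) (a i) k nj ni.
- by apply/andP; split; lra.
- by rewrite lexx ltW ?ab.
- by rewrite addrC addKr.
by move: jk1; rewrite ij k0 addr0; lra.
Qed.

Lemma arc_isolated_right n a b i : (n <= 3)%N -> (i < n)%N ->
  (forall i, (i < n)%N -> a i < b i) ->
  (forall i j s t (k : int), (i < n)%N -> (j < n)%N ->
    a i <= s <= b i -> a j <= t <= b j -> s - t = k%:~R -> i = j /\ k = 0) ->
  exists2 d : R, 0 < d & forall x, 0 < x < d -> forall j (k : int), (j < n)%N ->
    ~ (a j <= b i + x + k%:~R <= b j).
Proof.
move=> n3 ni ab disj.
have [||d d0 dP] := @arc_isolated_left n (fun j => - b j) (fun j => - a j) i n3 ni.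
- by move=> j nj; rewrite ltrN2 ab.
- move=> i' j s t k ni' nj /andP[s1 s2] /andP[t1 t2] st.
  have [|||-> k0] := disj i' j (- s) (- t) (- k) ni' nj.
  + by apply/andP; split; lra.
  + by apply/andP; split; lra.
  + by rewrite intrN -st; ring.
  by split=> //; apply/eqP; rewrite -oppr_eq0 k0.
exists d => // x xd j k nj /andP[t1 t2]; apply: (dP x xd j (- k) nj).
by rewrite intrN; apply/andP; split; lra.
Qed.

Lemma nstrands_le m : (nstrands m <= 3)%N. Proof. by case: m. Qed.

Lemma std_disc_closed : closed (@std_disc R).
Proof.
have cont : continuous (fun q : plane R => q.1 * q.1 + q.2 * q.2).
  by move=> q; apply: cvgD; apply: cvgM; first [exact: cvg_fst | exact: cvg_snd].
have -> : @std_disc R = (fun q : plane R => q.1 * q.1 + q.2 * q.2) @^-1` [set x | x <= 4].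
  by apply/funext => q; rewrite /std_disc /= !expr2.
by apply: preimage_closed => [q _|]; [exact: cont | exact: closed_le].
Qed.

Lemma diffeo_preimage_closed (h : plane R -> plane R) : oriented_diffeo h ->
  closed (h @^-1` @std_disc R).
Proof.
move=> [[dh _] _ _]; apply: preimage_closed => [q _|]; last exact: std_disc_closed.
exact: differentiable_continuous (dh q).
Qed.

Lemma id_reparam : circle_reparam (id : R -> R).
Proof.
split=> // t; split; first exact: derivable_id.
by rewrite derive1E derive_id ltr01.
Qed.

End Arcs.

Section Invariance.
Variables (R : realType) (X : ternaryGroupType) (D D' : knotDiagram R).
Variables (gamma : tgHom (pi1T D) X) (gamma' : tgHom (pi1T D') X).

(** The chains of two diagrams related by a move are homologous modulo degenerate
chains. *)
Lemma reidemeister_homologous m B : reidemeister m B D D' ->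
  colors_agree_outside B gamma gamma' ->
  exists w : chain X 2, diagram_chain gamma - diagram_chain gamma' - bd w \in @CD X 1.
Proof.
move=> [theta] /= [e [a [b [ o [ht [thetaP [eE [_ disj]] [pic pic'] same heights]]]]]] agree.
case: pic => h [phi [hP BE Barc arcP]]; case: pic' => h' [phi' [hP' BE' Barc' arcP']].
have Bclosed : closed B by rewrite BE; exact: diffeo_preimage_closed.
have sameB t : B (dcurve D t) <-> B (dcurve D' (theta t)).
  exact: iff_trans (Barc t) (iff_sym (Barc' t)).
have out := sum_out thetaP Bclosed same sameB agree.
have heightsD i j s t : (i < nstrands m)%N -> (j < nstrands m)%N -> i <> j ->
    a i <= s <= b i -> a j <= t <= b j -> double_point (dcurve D) s t ->
    dover D s = (ht j < ht i)%N.
  by move=> ni nj ij si tj; have [] := heights i j s t ni nj ij si tj.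
have heightsD' i j s t : (i < nstrands m)%N -> (j < nstrands m)%N -> i <> j ->
    a i <= s <= b i -> a j <= t <= b j -> double_point (dcurve D') (theta s) (theta t) ->
    dover D' (theta s) = (ht j < ht i)%N.
  move=> ni nj ij si tj [stE stN]; have [_ H] := heights i j s t ni nj ij si tj.
  by apply: H; split; [exact: stE | rewrite -(reparam_int thetaP)].
have idP := id_reparam R.
have eE' : - e = 1 \/ - e = -1 by case: eE => ->; [right | left; rewrite opprK].
rewrite (diagram_chain_split gamma B) (diagram_chain_split gamma' B) out opprD.
rewrite addrACA subrr addr0 => {out}.
have bd0 : bd (0 : chain X 2) = 0 by exact: raddf0.
case mE : m.
- exists 0; rewrite bd0 subr0; apply: rpredB.
    exact: (RI_inside gamma idP hP Barc arcP disj mE eE).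
  exact: (RI_inside gamma' thetaP hP' Barc' arcP' disj mE eE').
- exists 0.
  rewrite (RII_inside gamma idP hP Barc arcP disj heightsD mE eE).
  rewrite (RII_inside gamma' thetaP hP' Barc' arcP' disj heightsD' mE eE').
  by rewrite bd0 !subr0 rpred0.
have [P [[w1 w2 w0] [e0 e2 e1] rel ->]] :=
  RIII_inside gamma idP hP Barc arcP disj heightsD mE eE.
have [P' [[w1' w2' w0'] [e0' e2' e1'] rel' ->]] :=
  RIII_inside gamma' thetaP hP' Barc' arcP' disj heightsD' mE eE'.
have ab i : (i < nstrands m)%N -> a i < b i by move=> /arcP[].
(* At the ends of the arcs, the colours are those seen from outside [B]. *)
have bef i : (i < nstrands m)%N -> before gamma (a i) = before gamma' (theta (a i)).
  move=> ni; have [d d0 dP] := arc_isolated_left (nstrands_le m) ni ab disj.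
  apply: (side_out thetaP Bclosed same sameB agree); first by rewrite normrN normr1.
  exists d => // x xd; rewrite mulN1r => /Barc[j [k [nj tk]]]; exact: (dP x xd j k nj tk).
have aft i : (i < nstrands m)%N -> after gamma (b i) = after gamma' (theta (b i)).
  move=> ni; have [d d0 dP] := arc_isolated_right (nstrands_le m) ni ab disj.
  apply: (side_out thetaP Bclosed same sameB agree); first by rewrite normr1.
  exists d => // x xd; rewrite mul1r => /Barc[j [k [nj tk]]]; exact: (dP x xd j k nj tk).
have westE i : (i < nstrands m)%N ->
    west gamma id o i (arc_start a b o i) = west gamma' theta o i (arc_start a b o i).
  by move=> ni; rewrite /west /arc_start; case: (o i); rewrite ?bef ?aft.
have eastE i : (i < nstrands m)%N ->
    east gamma id o i (arc_end a b o i) = east gamma' theta o i (arc_end a b o i).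
  by move=> ni; rewrite /east /arc_end; case: (o i); rewrite ?bef ?aft.
have n0 : (0 < nstrands m)%N by rewrite mE.
have n1 : (1 < nstrands m)%N by rewrite mE.
have n2 : (2 < nstrands m)%N by rewrite mE.
have := westE 1%N n1; rewrite w1 w1' => -[c000 c010].
have := westE 2%N n2; rewrite w2 w2' => -[_ c011].
have := westE 0%N n0; rewrite w0 w0' => -[_ c111].
have := eastE 0%N n0; rewrite e0 e0' => -[_ c100].
have := eastE 2%N n2; rewrite e2 e2' => -[_ c101].
have eps : (0 < - e) = ~~ (0 < e).
  by case: eE => ->; rewrite ?opprK ?oppr_gt0 ?ltr01 ?ltr10 //.
rewrite eps in rel' *.
have [||w wE] := triple_move _ _ rel rel'; [by split|by split|].
by exists w; rewrite wE subrr rpred0.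
Qed.

End Invariance.

Theorem mainTheorem1 (R : realType) (X : ternaryGroupType)
    (D : knotDiagram R) (gamma : tgHom (pi1T D) X) :
  bd (diagram_chain gamma) = 0 /\
  bdN (piN (diagram_chain gamma)) = 0 /\
  forall (m : move_type) (B : set (R * R)) (D' : knotDiagram R)
    (gamma' : tgHom (pi1T D') X),
    reidemeister m B D D' ->
    colors_agree_outside B gamma gamma' ->
    HNclass (piN (diagram_chain gamma)) = HNclass (piN (diagram_chain gamma')).
Proof.
have cycle := bd_diagram_chain gamma.
split=> //; split=> [|m B D' gamma' move_D agree]; first exact: bdN_cycle.
have [w wP] := reidemeister_homologous move_D agree.
exact: HNclass_homologous wP.
Qed.
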